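(* Let $G$ be a finite simple graph without isolated vertices belonging to one of the following families: (1) co-chordal-cactus graphs; (2) $(2K_2,C_4)$-free graphs; (3) co-grid graphs. Then, for every $r\ge 2$, the clutter $\mathcal{C}_r(G)$ is co-chordal. Consequently, the ideal $I_r(G)$ has a linear resolution; equivalently, $\operatorname{reg}(I_r(G))=r+1$ for all $r\ge 2$.
   Context: Graphs. All graphs are finite and simple; $\overline{G}$ denotes the complement of $G$, and $G[A]$ the subgraph induced on $A\subseteq V(G)$. A graph is chordal if every cycle of length at least $4$ has a chord, i.e. it has no induced cycle of length at least $4$. A graph is $(2K_2,C_4)$-free if it contains neither two disjoint edges $2K_2$ nor the $4$-cycle $C_4$ as an induced subgraph. The grid graph $G_{n,m}=P_n\square P_m$ (Cartesian product of two paths) has vertex set $\{x_{i,j}: 1\le i\le n, 1\le j\le m\}$, with $x_{i,j}$ and $x_{k,\ell}$ adjacent iff $|i-k|+|j-\ell|=1$; a co-grid graph is the complement of a grid graph. A cactus graph is a graph (not necessarily connected) in which every edge lies in at most one cycle. Co-chordal-cactus graphs. $G$ is a co-chordal-cactus graph if $\overline{G}$ admits a representation $(T,\{H_e\}_{e\in E(T)})$ such that: (i) $T$ is a cactus graph (the skeleton of $\overline{G}$); (ii) for each $e\in E(T)$, $H_e$ is an induced subgraph of $\overline{G}$ and is either a cycle of length $\ge 3$ or a chordal graph; (iii) $V(\overline{G})=\bigcup_{e\in E(T)}V(H_e)$ and $E(\overline{G})=\bigcup_{e\in E(T)}E(H_e)$; (iv) for any distinct $e,f\in E(T)$, $|V(H_e)\cap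 V(H_f)|\le 1$, and the intersection is nonempty only when $e$ and $f$ share a common endpoint in $T$. Clutters. A clutter $\mathcal{C}$ on a finite vertex set $V(\mathcal{C})$ is a family $E(\mathcal{C})$ of subsets (edges), none containing another; it is $d$-uniform if all edges have cardinality $d$. The complement $\overline{\mathcal{C}}$ of a $d$-uniform clutter is the clutter on the same vertex set whose edges are the $d$-subsets of $V(\mathcal{C})$ not in $E(\mathcal{C})$. For $d$-uniform $\mathcal{C}$, a set $W\subseteq V(\mathcal{C})$ is a clique if every $d$-subset of $W$ is an edge (all sets of size $<d$ are cliques). For a $(d-1)$-subset $\sigma$ of $V(\mathcal{C})$, put $N_{\mathcal{C}}[\sigma]=\sigma\cup\{v\in V(\mathcal{C}): \sigma\cup\{v\}\in E(\mathcal{C})\}$; $\sigma$ is a maximal subedge if $N_{\mathcal{C}}[\sigma]\ne\sigma$, and a maximal subedge is simplicial if $N_{\mathcal{C}}[\sigma]$ is a clique. $\operatorname{Sim}(\mathcal{C})$ is the set of simplicial maximal subedges. The deletion $\mathcal{C}\setminus\sigma$ is the clutter on $V(\mathcal{C})$ with edges $\{e\in E(\mathcal{C}):\sigma\not\subseteq e\}$. A $d$-uniform clutter $\mathcal{C}$ is chordal if $E(\mathcal{C})=\emptyset$ or there is $\sigma\in\operatorname{Sim}(\mathcal{C})$ with $\mathcal{C}\setminus\sigma$ chordal; it is co-chordal if $\overline{\mathcal{C}}$ is chordal. Connected clutters and ideals. For $r\ge1$, $\mathcal{C}_r(G)$ is the $(r+1)$-uniform clutter on $V(G)$ whose edges are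 the sets $S$ with $|S|=r+1$ and $G[S]$ connected. Identifying vertices with the variables of a polynomial ring $R$ over a field $\mathbb{K}$, $I_r(G)\subseteq R$ is the ideal generated by the monomials $\prod_{x\in S}x$, $S\in E(\mathcal{C}_r(G))$. For a homogeneous ideal $I$ with graded Betti numbers $\beta_{i,j}(I)$, the Castelnuovo–Mumford regularity is $\operatorname{reg}(I)=\max\{j-i:\beta_{i,j}(I)\neq0\}$. A homogeneous ideal generated in a single degree $d$ has a linear resolution if $\beta_{i,j}(I)=0$ whenever $j\ne i+d$.
   Formalization: In (iv) the pieces H_e at a common endpoint u of T are also required to meet only in one vertex assigned to u; read literally, a star T admits every graph and G=2P_3, r=2 is a counterexample. reg(I_r(G))=r+1 is claimed only when I_r(G) is nonzero. *)

(* Defs.v *)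
From HB Require Import structures.
From mathcomp Require Import all_boot all_algebra.
From mathcomp.multinomials Require Import mpoly.

Set Implicit Arguments.
Unset Strict Implicit.
Unset Printing Implicit Defensive.

Import GRing.Theory.

(** * Graphs

    A finite simple graph is a symmetric irreflexive [rel V] on [V : finType];
    [symmetric] alone denotes the symmetric polynomials of [mpoly]. *)

Definition simple_graph (V : finType) (g : rel V) : Prop :=
  ssrbool.symmetric g /\ irreflexive g.

Definition no_isolated (V : finType) (g : rel V) : Prop :=
  forall x, exists y, g x y.

Definition compl_graph (V : finType) (g : rel V) : rel V :=
  fun x y => (x != y) && ~~ g x y.

Definition induced (V : finType) (g : rel V) (A : {set V}) :
  rel {x : V | x \in A} := relpre val g.
Arguments induced [V] g A.

Definition edges (V : finType) (g : rel V) : {set {set V}} :=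
  [set e : {set V} | [exists x, exists y, g x y && (e == [set x; y])]].

Definition graph_iso (V W : finType) (g : rel V) (h : rel W) : Prop :=
  exists f : V -> W, bijective f /\ forall x y, h (f x) (f y) = g x y.

(** [h] contains an induced copy of [g]. *)
Definition induced_copy (V W : finType) (g : rel V) (h : rel W) : Prop :=
  exists f : V -> W, injective f /\ forall x y, h (f x) (f y) = g x y.

(** The cycle [C_n]; only meant for [3 <= n]. *)
Definition cycle_graph (n : nat) : rel 'I_n :=
  fun i j => (i.+1 %% n == j) || (j.+1 %% n == i).
Arguments cycle_graph : clear implicits.

Definition two_K2 : rel (bool * bool) :=
  fun u v => (u.1 == v.1) && (u.2 != v.2).

Definition grid_graph (n m : nat) : rel ('I_n * 'I_m) :=
  fun u v => (u.1 - v.1) + (v.1 - u.1) + ((u.2 - v.2) + (v.2 - u.2)) == 1.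
Arguments grid_graph : clear implicits.

Definition chordal_graph (V : finType) (g : rel V) : Prop :=
  forall n, 4 <= n -> ~ induced_copy (cycle_graph n) g.

Definition is_cycle_graph (V : finType) (g : rel V) : Prop :=
  exists2 n, 3 <= n & graph_iso (cycle_graph n) g.

Definition twoK2_C4_free (V : finType) (g : rel V) : Prop :=
  ~ induced_copy two_K2 g /\ ~ induced_copy (cycle_graph 4) g.

Definition co_grid (V : finType) (g : rel V) : Prop :=
  exists n m, [/\ 0 < n, 0 < m & graph_iso (compl_graph (grid_graph n m)) g].

(** ** Cactus graphs

    A cycle of [t] (as a subgraph, not necessarily induced) is listed by a
    duplicate-free sequence of its vertices; it is determined by its edge set,
    so that rotations and reversals of the list give the same cycle. *)

Definition graph_cycle (V : finType) (t : rel V) (c : seq V) : bool :=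
  (3 <= size c) && ucycleb t c.

Definition cycle_edges (V : finType) (c : seq V) : {set {set V}} :=
  [set [set x; next c x] | x in c].

Definition cactus (V : finType) (t : rel V) : Prop :=
  forall (c1 c2 : seq V) (e : {set V}), graph_cycle t c1 -> graph_cycle t c2 ->
    e \in cycle_edges c1 -> e \in cycle_edges c2 ->
    cycle_edges c1 = cycle_edges c2.

(** ** Chordal-cactus representations

    [H e], for [e] an edge of the skeleton [t], is the vertex set of the
    (induced) piece replacing [e].  Pieces are glued along the skeleton: a
    vertex [u] of [t] stands for the vertex [a u] of [h], and two pieces can
    only meet in [a u] with [u] a common endpoint.  Without [a], i.e. if pieces
    at the same [u] could meet pairwise in unrelated points, every graph would
    have a representation: take a star as skeleton, and single edges (and
    single vertices) as pieces. *)

Record cactus_representation (V : finType) (h : rel V) (T : finType)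
    (t : rel T) (H : {set T} -> {set V}) (a : T -> V) : Prop := {
  skeleton_simple : simple_graph t;
  skeleton_cactus : cactus t;
  piece_type : forall e, e \in edges t ->
    is_cycle_graph (induced h (H e)) \/ chordal_graph (induced h (H e));
  piece_vertices : forall x, exists2 e, e \in edges t & x \in H e;
  piece_edges : forall x y, h x y ->
    exists2 e, e \in edges t & (x \in H e) && (y \in H e);
  piece_meet : forall e f, e \in edges t -> f \in edges t -> e != f ->
    #|H e :&: H f| <= 1;
  piece_adjacent : forall e f, e \in edges t -> f \in edges t -> e != f ->
    H e :&: H f != set0 -> e :&: f != set0;
  piece_glue : forall e f u x, e \in edges t -> f \in edges t -> e != f ->
    u \in e :&: f -> x \in H e :&: H f -> x = a u
}.

Definition co_chordal_cactus (V : finType) (g : rel V) : Prop :=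
  exists (T : finType) (t : rel T) (H : {set T} -> {set V}) (a : T -> V),
    cactus_representation (compl_graph g) t H a.

(** * Uniform clutters

    A [d]-uniform clutter on the vertex set [V] is given by its set of edges
    [E : {set {set V}}], all of cardinality [d]. *)

Section Clutter.
Variables (V : finType) (d : nat).
Implicit Types (E : {set {set V}}) (s W : {set V}).

Definition compl_clutter E : {set {set V}} :=
  [set e : {set V} | (#|e| == d) && (e \notin E)].

Definition clique E W : bool :=
  [forall e : {set V}, (e \subset W) && (#|e| == d) ==> (e \in E)].

Definition closed_nbhd E s : {set V} := s :|: [set v | v |: s \in E].

Definition maximal_subedge E s : bool :=
  (#|s|.+1 == d) && (closed_nbhd E s != s).

Definition Sim E : {set {set V}} :=
  [set s : {set V} | maximal_subedge E s && clique E (closed_nbhd E s)].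

Definition deletion E s : {set {set V}} := [set e in E | ~~ (s \subset e)].

Inductive chordal_clutter : {set {set V}} -> Prop :=
| Chordal_empty : chordal_clutter set0
| Chordal_deletion E s :
    s \in Sim E -> chordal_clutter (deletion E s) -> chordal_clutter E.

Definition co_chordal E : Prop := chordal_clutter (compl_clutter E).

End Clutter.

Definition connected_on (V : finType) (g : rel V) (S : {set V}) : bool :=
  (S != set0) &&
  [forall x in S, forall y in S,
     connect (fun u v => [&& u \in S, v \in S & g u v]) x y].

Definition conn_clutter (r : nat) (V : finType) (g : rel V) : {set {set V}} :=
  [set S : {set V} | (#|S| == r.+1) && connected_on g S].

(** * Ideals and graded free resolutions over [{mpoly K[n]}] *)

Local Open Scope ring_scope.

Section Ideals.
Variables (K : fieldType) (n : nat).
Local Notation R := {mpoly K[n]}.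

Definition ideal_gen (s : seq R) : R -> Prop :=
  fun f => exists c : 'I_(size s) -> R, f = \sum_i c i * s`_i.

Definition generated_in_degree (d : nat) (I : R -> Prop) : Prop :=
  exists2 s : seq R, {in s, forall p, p \is d.-homog} &
    forall f, I f <-> ideal_gen s f.

(** A complex ... -> F_1 -> F_0 -> R of free modules, where [F_i] has rank
    [rk i] and its basis vector [k] has degree [shift i k], i.e.
    [F_i = \bigoplus_k R(- shift i k)].  Elements of [F_i] are row vectors;
    [diff i : F_(i+1) -> F_i] and [aug : F_0 -> R] act by right
    multiplication. *)
Record free_complex := FreeComplex {
  rk : nat -> nat;
  shift : forall i, 'I_(rk i) -> nat;
  aug : 'cV[R]_(rk 0);
  diff : forall i, 'M[R]_(rk i.+1, rk i)
}.

Record minimal_graded_resolution (F : free_complex) (I : R -> Prop) : Prop := {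
  aug_homog : forall k, aug F k 0 \is (shift k).-homog;
  diff_homog : forall i k l,
    if (shift l <= shift k)%N
    then diff F i k l \is (shift k - shift l).-homog
    else diff F i k l == 0;
  aug_image : forall f, I f <-> exists v : 'rV_(rk F 0), f%:M = v *m aug F;
  exact_zero : forall v : 'rV_(rk F 0),
    v *m aug F = 0 <-> exists w, v = w *m diff F 0;
  exact_succ : forall i (v : 'rV_(rk F i.+1)),
    v *m diff F i = 0 <-> exists w, v = w *m diff F i.+1;
  (* the differentials have entries in the irrelevant maximal ideal *)
  minimality : forall i k l, (diff F i k l)@_0%MM = 0
}.

(** [graded_betti I i j b]: the graded Betti number [beta_(i,j)(I)] is [b]. *)
Definition graded_betti (I : R -> Prop) (i j b : nat) : Prop :=
  exists2 F, minimal_graded_resolution F I &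
    b = #|[set k : 'I_(rk F i) | shift k == j]|.

Definition linear_resolution (d : nat) (I : R -> Prop) : Prop :=
  generated_in_degree d I /\
  forall i j, j != (i + d)%N -> graded_betti I i j 0.

(** [m] is the maximum of [j - i] over the [i], [j] with [beta_(i,j)(I) <> 0];
    no [m] is the regularity of the zero ideal. *)
Definition is_regularity (I : R -> Prop) (m : nat) : Prop :=
  (exists i j b, [/\ graded_betti I i j b, b != 0%N & j = (i + m)%N]) /\
  (forall i j b, graded_betti I i j b -> b != 0%N -> (j <= i + m)%N).

End Ideals.

(** The ideal [I_r(G)]; the vertex [x] is the variable ['X_(enum_rank x)]. *)
Definition conn_ideal (K : fieldType) (r : nat) (V : finType) (g : rel V) :
  {mpoly K[#|V|]} -> Prop :=
  ideal_gen [seq \prod_(x in W) 'X_(enum_rank x) | W : {set V} in conn_clutter r g].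
Arguments conn_ideal : clear implicits.

(* Main.v *)
Require Import Defs.
From mathcomp Require Import all_boot all_algebra zify ring.
From mathcomp.multinomials Require Import mpoly.

Set Implicit Arguments.
Unset Strict Implicit.
Unset Printing Implicit Defensive.

(** Let [h] be the complement of [g].  The complement of [conn_clutter r g]
    consists of the [S] with [r + 1] vertices on which [g] is disconnected,
    that is, on which [h] is a join.

    Deleting a simplicial maximal subedge is an elementary collapse of the
    complex of cliques.  By [chordal_delete_face] one may delete a smaller face
    [Y] as well, as soon as all the edges containing [Y] lie in one clique [W].

    Suppose that a graph [hp] contains [h] and a diagonal of every square of
    [h], and that two edges of a triangle of [hp] are never both outside [h].
    Consider the sets [Y] with [2 <= #|Y| <= r] that are connected in [g] and
    are not cliques of [hp].  Their common [h]-neighbours form a clique of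
    [hp], for otherwise some square of [h] would have no diagonal in [hp].
    This lets one delete all these [Y], the largest ones first, and what
    remains is the family of cliques of [hp] with [r + 1] elements
    ([co_chordal_of_filling]).  These cliques have at least three elements, so
    edges of [hp] are faces that may be deleted; this removes a vertex whose
    neighbourhood in [hp] is chordal ([clique_clutter_chordal]).  So it is
    enough to find [hp] such that every nonempty set of vertices contains a
    vertex with a chordal neighbourhood in that set.

    - If [g] has no induced 2K2 and C4, then [h] has none either, and [hp] is
      [h].  Either [h] is chordal or it has an induced pentagon, whose vertices
      have chordal neighbourhoods.
    - If [h] is a grid, then [hp] is the king's graph.
    - If [h] has a cactus representation, a square of [h] is a piece, or leaves
      a piece through two shared vertices, or runs through four pieces.  In the
      first case [hp] gets its diagonals that have an unshared end, in the
      second the diagonal inside the piece, in the third both.  Since every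
      edge of the skeleton is in at most one cycle, new edges do not accumulate
      ([filling_triangle]), and vertices can be removed piece by piece
      ([filling_reducible]).

    For the ideals, let [I] be generated by the monomials [mon B] with [B] in
    a family [E] of sets of size [d].  The Koszul cycles of [I] in the lowest
    degree [d] span free modules that form the linear strand of the resolution
    of [I]; [lin_cycle E] and [koszul] describe this strand, and [strand_exact]
    says that it resolves [I].  For [E] the complement of a clutter [C] and [s]
    in [Sim C], let [J] be the ideal belonging to the deletion of [s].  Then
    [J = I + L] and [L :&: I = L'], where [L] and [L'] are the products of the
    monomial of [s] with ideals generated by variables.  The linear strands
    form a Mayer-Vietoris sequence ([lin_cycle_split], [lin_cycle_meet]), those
    of [L] and [L'] are truncated Koszul complexes, which are exact
    ([star_exact]), and therefore the strand of [I] is exact iff that of [J] is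
    ([strand_exact_up], [strand_exact_down]).  The complete clutter is chordal
    and has the zero ideal as its complement; going from it to the empty
    clutter, and from there to a given chordal clutter, shows that the
    complement of every chordal clutter has an exact linear strand
    ([chordal_exact]).  Bases over the field turn the strand into a minimal
    graded resolution ([linear_strand_resolution]).

    The regularity refers to all minimal resolutions.  Between a linear one and
    an arbitrary one there are graded comparison maps whose composite is the
    identity modulo the irrelevant ideal; this bounds the shifts of the second
    ([linear_shift_bound]). *)

(** * Deleting faces of a uniform clutter *)

Section FaceDeletion.
Variables (V : finType) (d : nat).
Implicit Types (E : {set {set V}}) (Y W S : {set V}).

Definition uniform E := forall S, S \in E -> #|S| = d.

Lemma cliqueP E W :
  reflect (forall S, S \subset W -> #|S| = d -> S \in E) (clique d E W).
Proof.
apply: (iffP forallP) => [h S SW /eqP Sd | h S].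
  by move: (h S); rewrite SW Sd.
by apply/implyP => /andP[SW /eqP Sd]; apply: h.
Qed.

Lemma uniform_deletion E Y : uniform E -> uniform (deletion E Y).
Proof. by move=> hE S; rewrite inE => /andP[/hE]. Qed.

Lemma deletion_id E Y :
  (forall S, S \in E -> ~~ (Y \subset S)) -> deletion E Y = E.
Proof.
by move=> h; apply/setP => S; rewrite inE; case: (boolP (S \in E)) => //= /h ->.
Qed.

Lemma deletionS E (Y Z : {set V}) : Y \subset Z -> deletion (deletion E Z) Y = deletion E Y.
Proof.
move=> YZ; apply/setP => S; rewrite !inE; case: (S \in E) => //=.
case: (boolP (Y \subset S)) => [|nYS]; first by rewrite andbF.
by rewrite (contra _ nYS) // => /(subset_trans YZ).
Qed.

(** A simplicial maximal subedge is the case [#|Y| = d - 1].  For a smaller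
    [Y], take [q] in [W] outside [Y]: the face [q |: Y] satisfies the same
    hypotheses, and once it is deleted [W :\ q] can replace [W]. *)
Lemma chordal_delete_face E Y W :
  uniform E -> #|Y| < d -> Y \subset W -> clique d E W ->
  (forall S, S \in E -> Y \subset S -> S \subset W) ->
  chordal_clutter d (deletion E Y) -> chordal_clutter d E.
Proof.
move: {2}(d - #|Y|) (erefl (d - #|Y|)) => n.
elim: n E Y W => [|n IHn] E Y W dY unifE Yd YW.
  by move/eqP: dY; rewrite subn_eq0 leqNgt Yd.
move: {2}(#|W|) (leqnn #|W|) => m.
elim: m E W unifE YW => [|m IHm] E W unifE YW Wm Wclique WY delY.
  have Y0 : W = set0 by apply/eqP; rewrite -cards_eq0 -leqn0.
  suff <- : deletion E Y = E by [].
  apply: deletion_id => S SE; apply/negP => YS.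
  move: (WY S SE YS) (unifE S SE); rewrite Y0 subset0 => /eqP ->.
  by rewrite cards0 => d0; rewrite -d0 in Yd.
case: (ltnP #|Y|.+1 d) => [Yd' | Yd'].
  have [WY0 | [q]] := set_0Vmem (W :\: Y).
    suff <- : deletion E Y = E by [].
    apply: deletion_id => S SE; apply/negP => YS.
    have SY : S \subset Y.
      by apply: subset_trans (WY S SE YS) _; rewrite -setD_eq0 WY0.
    by move: (subset_leq_card SY); rewrite (unifE S SE) leqNgt Yd.
  rewrite inE => /andP[qY qW].
  have qYc : #|q |: Y| = #|Y|.+1 by rewrite cardsU1 qY.
  apply: (IHn E (q |: Y) W) => //.
  - by rewrite qYc subnS dY.
  - by rewrite qYc.
  - by rewrite subUset sub1set qW.
  - by move=> S SE; rewrite subUset => /andP[_]; apply: WY.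
  apply: (IHm _ (W :\ q)).
  - exact: uniform_deletion.
  - apply/subsetP => x xY; rewrite !inE (subsetP YW) // andbT.
    by apply: contraNneq qY => <-.
  - by move: Wm; rewrite (cardsD1 q W) qW add1n ltnS.
  - apply/cliqueP => S SW Sd; rewrite inE (cliqueP _ _ Wclique) //=.
      by apply/negP => /subsetP/(_ q (setU11 _ _))/(subsetP SW); rewrite !inE eqxx.
    exact: subset_trans SW (subsetDl _ _).
  - move=> S; rewrite inE => /andP[SE qYS] YS; rewrite subsetD1 WY //=.
    by apply: contra qYS => qS; rewrite subUset sub1set qS.
  - by rewrite deletionS // subsetUr.
have {}Yd' : #|Y|.+1 = d by apply/eqP; rewrite eqn_leq Yd Yd'.
have nbW : closed_nbhd E Y \subset W.
  rewrite subUset YW /=; apply/subsetP => v; rewrite inE => vE.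
  by apply: (subsetP (WY _ vE (subsetUr _ _))); rewrite setU11.
case: (eqVneq (closed_nbhd E Y) Y) => [nbY | nbY].
  suff <- : deletion E Y = E by [].
  apply: deletion_id => S SE; apply/negP => YS.
  have /eqP/cards1P [v SYv] : #|S :\: Y| = 1.
    by rewrite cardsD (setIidPr YS) (unifE _ SE) -Yd' subSnn.
  have SvY : v |: Y = S.
    by apply/setP => x; rewrite setUC -SYv !inE; case: (boolP (x \in Y)) => //= /(subsetP YS).
  have : v \in S :\: Y by rewrite SYv set11.
  by rewrite -nbY !inE SvY SE orbT.
apply: (@Chordal_deletion _ _ E Y) => //.
rewrite inE /maximal_subedge Yd' eqxx nbY /=.
apply/cliqueP => S SW Sd; apply: (cliqueP _ _ Wclique) => //.
exact: subset_trans SW nbW.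
Qed.

Lemma complete_chordal : 0 < d -> chordal_clutter d [set S : {set V} | #|S| == d].
Proof.
move=> d0; apply: (@chordal_delete_face _ set0 setT).
- by move=> S; rewrite inE => /eqP.
- by rewrite cards0.
- exact: sub0set.
- by apply/cliqueP => S _ Sd; rewrite inE Sd.
- by move=> S _ _; apply: subsetT.
suff -> : deletion [set S : {set V} | #|S| == d] set0 = set0.
  exact: Chordal_empty.
by apply/setP => S; rewrite !inE sub0set andbF.
Qed.

End FaceDeletion.

(** * Clique clutters and connected sets *)

Section CliqueClutters.
Variables (V : finType) (L : rel V).
Implicit Types (U N X Y S : {set V}).

Definition is_clique X := [forall x in X, forall y in X, (x != y) ==> L x y].

Lemma is_cliqueP X :
  reflect (forall x y, x \in X -> y \in X -> x != y -> L x y) (is_clique X).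
Proof.
apply: (iffP forall_inP) => [h x y xX yX | h x xX].
  by move: (h x xX) => /forall_inP/(_ y yX)/implyP.
by apply/forall_inP => y yX; apply/implyP; apply: h.
Qed.

Lemma is_cliqueS X Y : X \subset Y -> is_clique Y -> is_clique X.
Proof.
move=> /subsetP XY /is_cliqueP Yc; apply/is_cliqueP => x y /XY xY /XY yY.
exact: Yc.
Qed.

Definition nbhd U v := [set x in U | L v x].

(** For symmetric irreflexive [L] this is the chordality of [L] on [N], by
    Dirac's theorem; in this form it passes to subsets of [N]. *)
Definition simplicially_reducible N :=
  forall X, X \subset N -> X != set0 -> exists2 w, w \in X & is_clique (nbhd X w).

(** A vertex needs no more than a chordal neighbourhood to be removed from a
    family of cliques with at least three elements. *)
Definition locally_reducible :=
  forall U, U != set0 -> exists2 v, v \in U & simplicially_reducible (nbhd U v).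

Definition clique_clutter d U : {set {set V}} :=
  [set S : {set V} | [&& #|S| == d, S \subset U & is_clique S]].

Hypotheses (Lsym : ssrbool.symmetric L) (Lirr : irreflexive L).

(** If [w] is simplicial in [X], then the cliques through [v] and [w] lie in
    the clique [v |: (w |: nbhd X w)], and [[set v; w]], having less than [d]
    elements, can be deleted.  This removes [w] from [X]; when [X] is empty,
    [v] is on no clique. *)
Lemma clique_clutter_nbhd_chordal d U v X : 2 < d -> v \in U ->
  X \subset nbhd U v -> simplicially_reducible X ->
  chordal_clutter d (clique_clutter d (U :\ v)) ->
  chordal_clutter d
    [set S in clique_clutter d U | (v \in S) ==> (S :\ v \subset X)].
Proof.
move=> d2 vU; move: {2}#|X| (erefl #|X|) => n.
elim: n X => [|n IHn] X cX XN redX chU.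
  have X0 : X = set0 by apply/eqP; rewrite -cards_eq0 cX.
  congr (chordal_clutter d _): chU; apply/setP => S; rewrite !inE subsetD1 X0.
  case: (boolP (#|S| == d)) => //= /eqP Sd; case: (S \subset U) => //=.
  rewrite andbC; congr (_ && _); case: (boolP (v \in S)) => //= vS.
  rewrite subset0 -cards_eq0; move: Sd; rewrite (cardsD1 v) vS add1n => Sd.
  by move: d2; rewrite -Sd; case: #|_|.
have [|w wX wcl] := redX X (subxx _); first by rewrite -cards_eq0 cX.
have wU : w \in U by move/(subsetP XN): wX; rewrite inE => /andP[].
have Lvw : L v w by move/(subsetP XN): wX; rewrite inE => /andP[].
have vw : v != w by apply: contraTneq Lvw => ->; rewrite Lirr.
have vX : v \notin X by apply/negP => /(subsetP XN); rewrite inE Lirr andbF.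
apply: (@chordal_delete_face _ d _ [set v; w] (v |: (w |: nbhd X w))).
- by move=> S; rewrite !inE => /andP[/andP[/eqP]].
- by rewrite cards2 vw.
- by rewrite setUA subsetUl.
- apply/cliqueP => S SW Sd; rewrite !inE Sd eqxx /=.
  have SvX : S \subset v |: X.
    apply: (subset_trans SW); apply: setUS; rewrite subUset sub1set wX /=.
    by apply/subsetP => x; rewrite inE => /andP[].
  apply/andP; split.
    apply/andP; split.
      apply: (subset_trans SvX); rewrite subUset sub1set vU.
      by apply: (subset_trans XN); apply/subsetP => x; rewrite inE => /andP[].
    apply/is_cliqueP => x y /(subsetP SW) xW /(subsetP SW) yW.
    have sX z : z \in nbhd X w -> L v z.
      by rewrite inE => /andP[/(subsetP XN)]; rewrite inE => /andP[].
    have sw z : z \in nbhd X w -> L w z by rewrite inE => /andP[].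
    move: xW yW; rewrite !(in_setU1 _ v) !(in_setU1 _ w).
    have [->|xv] /= := eqVneq x v => [_|].
      have [->|yv] /= := eqVneq y v => [|]; first by [].
      by case/orP => [/eqP -> //|/sX].
    case/orP => [/eqP ->|xN].
      have [->|yv] /= := eqVneq y v => [|]; first by rewrite Lsym.
      case/orP => [/eqP ->|/sw].
        by rewrite eqxx.
      by [].
    have [->|yv] /= := eqVneq y v => [|]; first by rewrite Lsym sX.
    case/orP => [/eqP ->|yN]; first by rewrite Lsym sw.
    exact: (is_cliqueP _ wcl).
  by apply/implyP => vS; rewrite subDset.
- move=> S; rewrite !inE => /andP[/andP[Sd /andP[SU Scl]] Sv].
  rewrite subUset !sub1set => /andP[vS wS].
  rewrite vS /= in Sv.
  apply/subsetP => x xS; rewrite !inE.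
  have [//|xv] /= := eqVneq x v; have [//|xw] /= := eqVneq x w.
  rewrite (subsetP Sv) ?inE ?xv //=.
  by apply: (is_cliqueP _ Scl) => //; rewrite eq_sym.
have := IHn (X :\ w) _ _ _ chU.
rewrite (_ : [set S in clique_clutter d U | (v \in S) ==> (S :\ v \subset X :\ w)] =
  deletion [set S in clique_clutter d U | (v \in S) ==> (S :\ v \subset X)] [set v; w]).
  apply.
  - by move: cX; rewrite (cardsD1 w) wX add1n => -[].
  - exact: subset_trans (subsetDl _ _) XN.
  - by move=> Z ZX; apply: redX; apply: subset_trans ZX (subsetDl _ _).
apply/setP => S; rewrite !inE -!andbA; do 3 congr (_ && _).
rewrite subUset !sub1set; case: (boolP (v \in S)) => //= vS.
by rewrite subsetD1 !inE (eq_sym w) vw.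
Qed.

Lemma clique_clutter_chordal d : 2 < d -> locally_reducible ->
  chordal_clutter d (clique_clutter d [set: V]).
Proof.
move=> d2 red; move: [set: V] => U.
move: {2}#|U| (erefl #|U|) => n; elim: n U => [|n IHn] U cU.
  suff -> : clique_clutter d U = set0 by exact: Chordal_empty.
  apply/setP => S; rewrite !inE; apply/negP => /and3P[/eqP Sd /subset_leq_card].
  by rewrite cU Sd; case: d d2 {Sd}.
have [|v vU vred] := red U; first by rewrite -cards_eq0 cU.
have := clique_clutter_nbhd_chordal d2 vU (subxx _) vred.
rewrite (_ : [set S in clique_clutter d U | _] = clique_clutter d U).
  by apply; apply: IHn; move: cU; rewrite (cardsD1 v) vU add1n => -[].
apply/setP => S; rewrite !inE; case: (boolP (S \subset U)) => SU; last by rewrite !andbF.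
case: (boolP (is_clique S)) => Scl; last by rewrite !andbF.
case: (_ == d) => //=; apply/implyP => vS; apply/subsetP => x; rewrite !inE.
case/andP => xv xS; rewrite (subsetP SU) //=.
by apply: (is_cliqueP _ Scl) => //; rewrite eq_sym.
Qed.

End CliqueClutters.

Section Connected.
Variables (V : finType) (g : rel V).
Implicit Types (S Y A B : {set V}).

(** Connectedness by cuts, which avoids handling paths. *)
Lemma connected_onP S :
  reflect (S != set0 /\ forall A, A != set0 -> A \proper S ->
            exists x y, [/\ x \in A, y \in S, y \notin A & g x y])
          (connected_on g S).
Proof.
apply: (iffP andP) => -[S0 hS]; split => //.
- move=> A /set0Pn[a aA] /properP[/subsetP AS [b bS bA]].
  move/forall_inP/(_ a (AS a aA))/forall_inP/(_ b bS)/connectP: hS => [p].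
  elim: p a aA => [|c p IHp] a aA /=; first by move=> _ ab; rewrite ab aA in bA.
  case/andP=> /and3P[aS cS gac] pth lst.
  case: (boolP (c \in A)) => cA; last by exists a, c.
  exact: (IHp c).
- apply/forall_inP => x xS; apply/forall_inP => y yS.
  set e := fun u v => _.
  case: (boolP (y \in [set z in S | connect e x z])) => [|yA].
    by rewrite inE => /andP[].
  have [||u [v [uA vS vA guv]]] := hS [set z in S | connect e x z].
  - by apply/set0Pn; exists x; rewrite inE xS connect0.
  - apply/properP; split; first by apply/subsetP => z; rewrite inE => /andP[].
    by exists y.
  - case/negP: vA; move: uA; rewrite !inE vS => /andP[uS xu] /=.
    by apply: (connect_trans xu); apply: connect1; rewrite /e uS vS.
Qed.

Lemma connected_subset_or A B S : connected_on g S -> S \subset A :|: B ->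
  (forall x y, x \in A -> y \in B -> ~~ g x y) ->
  (forall x y, x \in B -> y \in A -> ~~ g x y) ->
  (S \subset A) || (S \subset B).
Proof.
move=> /connected_onP[S0 Sc] SAB nAB nBA.
case: (boolP (S \subset B)) => [_|/subsetPn[x xS xB]]; first by rewrite orbT.
rewrite orbF; apply/negPn/negP => /subsetPn[y yS yA].
have [||u [v [uA vS vA guv]]] := Sc (S :\: B).
- by apply/set0Pn; exists x; rewrite inE xB.
- apply/properP; split; first exact: subsetDl.
  exists y => //; rewrite inE yS andbT negbK.
  by move/(subsetP SAB): yS; rewrite inE (negPf yA).
move: uA vA; rewrite !inE vS andbT negbK => /andP[uB uS] vB.
move/(subsetP SAB): uS; rewrite inE (negPf uB) orbF => uA.
by move: guv; rewrite (negPf (nAB _ _ uA vB)).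
Qed.

Hypothesis gsym : ssrbool.symmetric g.

Lemma connected_setU1 Y y w : connected_on g Y -> y \in Y -> g y w ->
  connected_on g (w |: Y).
Proof.
move=> /connected_onP[Y0 Yc] yY gyw; apply/connected_onP; split.
  by apply/set0Pn; exists w; rewrite setU11.
move=> A A0 /properP[/subsetP AY [b bY bA]].
case: (boolP (Y \subset A)) => [YA|].
  exists y, w; rewrite (subsetP YA) // setU11 gyw; split => //.
  apply: contra bA => wA; move: bY; rewrite in_setU1 => /orP[/eqP -> //|].
  exact: (subsetP YA).
case/subsetPn => c cY cA.
case: (eqVneq (A :&: Y) set0) => [AY0|AY0].
  have wA : A = [set w].
    apply/eqP; rewrite eqEsubset sub1set; apply/andP; split.
      apply/subsetP => x xA; move: (AY x xA); rewrite !inE => /orP[//|xY].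
      by move/setP/(_ x): AY0; rewrite !inE xA xY.
    case/set0Pn: A0 => x xA; move: (AY x xA); rewrite !inE => /orP[/eqP <- //|xY].
    by move/setP/(_ x): AY0; rewrite !inE xA xY.
  exists w, y; rewrite wA set11 in_setU1 yY orbT gsym gyw; split => //.
  rewrite -wA; apply/negP => yA.
  by move/setP/(_ y): AY0; rewrite !inE yA yY.
have [//||u [v [uA vY vA guv]]] := Yc (A :&: Y).
  by apply/properP; split; [exact: subsetIr | exists c => //; rewrite inE (negPf cA)].
exists u, v; move: uA vA; rewrite !inE vY andbT orbT => /andP[uA uY] vA.
by split.
Qed.

(** If no vertex had two neighbours in [S], an edge would be a component. *)
Lemma connected_path3 S : connected_on g S -> 2 < #|S| -> irreflexive g ->
  exists x y z, [/\ x \in S, y \in S, z \in S & [/\ g x y, g y z & x != z]].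
Proof.
move=> /connected_onP[/set0Pn[x xS] Sc] S3 girr.
have [||x' [y []]] := Sc [set x].
- by apply/set0Pn; exists x; rewrite set11.
- rewrite properEcard sub1set xS cards1; exact: ltnW.
rewrite inE => /eqP -> yS; rewrite inE => yx gxy {x'}.
have [||u [v [uA vS]]] := Sc [set x; y].
- by apply/set0Pn; exists x; rewrite !inE eqxx.
- rewrite properEcard subUset !sub1set xS yS cards2.
  by rewrite eq_sym yx.
rewrite !inE negb_or => /andP[vx vy] guv; move: uA; rewrite !inE.
case/orP => /eqP uE; rewrite uE in guv.
  by exists y, x, v; split => //; split => //; [rewrite gsym | rewrite eq_sym].
by exists x, y, v; split => //; split => //; rewrite eq_sym.
Qed.

End Connected.

(** * Filling the squares of the complement *)

Section FilledSquares.
Variables (V : finType) (g hp : rel V) (r : nat).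
Local Notation h := (compl_graph g).
Implicit Types (S T Y A B : {set V}) (E D : {set {set V}}).

Hypotheses (gsym : ssrbool.symmetric g) (girr : irreflexive g).
Hypotheses (hpsym : ssrbool.symmetric hp) (hpirr : irreflexive hp).
Hypothesis h_hp : subrel h hp.
Hypothesis square_diagonal : forall x s y k, x != y -> s != k ->
  h x s -> h s y -> h y k -> h k x -> hp x y || hp s k.
Hypothesis triangle_one_new : forall x y z,
  hp x y -> hp y z -> hp x z -> g x y -> g y z -> False.
Hypothesis r2 : 1 < r.

Let C := compl_clutter r.+1 (conn_clutter r g).

Let inC S : (S \in C) = (#|S| == r.+1) && ~~ connected_on g S.
Proof. by rewrite !inE; case: eqP. Qed.

Let not_hp_g x y : x != y -> ~~ hp x y -> g x y.
Proof. by move=> xy; apply: contraR => gxy; apply: h_hp; rewrite /compl_graph xy gxy. Qed.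

Let P : {set {set V}} :=
  [set Y : {set V} | [&& 1 < #|Y|, #|Y| <= r, connected_on g Y & ~~ is_clique hp Y]].

Let CN Y : {set V} := [set w | [forall y in Y, h w y]].

Let CNP Y w : reflect (forall y, y \in Y -> h w y) (w \in CN Y).
Proof. by rewrite inE; exact: forall_inP. Qed.

Let CN_clique Y : ~~ is_clique hp Y -> is_clique hp (CN Y).
Proof.
move=> Yncl; apply/is_cliqueP => s k /CNP sY /CNP kY sk.
apply: contraNT Yncl => nsk; apply/is_cliqueP => x y xY yY xy.
have hsym a b : h a b -> h b a by rewrite /compl_graph gsym eq_sym.
have := @square_diagonal x s y k xy sk.
rewrite (negPf nsk) orbF; apply; [exact/hsym/sY|exact/sY|exact/hsym/kY|exact/kY].
Qed.

Let clique_disconnected T : is_clique hp T -> 2 < #|T| -> ~~ connected_on g T.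
Proof.
move=> /is_cliqueP Tcl T3; apply/negP => Tc.
have [x [y [z [xT yT zT [gxy gyz xz]]]]] := connected_path3 gsym Tc T3 girr.
have ne a b : g a b -> a != b by apply: contraTneq => ->; rewrite girr.
apply: (triangle_one_new _ _ _ gxy gyz); apply: Tcl => //; exact: ne.
Qed.

Definition avoiding (E D : {set {set V}}) : {set {set V}} :=
  [set S in E | [forall Y in D, ~~ (Y \subset S)]].

Let avoidingP E D S :
  reflect (S \in E /\ forall Y, Y \in D -> ~~ (Y \subset S)) (S \in avoiding E D).
Proof. by rewrite inE; apply: (iffP andP) => -[? /forall_inP]. Qed.

Let avoiding_all : avoiding C P = clique_clutter hp r.+1 setT.
Proof.
apply/setP => S; apply/avoidingP/idP; rewrite inC.
- move=> [/andP[Sr Sc] SP]; rewrite inE Sr subsetT /=.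
  apply/is_cliqueP => x y xS yS xy; apply/negPn/negP => nxy.
  have gxy := not_hp_g xy nxy.
  suff /SP : [set x; y] \in P by rewrite subUset !sub1set xS yS.
  rewrite inE cards2 xy r2 /=; apply/andP; split.
    have -> : [set x; y] = y |: [set x] by rewrite setUC.
    apply: connected_setU1 (set11 x) gxy => //.
    apply/connected_onP; split; first by apply/set0Pn; exists x; rewrite set11.
    by move=> A /set0Pn[a aA] /proper_card; rewrite cards1 ltnS leqn0 cards_eq0 => /eqP A0;
       rewrite A0 inE in aA.
  by apply: contra nxy => /is_cliqueP; apply; rewrite ?inE ?eqxx ?orbT.
- rewrite inE subsetT => /and3P[/eqP Sr _ Scl]; rewrite Sr eqxx /=; split.
    by apply: clique_disconnected; rewrite // Sr.
  move=> Y; rewrite inE => /and4P[_ _ _ Yncl]; apply: contra Yncl => YS.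
  exact: is_cliqueS YS Scl.
Qed.

(** The members of [P] are deleted by decreasing size.  Let [Y] be the next
    one.  An edge [S] that contains [Y] lies in [Y :|: CN Y]: for [w] in [S]
    joined to [Y] by an edge of [g], the set [w |: Y] would be connected, so
    either it would have been deleted before or it would be [S] itself.  And
    [Y :|: CN Y] is a clique of what is left: [g] has no edge between its two
    parts, so a subset with [r + 1] elements is disconnected, and a member of
    [P] inside it is contained in [Y], because [CN Y] is a clique of [hp]. *)
Lemma co_chordal_of_filling : locally_reducible hp ->
  co_chordal r.+1 (conn_clutter r g).
Proof.
move=> red; rewrite /co_chordal -/C.
suff main D : D \subset P ->
    (forall Y Y', Y \in P -> Y \notin D -> Y' \in D -> #|Y| <= #|Y'|) ->
    chordal_clutter r.+1 (avoiding C D).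
  suff -> : C = avoiding C set0.
    by apply: main; [exact: sub0set | move=> Y Y' _ _; rewrite inE].
  apply/setP => S; apply/idP/avoidingP => [SC|[] //].
  by split => // Y; rewrite inE.
move: {2}#|P :\: D| (erefl #|P :\: D|) => n; elim: n D => [|n IHn] D cD DP Dtop.
  have -> : D = P.
    by apply/eqP; rewrite eqEsubset DP -setD_eq0 -cards_eq0 cD.
  by rewrite avoiding_all; apply: clique_clutter_chordal.
have [Y0 Y0P] : exists Y, Y \in P :\: D by apply/set0Pn; rewrite -cards_eq0 cD.
case: (@arg_maxnP _ Y0 (mem (P :\: D)) (fun Y : {set V} => #|Y|) Y0P) => Y YPD Ymax.
have {}YPD : Y \in P :\: D := YPD.
have /setDP[YP YD] := YPD.
move: (YP); rewrite inE => /and4P[Y1 Yr Yc Yncl].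
have YnCN y w : y \in Y -> w \in CN Y -> ~~ g y w.
  by move=> yY /CNP/(_ y yY)/andP[_]; rewrite gsym.
apply: (@chordal_delete_face _ r.+1 _ Y (Y :|: CN Y)) => //.
- by move=> S /avoidingP[]; rewrite inC => /andP[/eqP].
- exact: subsetUl.
- apply/cliqueP => T TW Tr; apply/avoidingP; split.
    rewrite inC Tr eqxx /=; apply/negP => Tc.
    have := connected_subset_or Tc TW YnCN.
    case/(_ _)/orP => [x y xC yY|TY|TC]; first by rewrite gsym YnCN.
      by move: (subset_leq_card TY); rewrite Tr leqNgt ltnS Yr.
    have := clique_disconnected (is_cliqueS TC (CN_clique Yncl)).
    by rewrite Tr Tc ltnS r2 => /(_ isT).
  move=> Y' Y'D; apply/negP => Y'T.
  move: (subsetP DP _ Y'D); rewrite inE => /and4P[_ _ Y'c Y'ncl].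
  have := connected_subset_or Y'c (subset_trans Y'T TW) YnCN.
  case/(_ _)/orP => [x y xC yY|Y'Y|Y'C]; first by rewrite gsym YnCN.
    have /eqP Y'E : Y' == Y by rewrite eqEcard Y'Y (Dtop _ _ YP YD Y'D).
    by rewrite -Y'E Y'D in YD.
  by case/negP: Y'ncl; apply: is_cliqueS Y'C (CN_clique Yncl).
- move=> S /avoidingP[]; rewrite inC => /andP[/eqP Sr Sc] SD YS.
  apply/subsetP => w wS; rewrite inE; case: (boolP (w \in Y)) => //= wY.
  apply/CNP => y yY; rewrite /compl_graph.
  have -> /= : w != y by apply: contraNneq wY => ->.
  apply/negP => gwy.
  have wYc : connected_on g (w |: Y) by apply: connected_setU1 yY _; rewrite // gsym.
  have wYS : w |: Y \subset S by rewrite subUset sub1set wS.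
  have cwY : #|w |: Y| = #|Y|.+1 by rewrite cardsU1 wY.
  have wYr : #|w |: Y| <= r.
    rewrite -ltnS -Sr; apply: proper_card; rewrite properEneq wYS andbT.
    by apply: contraNneq Sc => <-.
  have wYP : w |: Y \in P.
    rewrite inE wYr wYc cwY ltnS (ltnW Y1) /=.
    by apply: contra Yncl; apply: is_cliqueS; exact: subsetUr.
  have wYD : w |: Y \in D.
    apply/negPn/negP => wYD.
    have wYPD : w |: Y \in P :\: D by rewrite in_setD wYD.
    by have := Ymax _ wYPD; rewrite /= cwY ltnn.
  by move/negP: (SD _ wYD).
have -> : deletion (avoiding C D) Y = avoiding C (Y |: D).
  apply/setP => S; rewrite inE; apply/andP/avoidingP => [[/avoidingP[SC SD] YS]|[SC SD]].
    by split => // Z; rewrite in_setU1 => /orP[/eqP -> //|]; apply: SD.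
  split; last by apply: SD; rewrite setU11.
  by apply/avoidingP; split => // Z ZD; apply: SD; rewrite in_setU1 ZD orbT.
apply: IHn.
- by move: cD; rewrite (cardsD1 Y) YPD add1n setDDl setUC => -[].
- by rewrite subUset sub1set YP.
- move=> Z Z' ZP; rewrite !in_setU1 negb_or => /andP[ZY ZD] /orP[/eqP ->|].
    by apply: Ymax; rewrite /= in_setD ZD.
  exact: Dtop.
Qed.

End FilledSquares.

(** * Dirac's theorem: chordal graphs have simplicial vertices *)

Lemma cycle_adjacency m i j : i < j < m.+2 ->
  (i.+1 %% m.+2 == j) || (j.+1 %% m.+2 == i) =
  if j == m.+1 then (i == 0) || (i == m) else j == i.+1.
Proof.
move=> /andP[ij jm]; rewrite (modn_small (leq_ltn_trans ij jm)).
case: (eqVneq j m.+1) => [->|nj]; first by rewrite modnn eqSS orbC (eq_sym 0).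
have jm' : j.+1 < m.+2 by rewrite ltn_neqAle eqSS nj.
by rewrite (modn_small jm') (eq_sym j) [j.+1 == i]gtn_eqF ?orbF // ltnS ltnW.
Qed.

Section Dirac.
Variables (V : finType) (h : rel V).
Hypotheses (hsym : ssrbool.symmetric h) (hirr : irreflexive h).
Implicit Types (X C D N : {set V}).

Definition hole_free N := forall n (f : 'I_n -> V), 4 <= n -> injective f ->
  (forall i, f i \in N) -> (forall i j, h (f i) (f j) = cycle_graph n i j) -> False.

Lemma hole_freeS N X : X \subset N -> hole_free N -> hole_free X.
Proof.
by move=> /subsetP XN hN n f n4 finj fX; apply: hN n4 finj _ => i; apply/XN/fX.
Qed.

Lemma chordal_hole_free N : chordal_graph (induced h N) -> hole_free N.
Proof.
move=> ch n f n4 finj fN fE; apply: (ch n n4).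
exists (fun i => exist _ (f i) (fN i)); split; first by move=> i j [/finj].
by move=> i j; rewrite -fE.
Qed.

Definition walk_in D s s' q := [&& path h s q, last s q == s' & all (mem D) q].

(** In a shortest walk, a repetition or an edge between two positions that
    are not consecutive would give a shortcut. *)
Lemma shortest_path_induced D s s' q0 : walk_in D s s' q0 ->
  exists q, [/\ walk_in D s s' q, uniq (s :: q) &
    forall i j, i < j <= size q ->
      h (nth s (s :: q) i) (nth s (s :: q) j) = (j == i.+1)].
Proof.
move=> lq0.
have ex : exists n, [exists q : n.-tuple V, walk_in D s s' q].
  by exists (size q0); apply/existsP; exists (in_tuple q0).
case: (ex_minnP ex) => n /existsP[[q /= sq] lq] nmin {ex q0 lq0}; exists q.
have {}nmin p : walk_in D s s' p -> size q <= size p.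
  move=> lp; rewrite (eqP sq); apply: nmin; apply/existsP.
  by exists (in_tuple p).
have /and3P[pq /eqP lastq Dq] := lq.
have nthS i : i <= size q -> nth s (s :: q) i = last s (take i q).
  case: i => [|i] iq /=; first by rewrite take0.
  rewrite (take_nth s) // last_rcons //.
have cut i j : i <= size q -> j <= size q ->
    path h (nth s (s :: q) i) (drop j q) ->
    last (nth s (s :: q) i) (drop j q) = s' -> j <= i.
  move=> iq jq pd ld; have := nmin (take i q ++ drop j q).
  rewrite size_cat size_takel // size_drop => le.
  suff /le : walk_in D s s' (take i q ++ drop j q) by lia.
  rewrite /walk_in cat_path last_cat -nthS // pd ld eqxx all_cat /= andbT.
  rewrite -{1}(cat_take_drop i q) cat_path in pq.
  case/andP: pq => -> _ /=.
  by apply/andP; split; apply/allP => x; [move/mem_take | move/mem_drop]; apply: (allP Dq).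
have tail j : j <= size q ->
    path h (nth s (s :: q) j) (drop j q) /\ last (nth s (s :: q) j) (drop j q) = s'.
  move=> jq; rewrite nthS //; split.
    by rewrite -{1}(cat_take_drop j q) cat_path in pq; case/andP: pq.
  by rewrite -last_cat cat_take_drop.
split => //.
- rewrite -[_ && _]/(uniq (s :: q)); apply: contraT => /(uniqPn s)[i [j [ij jq eij]]].
  rewrite /= ltnS in jq.
  have [pj lj] := tail j jq; rewrite -eij in pj lj.
  by have := cut i j (ltnW (leq_trans ij jq)) jq pj lj; rewrite leqNgt ij.
- move=> i j /andP[ij jq]; case: (eqVneq j i.+1) => [jE|nj].
    subst j; have iq := ltnW jq; have [pi _] := tail i iq.
    by rewrite (drop_nth s) // in pi; case/andP: pi.
  apply/negP => hij; have [pj lj] := tail j jq.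
  case: j => [|j] in ij jq nj hij pj lj *; first by [].
  have jE : drop j q = nth s (s :: q) j.+1 :: drop j.+1 q by rewrite (drop_nth s).
  have iq : i <= size q by lia.
  suff : j <= i by lia.
  by apply: cut => //; [lia | rewrite jE /= hij | rewrite jE].
Qed.

(** A shortest walk from [s] to [s'] through [C], closed up by [v], is a hole. *)
Lemma hole_through_set X C v s s' q : hole_free X ->
  C \subset X -> v \in X -> s \in X -> s' \in X ->
  v \notin C -> (forall c, c \in C -> ~~ h v c) ->
  h v s -> h v s' -> s != s' -> ~~ h s s' ->
  walk_in (C :|: [set s; s']) s s' q -> False.
Proof.
move=> hX CX vX sX s'X vC nvC hvs hvs' ss' nss' /shortest_path_induced.
case=> {}q [/and3P[_ /eqP lastq Dq] uq ind].
have q2 : 1 < size q.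
  case: q lastq {Dq uq} ind => [|a [|b q]] //= lastq ind.
    by rewrite lastq eqxx in ss'.
  by have := ind 0 1 isT; rewrite /= lastq (negPf nss').
have vs : v != s by apply: contraTneq hvs => ->; rewrite hirr.
have vs' : v != s' by apply: contraTneq hvs' => ->; rewrite hirr.
have vq : v \notin s :: q.
  rewrite inE negb_or vs /=; apply/negP => /(allP Dq).
  by rewrite /= !inE (negPf vC) (negPf vs) (negPf vs').
pose c := rcons (s :: q) v.
have sc : size c = (size q).+2 by rewrite size_rcons.
have uc : uniq c by rewrite rcons_uniq vq.
have nthc i : i <= size q -> nth s c i = nth s (s :: q) i.
  by move=> iq; rewrite nth_rcons /= ltnS iq.
have nthv : nth s c (size q).+1 = v by rewrite nth_rcons /= ltnn eqxx.
have hv i : i <= size q -> h v (nth s c i) = (i == 0) || (i == size q).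
  move=> iq; rewrite nthc //; case: (posnP i) => [->|i0]; first by rewrite /= hvs.
  case: eqVneq => [->|ni]; first by rewrite -last_nth lastq hvs' orbT.
  have : nth s (s :: q) i \in C :|: [set s; s'].
    by case: i i0 iq ni => //= i _ iq _; apply: (allP Dq); apply: mem_nth.
  rewrite !inE => /or3P[/nvC/negPf ->|/eqP e|/eqP e].
  - by rewrite orbF; case: i i0 {iq ni}.
  - have := nth_uniq s (_ : i < size (s :: q)) (isT : 0 < size (s :: q)) uq.
    by rewrite e /= eqxx ltnS iq => /(_ isT); case: i i0 {e iq ni}.
  - have := nth_uniq s (_ : i < size (s :: q)) (ltnSn _ : size q < size (s :: q)) uq.
    by rewrite e -last_nth lastq eqxx /= ltnS iq => /(_ isT); rewrite (negPf ni).
apply: (hX (size q).+2 (fun i => nth s c i)) => //.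
- by move=> i j /eqP; rewrite nth_uniq ?sc ?ltn_ord // => /eqP/val_inj.
- move=> i; have : nth s c i \in c by apply: mem_nth; rewrite sc.
  rewrite mem_rcons !inE => /or3P[/eqP -> //|/eqP -> //|/(allP Dq)].
  by rewrite /= !inE => /or3P[/(subsetP CX) //|/eqP -> //|/eqP -> //].
- have key (i j : nat) : i < j < (size q).+2 -> h (nth s c i) (nth s c j) =
      (i.+1 %% (size q).+2 == j) || (j.+1 %% (size q).+2 == i).
    move=> ijq; rewrite cycle_adjacency //; case/andP: ijq => ij jq.
    case: (eqVneq j _) => [jE|nj].
      by rewrite jE nthv hsym hv // -ltnS -jE.
    have jq' : j <= size q by rewrite -ltnS ltn_neqAle nj.
    by rewrite !nthc ?ind ?ij // (leq_trans (ltnW ij)).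
  move=> i j; rewrite /cycle_graph.
  case: (ltngtP i j) => ij.
  - by rewrite key // ij ltn_ord.
  - by rewrite hsym key ?ij ?ltn_ord // orbC.
  - rewrite -ij hirr orbb; apply/esym/negP.
    have := ltn_ord i; rewrite ltnS leq_eqVlt => /orP[/eqP -> | lt].
      by rewrite modnn.
    by rewrite modn_small // => /eqP /esym/n_Sn.
Qed.

(** Let [C] be a component of the non-neighbours of [v] and [S] the set of
    neighbours of [v] attached to it; [S] is a clique by [hole_through_set].
    A vertex of [C] has all its neighbours in [C :|: S], so a simplicial vertex
    of this smaller set is good if it is in [C].  Induction provides one that
    is not joined to a prescribed vertex of [C :|: S]: a vertex of [S] if one
    of them has a non-neighbour there, any vertex with a non-neighbour
    otherwise. *)
Lemma dirac_far_simplicial X v y : hole_free X -> v \in X -> y \in X ->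
  y != v -> ~~ h v y ->
  exists w, [/\ w \in X, w != v, ~~ h v w & is_clique h (nbhd h X w)].
Proof.
move: {2}#|X| (leqnn #|X|) => n; elim: n X v y => [|n IHn] X v y.
  by rewrite leqn0 cards_eq0 => /eqP -> _; rewrite inE.
move=> Xn hX vX yX yv nvy.
pose R := [set x in X | (x != v) && ~~ h v x].
pose e := [rel a b | [&& a \in R, b \in R & h a b]].
have esym : connect_sym e.
  by apply: sym_connect_sym => a b /=; rewrite hsym andbCA.
pose C := [set x | connect e y x].
have yR : y \in R by rewrite inE yX yv nvy.
have CR x : x \in C -> x \in R.
  rewrite inE => /connectP[p pth ->]; elim: p (y) yR pth => //= b p IHp a aR.
  by case/andP => /and3P[_ bR _]; apply: IHp.
have CRX x : x \in C -> [/\ x \in X, x != v & ~~ h v x].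
  by move/CR; rewrite inE => /and3P[].
have CX : C \subset X by apply/subsetP => x /CRX[].
pose S := [set s in X | h v s && [exists c in C, h s c]].
have SP s : s \in S -> [/\ s \in X, h v s & exists2 c, c \in C & h s c].
  by rewrite inE => /and3P[sX hvs /exists_inP[c cC hsc]]; split => //; exists c.
have Scl : is_clique h S.
  apply/is_cliqueP => s s' /SP[sX hvs [c cC hsc]] /SP[s'X hvs' [c' c'C hsc']] ss'.
  apply/negPn/negP => nss'.
  have /connectP[p pth lp] : connect e c c'.
    by rewrite !inE in cC c'C; apply: connect_trans c'C; rewrite esym.
  apply: (@hole_through_set X C v s s' (c :: rcons p s')) => //.
  - by apply/negP => /CRX[_]; rewrite eqxx.
  - by move=> x /CRX[].
  have [pC ph] : all (mem C) (c :: p) /\ path h c p.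
    elim: p c cC pth {lp hsc} => [|b p IHp] c cC /=; first by rewrite cC.
    case/andP => ecb pth; have bC : b \in C.
      by rewrite inE; rewrite inE in cC; apply: connect_trans cC (connect1 _).
    have [] := IHp b bC pth; rewrite /= => -> ->; rewrite cC.
    by case/and3P: ecb => _ _ ->.
  rewrite /walk_in /= hsc rcons_path ph -lp hsym hsc' last_rcons eqxx /=.
  have CD x : x \in C -> x \in C :|: [set s; s'] by rewrite in_setU => ->.
  have s'D : s' \in C :|: [set s; s'] by rewrite in_setU set22 orbT.
  by case/andP: pC => /CD cD pC; rewrite cD all_rcons /= s'D; apply: sub_all pC.
have CS_nbhd w : w \in C -> nbhd h X w \subset C :|: S.
  move=> wC; have [wX wv nvw] := CRX w wC; apply/subsetP => x; rewrite inE => /andP[xX hwx].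
  have xv : x != v by apply: contraNneq nvw => <-; rewrite hsym.
  rewrite in_setU; case: (boolP (h v x)) => hvx.
    by rewrite (_ : x \in S) ?orbT // inE xX hvx; apply/exists_inP; exists w; rewrite 1?hsym.
  rewrite inE (_ : connect e y x) //; rewrite inE in wC.
  by apply: connect_trans wC (connect1 _); rewrite /= !inE wX wv nvw xX xv hvx.
suff [w wC wcl] : exists2 w, w \in C & is_clique h (nbhd h (C :|: S) w).
  have [wX wv nvw] := CRX w wC; exists w; split => //.
  apply: is_cliqueS wcl; apply/subsetP => x xw; rewrite inE (subsetP (CS_nbhd w wC)) //.
  by move: xw; rewrite inE => /andP[].
have CSX : C :|: S \subset X.
  by rewrite subUset CX; apply/subsetP => x; rewrite inE => /andP[].
have yC : y \in C by rewrite inE connect0.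
case: (boolP (is_clique h (C :|: S))) => [cl|ncl].
  by exists y => //; apply: is_cliqueS cl; apply/subsetP => x; rewrite inE => /andP[].
have cCS : #|C :|: S| <= n.
  rewrite -ltnS; apply: leq_trans Xn; apply: proper_card; apply/properP; split => //.
  exists v => //; rewrite in_setU negb_or; apply/andP; split.
    by apply/negP => /CRX[_]; rewrite eqxx.
  by rewrite inE hirr andbF.
have hCS := hole_freeS CSX hX.
case: (boolP [exists s in S, [exists x in C :|: S, (x != s) && ~~ h s x]]).
  case/exists_inP => s sS /exists_inP[x xCS /andP[xs nsx]].
  have [||w [wCS ws nsw wcl]] := IHn (C :|: S) s x _ hCS _ xCS xs nsx => //.
    by rewrite in_setU sS orbT.
  exists w => //; move: wCS; rewrite in_setU => /orP[//|wS].
  by case/negP: nsw; apply: (is_cliqueP _ _ Scl) => //; rewrite eq_sym.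
rewrite negb_exists_in => /forall_inP Suniv.
have {}Suniv s x : s \in S -> x \in C :|: S -> x != s -> h s x.
  move=> sS xCS xs; move: (Suniv s sS); rewrite negb_exists_in => /forall_inP/(_ x xCS).
  by rewrite xs negbK.
have [a [b [aCS bCS ab nab]]] : exists a b, [/\ a \in C :|: S, b \in C :|: S, a != b & ~~ h a b].
  move: ncl; rewrite negb_forall_in => /exists_inP[a aCS].
  rewrite negb_forall_in => /exists_inP[b bCS]; rewrite negb_imply => /andP[ab nab].
  by exists a, b.
have [|w [wCS wa naw wcl]] := IHn (C :|: S) a b cCS hCS aCS bCS _ nab; first by rewrite eq_sym.
exists w => //; move: wCS; rewrite in_setU => /orP[//|wS].
by case/negP: naw; rewrite hsym Suniv // eq_sym.
Qed.

Lemma hole_free_reducible N : hole_free N -> simplicially_reducible h N.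
Proof.
move=> hN X XN /set0Pn[v vX]; have hX := hole_freeS XN hN.
case: (boolP (is_clique h X)) => [cl|].
  by exists v => //; apply: is_cliqueS cl; apply/subsetP => x; rewrite inE => /andP[].
rewrite negb_forall_in => /exists_inP[a aX].
rewrite negb_forall_in => /exists_inP[b bX]; rewrite negb_imply => /andP[ab nab].
have [|w [wX _ _ wcl]] := dirac_far_simplicial hX aX bX _ nab; first by rewrite eq_sym.
by exists w.
Qed.

End Dirac.

(** * Graphs without induced 2K2 and C4 *)

Lemma compl_graph_sym (V : finType) (g : rel V) :
  ssrbool.symmetric g -> ssrbool.symmetric (compl_graph g).
Proof. by move=> gsym x y; rewrite /compl_graph eq_sym gsym. Qed.

Lemma compl_graph_irr (V : finType) (g : rel V) : irreflexive (compl_graph g).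
Proof. by move=> x; rewrite /compl_graph eqxx. Qed.

Section TwoK2C4Free.
Variables (V : finType) (h : rel V).
Hypotheses (hsym : ssrbool.symmetric h) (hirr : irreflexive h).
Hypothesis square_chord : forall x s y k, x != y -> s != k ->
  h x s -> h s y -> h y k -> h k x -> h x y || h s k.
Hypothesis edges_linked : forall a b c d, h a b -> h c d ->
  [|| h a c, h a d, h b c | h b d].

Definition pentagon (c0 c1 c2 c3 c4 : V) :=
  [/\ h c0 c1, h c1 c2, h c2 c3, h c3 c4 & h c4 c0] /\
  [/\ ~~ h c0 c2, ~~ h c1 c3, ~~ h c2 c4, ~~ h c3 c0 & ~~ h c4 c1].

Lemma pentagon_rev c0 c1 c2 c3 c4 :
  pentagon c0 c1 c2 c3 c4 -> pentagon c0 c4 c3 c2 c1.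
Proof.
by case=> [[e01 e12 e23 e34 e40] [n02 n13 n24 n30 n41]]; split; split; rewrite hsym.
Qed.

(** A vertex joined to an induced pentagon is on it or is joined to all of it.
    Only the part needed for the neighbourhood of [c0] is recorded. *)
Lemma pentagon_neighbor c0 c1 c2 c3 c4 x : pentagon c0 c1 c2 c3 c4 ->
  h x c0 -> x != c1 -> x != c4 -> h x c1 /\ h x c4.
Proof.
have half a0 a1 a2 a3 a4 : pentagon a0 a1 a2 a3 a4 -> h x a0 -> x != a1 ->
    x != a4 -> h x a2 -> h x a1 /\ h x a4.
  case=> [[e01 e12 e23 e34 e40] [n02 n13 n24 n30 n41]] x0 x1 x4 x2.
  have d02 : a0 != a2 by apply: contraNneq n30 => ->; rewrite hsym.
  have h1 : h x a1.
    have := @square_chord a0 x a2 a1 d02 x1; rewrite (negPf n02) /=.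
    by apply; rewrite // hsym.
  split=> //; have d03 : a0 != a3 by apply: contraNneq n02 => ->; rewrite hsym.
  case: (boolP (h x a3)) => [x3|nx3].
    have := @square_chord a0 x a3 a4 d03 x4; rewrite [h a0 a3]hsym (negPf n30) /=.
    by apply; rewrite // hsym.
  have := edges_linked h1 e34; rewrite (negPf nx3) (negPf n13) /=.
  by rewrite [h a1 a4]hsym (negPf n41) orbF.
move=> pc x0 x1 x4; case: (pc) => [[e01 e12 e23 e34 e40] [n02 n13 n24 n30 n41]].
have := edges_linked x0 e23; rewrite (negPf n02) [h c0 c3]hsym (negPf n30) !orbF.
case/orP => [x2|x3]; first exact: half pc x0 x1 x4 x2.
by have [] := half _ _ _ _ _ (pentagon_rev pc) x0 x4 x1 x3.
Qed.

(** The neighbours of [c0] off the pentagon form a clique, because all of them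
    are joined to [c1] and [c4], which are not adjacent. *)
Lemma pentagon_nbhd_reducible U c0 c1 c2 c3 c4 : pentagon c0 c1 c2 c3 c4 ->
  simplicially_reducible h (nbhd h U c0).
Proof.
move=> pc; case: (pc) => [[e01 e12 e23 e34 e40] [n02 n13 n24 n30 n41]].
have d41 : c4 != c1 by apply: contraNneq n13 => <-; rewrite hsym.
pose K := nbhd h U c0 :\: [set c1; c4].
have Kcl : is_clique h K.
  apply/is_cliqueP => x y; rewrite !inE !negb_or => /and3P[/andP[x1 x4] _ hx].
  case/and3P=> /andP[y1 y4] _ hy xy; rewrite hsym in hx; rewrite hsym in hy.
  have [hx1 hx4] := pentagon_neighbor pc hx x1 x4.
  have [hy1 hy4] := pentagon_neighbor pc hy y1 y4.
  have := @square_chord c4 x c1 y d41 xy; rewrite (negPf n41) /=.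
  by apply; rewrite // hsym.
move=> X XN X0.
have XK x : x \in X -> x != c1 -> x != c4 -> x \in K.
  by move=> /(subsetP XN) xN x1 x4; rewrite in_setD xN !inE negb_or x1 x4.
have XKn x (w : V) : h w x -> x \in X -> ~~ h w c1 -> ~~ h w c4 -> x \in K.
  by move=> hwx xX n1 n4; apply: XK => //; apply: contraTneq hwx => ->.
case: (boolP (c1 \in X)) => c1X.
  exists c1 => //; apply: is_cliqueS Kcl; apply/subsetP => x; rewrite inE => /andP[xX hx].
  by apply: XKn hx xX _ _; rewrite ?hirr // hsym.
case: (boolP (c4 \in X)) => c4X.
  exists c4 => //; apply: is_cliqueS Kcl; apply/subsetP => x; rewrite inE => /andP[xX hx].
  by apply: XKn hx xX _ _; rewrite ?hirr.
case/set0Pn: X0 => w wX; exists w => //; apply: is_cliqueS Kcl.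
apply/subsetP => x; rewrite inE => /andP[xX _].
by apply: XK => //; [apply: contraNneq c1X | apply: contraNneq c4X] => <-.
Qed.

(** A hole of length 4 is a square without chord and one of length at least 6
    contains two unlinked edges.  So either there is no hole at all, or there
    is an induced pentagon. *)
Lemma twoK2_C4_free_reducible : locally_reducible h.
Proof.
move=> U /set0Pn[u uU].
pose p5 (c : {ffun 'I_5 -> V}) := [forall i, c i \in U] &&
  [forall i, forall j, h (c i) (c j) == cycle_graph 5 i j].
case: (boolP [exists c, p5 c]) => [/existsP[c /andP[/forallP cU /forallP hc]]|no5].
  have {}hc i j : h (c i) (c j) = cycle_graph 5 i j by exact/eqP/(forallP (hc i)).
  exists (c (@Ordinal 5 0 isT)) => //.
  apply: (@pentagon_nbhd_reducible _ _ (c (@Ordinal 5 1 isT)) (c (@Ordinal 5 2 isT))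
            (c (@Ordinal 5 3 isT)) (c (@Ordinal 5 4 isT))).
  by rewrite /pentagon !hc.
exists u => //; apply: hole_free_reducible => //.
apply: (@hole_freeS _ _ U); first by apply/subsetP => x; rewrite inE => /andP[].
move=> n f n4 finj fU hf.
have [n5 | n5] := eqVneq n 5.
  subst n; case/negP: no5; apply/existsP; exists [ffun i => f i].
  apply/andP; split; first by apply/forallP => i; rewrite ffunE.
  by apply/forallP => i; apply/forallP => j; rewrite !ffunE hf.
have [n4' | n4'] := eqVneq n 4.
  subst n; pose o k (lk : k < 4) := f (Ordinal lk).
  have ne (i j : 'I_4) : i != j -> f i != f j by apply: contraNneq => /finj ->.
  have := @square_chord (o 0 isT) (o 1 isT) (o 2 isT) (o 3 isT).
  by rewrite /o !hf !ne // => /(_ isT isT isT isT isT isT).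
have n6 : 5 < n by move: n4 n5 n4'; clear; lia.
have lt k : k < 6 -> k < n by move=> k6; apply: leq_trans k6 n6.
have := @edges_linked (f (Ordinal (lt 0 isT))) (f (Ordinal (lt 1 isT)))
  (f (Ordinal (lt 3 isT))) (f (Ordinal (lt 4 isT))).
by rewrite !hf /cycle_graph /= !modn_small ?lt // => /(_ isT isT).
Qed.

End TwoK2C4Free.

Lemma twoK2_C4_free_co_chordal (V : finType) (g : rel V) r :
  simple_graph g -> twoK2_C4_free g -> 1 < r -> co_chordal r.+1 (conn_clutter r g).
Proof.
move=> [gsym girr] [no2K2 noC4] r2.
pose h := compl_graph g.
have hsym : ssrbool.symmetric h := compl_graph_sym gsym.
have hirr : irreflexive h := @compl_graph_irr _ g.
have hg a b : h a b -> g a b = false by case/andP => _ /negPf.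
have gh a b : h b a -> g a b = false by move=> hba; rewrite gsym hg.
have ne a b : h a b -> a != b by apply: contraTneq => ->; rewrite hirr.
have nhg a b : a != b -> ~~ h a b -> g a b.
  by rewrite /h /compl_graph => -> /=; rewrite negbK.
have square_chord x s y k : x != y -> s != k ->
    h x s -> h s y -> h y k -> h k x -> h x y || h s k.
  move=> xy sk hxs hsy hyk hkx; apply/negPn/negP; rewrite negb_or => /andP[nxy nsk].
  have gxy := nhg _ _ xy nxy; have gsk := nhg _ _ sk nsk.
  apply: no2K2; pose f (u : bool * bool) := nth x [:: x; y; s; k] (u.1.*2 + u.2).
  exists f; split.
    have un : uniq [:: x; y; s; k].
      rewrite /= !inE !negb_or xy sk (ne _ _ hxs) (ne _ _ hyk).
      by rewrite (eq_sym y s) (eq_sym x k) (ne _ _ hsy) (ne _ _ hkx).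
    move=> u v /eqP; rewrite nth_uniq //; try by [case: u => [[] []] | case: v => [[] []]].
    by case: u v => [[] []] [[] []].
  have E := (girr, (gxy, gsk), (hg _ _ hxs, hg _ _ hsy, hg _ _ hyk, hg _ _ hkx),
             (gh _ _ hxs, gh _ _ hsy, gh _ _ hyk, gh _ _ hkx)).
  by case=> [[] []] [[] []]; rewrite /f /two_K2 /= ?E // gsym E.
have edges_linked a b c d : h a b -> h c d -> [|| h a c, h a d, h b c | h b d].
  move=> hab hcd; apply/negPn/negP; rewrite !negb_or => /and4P[nac nad nbc nbd].
  have dac : a != c by apply: contraNneq nad => ->.
  have dad : a != d by apply: contraNneq nac => ->; rewrite hsym.
  have dbc : b != c by apply: contraNneq nac => <-.
  have dbd : b != d by apply: contraNneq nad => <-.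
  apply: noC4.
  have gac := nhg _ _ dac nac; have gad := nhg _ _ dad nad.
  have gbc := nhg _ _ dbc nbc; have gbd := nhg _ _ dbd nbd.
  pose f (i : 'I_4) := nth a [:: a; c; b; d] i.
  exists f; split.
    have un : uniq [:: a; c; b; d].
      rewrite /= !inE !negb_or dac dad dbd (eq_sym c b) dbc /= andbT.
      by rewrite (ne _ _ hab) (ne _ _ hcd).
    by move=> i j /eqP; rewrite nth_uniq // => /eqP/val_inj.
  have E := (girr, (gac, gad, gbc, gbd), (hg _ _ hab, hg _ _ hcd), (gh _ _ hab, gh _ _ hcd)).
  case=> [[|[|[|[|//]]]] i4] [[|[|[|[|//]]]] j4]; rewrite /f /cycle_graph /=;
    by rewrite ?E // gsym E.
apply: (@co_chordal_of_filling _ _ h) => //.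
  by move=> x y z hxy _ _; rewrite hg.
exact: twoK2_C4_free_reducible.
Qed.

(** * Co-grids *)

Section Grid.
Variables (V : finType) (p q : V -> nat).
Hypothesis coord_inj : forall x y, p x = p y -> q x = q y -> x = y.

Definition king_graph : rel V := fun x y =>
  [&& x != y, p x <= (p y).+1, p y <= (p x).+1, q x <= (q y).+1 & q y <= (q x).+1].

Lemma coord_neq x y : x != y -> p x <> p y \/ q x <> q y.
Proof.
move=> xy; case: (eqVneq (p x) (p y)) => [px|/eqP]; last by left.
by case: (eqVneq (q x) (q y)) => [/(coord_inj px)/eqP|/eqP]; [rewrite (negPf xy) | right].
Qed.

Lemma king_sym : ssrbool.symmetric king_graph.
Proof. by move=> x y; rewrite /king_graph eq_sym; case: eqVneq => //= _; lia. Qed.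

Lemma king_irr : irreflexive king_graph.
Proof. by move=> x; rewrite /king_graph eqxx. Qed.

(** Remove the lexicographically smallest vertex [v].  Its neighbours are the
    next one in its row and at most three consecutive ones in the next row, of
    which only the one in the column before [v] is not joined to the first. *)
Lemma king_reducible : locally_reducible king_graph.
Proof.
move=> U /set0Pn[u uU].
case: (@arg_minnP _ u (mem U) p uU) => a aU pmin.
have aA : a \in [pred x in U | p x == p a] by rewrite !inE eqxx andbT.
case: (@arg_minnP _ a [pred x in U | p x == p a] q aA) => v.
rewrite !inE => /andP[vU /eqP pv] qmin.
have {}pmin x : x \in U -> p v <= p x by move=> xU; rewrite pv; apply: pmin.
have {}qmin x : x \in U -> p x = p v -> q v <= q x.
  by move=> xU px; apply: qmin; rewrite /= xU px pv eqxx.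
exists v => // X XN X0.
have XP x : x \in X -> (p x = p v /\ q x = (q v).+1) \/
    (p x = (p v).+1 /\ ((q x).+1 = q v \/ q x = q v \/ q x = (q v).+1)).
  move=> /(subsetP XN); rewrite inE => /andP[xU /and5P[vx l1 l2 l3 l4]].
  have := pmin x xU; have := coord_neq vx; have := qmin x xU.
  by move: l1 l2 l3 l4; clear; lia.
case: (boolP [exists w in X, (q w).+1 == q v]) => [/exists_inP[w wX /eqP qw]|].
  exists w => //; apply/is_cliqueP => x y.
  have key z : z \in nbhd king_graph X w -> p z = (p v).+1 /\ q z = q v.
    rewrite inE => /andP[zX /and5P[wz l1 l2 l3 l4]].
    have := coord_neq wz; have := XP z zX; have := XP w wX.
    by move: l1 l2 l3 l4 qw; clear; lia.
  move=> /key[px qx] /key[py qy]; case/eqP; apply: coord_inj.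
    by rewrite px py.
  by rewrite qx qy.
rewrite negb_exists_in => /forall_inP nX.
case/set0Pn: X0 => w wX; exists w => //; apply/is_cliqueP => x y.
rewrite !inE => /andP[xX _] /andP[yX _] xy; rewrite /king_graph xy /=.
have := XP x xX; have := XP y yX; have := nX x xX; have := nX y yX.
by clear; lia.
Qed.

End Grid.

Definition grid_dist (px qx py qy : nat) := (px - py) + (py - px) + ((qx - qy) + (qy - qx)).

Lemma grid_distC px qx py qy : grid_dist px qx py qy = grid_dist py qy px qx.
Proof. by rewrite /grid_dist [px - py + _]addnC [qx - qy + _]addnC. Qed.

Lemma grid_distT px qx py qy : grid_dist px qx py qy = grid_dist qx px qy py.
Proof. by rewrite /grid_dist addnC. Qed.

Lemma grid_midpoint px qx ps qs py qy : grid_dist px qx ps qs = 1 ->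
  grid_dist ps qs py qy = 1 -> py.+1 < px -> ps = py.+1 /\ qs = qy.
Proof. by rewrite /grid_dist => *; lia. Qed.

(** If two opposite corners of a square were two rows apart, the other two
    corners would both be their midpoint. *)
Lemma grid_square_le px qx ps qs py qy pk qk : ps <> pk \/ qs <> qk ->
  grid_dist px qx ps qs = 1 -> grid_dist ps qs py qy = 1 ->
  grid_dist py qy pk qk = 1 -> grid_dist pk qk px qx = 1 -> px <= py.+1.
Proof.
move=> sk xs sy; rewrite grid_distC => ky; rewrite grid_distC => xk.
rewrite leqNgt; apply/negP => lt.
have [sp sq] := grid_midpoint xs sy lt; have [kp kq] := grid_midpoint xk ky lt.
by case: sk; rewrite ?sp ?sq ?kp ?kq.
Qed.

Lemma grid_square px qx ps qs py qy pk qk : ps <> pk \/ qs <> qk ->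
  grid_dist px qx ps qs = 1 -> grid_dist ps qs py qy = 1 ->
  grid_dist py qy pk qk = 1 -> grid_dist pk qk px qx = 1 ->
  [/\ px <= py.+1, py <= px.+1, qx <= qy.+1 & qy <= qx.+1].
Proof.
move=> sk xs sy yk kx; have sk' : qs <> qk \/ ps <> pk by case: sk; auto.
have ks : pk <> ps \/ qk <> qs by case: sk => ?; [left | right]; apply: nesym.
have ks' : qk <> qs \/ pk <> ps by case: ks; auto.
split.
- exact: grid_square_le sk xs sy yk kx.
- exact: grid_square_le ks yk kx xs sy.
- by apply: (grid_square_le sk'); rewrite grid_distT; eassumption.
- by apply: (grid_square_le ks'); rewrite grid_distT; eassumption.
Qed.

Lemma king_diagonal (px qx py qy : nat) : px <> py \/ qx <> qy ->
  px <= py.+1 -> py <= px.+1 -> qx <= qy.+1 -> qy <= qx.+1 ->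
  grid_dist px qx py qy <> 1 ->
  (px = py.+1 \/ py = px.+1) /\ (qx = qy.+1 \/ qy = qx.+1).
Proof. by rewrite /grid_dist => *; lia. Qed.

Lemma near_twin (a b c : nat) : a = b.+1 \/ b = a.+1 -> b = c.+1 \/ c = b.+1 ->
  a <= c.+1 -> c <= a.+1 -> a = c.
Proof. by move=> *; lia. Qed.

Lemma co_grid_co_chordal (V : finType) (g : rel V) r :
  simple_graph g -> co_grid g -> 1 < r -> co_chordal r.+1 (conn_clutter r g).
Proof.
move=> [gsym girr] [n [m [_ _ [f [[f' fK f'K] gf]]]]] r2.
pose p x : nat := (f' x).1; pose q x : nat := (f' x).2.
have pq_inj x y : p x = p y -> q x = q y -> x = y.
  rewrite /p /q => /val_inj e1 /val_inj e2; rewrite -(f'K x) -(f'K y); congr (f _).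
  by move: e1 e2; case: (f' x) (f' y) => [? ?] [? ?] /= -> ->.
have hE x y : compl_graph g x y =
    (grid_dist (p x) (q x) (p y) (q y) == 1).
  rewrite /compl_graph -{1 2}(f'K x) -{1 2}(f'K y) gf (can_eq fK) /compl_graph.
  rewrite negb_and negbK; case: eqVneq => [e|] /=; last by rewrite negbK.
  by rewrite /grid_dist /p /q e !subnn.
have gN x y : g x y -> grid_dist (p x) (q x) (p y) (q y) <> 1.
  by move=> gxy; apply/eqP; rewrite -hE /compl_graph gxy andbF.
apply: (@co_chordal_of_filling _ _ (king_graph p q)) => //.
- exact: king_sym.
- exact: king_irr.
- move=> x y hxy; have xy : x != y by case/andP: hxy.
  by move: hxy; rewrite /king_graph xy hE /grid_dist /=; clear; lia.
- move=> x s y k xy sk; rewrite !hE => /eqP xs /eqP sy /eqP yk /eqP kx.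
  have [l1 l2 l3 l4] := grid_square (coord_neq pq_inj sk) xs sy yk kx.
  by rewrite /king_graph xy l1 l2 l3 l4.
- move=> x y z /and5P[xy a1 a2 a3 a4] /and5P[yz b1 b2 b3 b4] /and5P[xz c1 c2 c3 c4].
  move=> /gN gxy /gN gyz; case/eqP: xz.
  have [d1 d2] := king_diagonal (coord_neq pq_inj xy) a1 a2 a3 a4 gxy.
  have [d3 d4] := king_diagonal (coord_neq pq_inj yz) b1 b2 b3 b4 gyz.
  by apply: pq_inj; [apply: near_twin d1 d3 _ _ | apply: near_twin d2 d4 _ _].
- exact: king_reducible.
Qed.

(** * Shared vertices and cycles of a chordal cactus *)

Section Cactus.
Variables (V : finType) (h : rel V) (T : finType) (t : rel T).
Variables (H : {set T} -> {set V}) (a : T -> V).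
Hypotheses (hsym : ssrbool.symmetric h) (hirr : irreflexive h).
Hypothesis rep : cactus_representation h t H a.
Local Notation EE := (edges t).
Implicit Types (x y z s k v w : V) (e f : {set T}) (c : seq V).

Lemma piece_unique e f x y : e \in EE -> f \in EE -> x != y ->
  x \in H e -> y \in H e -> x \in H f -> y \in H f -> e = f.
Proof.
move=> eE fE xy xe ye xf yf; apply/eqP; apply: contraT => ef.
have /card_le1_eqP/(_ x y) := piece_meet rep eE fE ef.
by rewrite !inE xe ye xf yf => /(_ isT isT) xE; rewrite xE eqxx in xy.
Qed.

Definition common x y := [exists e in EE, (x \in H e) && (y \in H e)].

Definition shared x :=
  [exists e in EE, [exists f in EE, [&& e != f, x \in H e & x \in H f]]].

Lemma commonP x y :
  reflect (exists e, [/\ e \in EE, x \in H e & y \in H e]) (common x y).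
Proof.
apply: (iffP exists_inP) => [[e eE /andP[xe ye]]|[e [eE xe ye]]].
  by exists e.
by exists e => //; rewrite xe.
Qed.

Lemma common_sym x y : common x y = common y x.
Proof. by apply/commonP/commonP => [[e [? ? ?]]|[e [? ? ?]]]; exists e. Qed.

Lemma h_common x y : h x y -> common x y.
Proof. by move/(piece_edges rep) => [e eE /andP[xe ye]]; apply/commonP; exists e. Qed.

Lemma sharedI e f x : e \in EE -> f \in EE -> e != f -> x \in H e -> x \in H f ->
  shared x.
Proof.
by move=> eE fE ef xe xf; apply/exists_inP; exists e => //; apply/exists_inP; exists f; rewrite ?ef ?xe.
Qed.

Lemma unshared_piece e f x : ~~ shared x -> e \in EE -> f \in EE ->
  x \in H e -> x \in H f -> e = f.
Proof.
by move=> nx eE fE xe xf; apply/eqP; apply: contraNT nx => ef; apply: sharedI ef xe xf.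
Qed.

Lemma shared_endpoint e x : shared x -> e \in EE -> x \in H e ->
  exists2 u, u \in e & a u = x.
Proof.
move=> /exists_inP[e1 e1E /exists_inP[e2 e2E /and3P[e12 xe1 xe2]]] eE xe.
have [f [fE ef xf]] : exists f, [/\ f \in EE, e != f & x \in H f].
  have [ee1|] := eqVneq e e1; last by exists e1.
  by exists e2; rewrite ee1.
have xef : x \in H e :&: H f by rewrite inE xe.
have /set0Pn[u uef] : e :&: f != set0.
  by apply: (piece_adjacent rep) => //; apply/set0Pn; exists x.
by exists u; [case/setIP: uef | rewrite (piece_glue rep eE fE ef uef xef)].
Qed.

Lemma edge_pair e (u w : T) : e \in EE -> u \in e -> w \in e -> u != w ->
  e = [set u; w] /\ t u w.
Proof.
have [tsym _] := skeleton_simple rep.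
rewrite inE => /existsP[p /existsP[q /andP[tpq /eqP ->]]].
rewrite !inE => /orP[] /eqP -> /orP[] /eqP ->; rewrite ?eqxx // => _.
by split; rewrite 1?setUC 1?tsym.
Qed.

(** The second shared vertex [y] excludes the degenerate case in which [a]
    sends both ends of [e] to [x]. *)
Lemma endpoint_unique e x y (u w : T) : e \in EE -> x != y -> shared y -> y \in H e ->
  u \in e -> w \in e -> a u = x -> a w = x -> u = w.
Proof.
move=> eE xy sy ye ue we au aw.
have [u' u'e au'] := shared_endpoint sy eE ye.
have uu' : u != u' by apply: contraNneq xy => uu'; rewrite -au -au' uu'.
have [eE' _] := edge_pair eE ue u'e uu'.
move: we; rewrite eE' !inE => /orP[/eqP -> //|/eqP wu'].
by case/eqP: xy; rewrite -aw -au' wu'.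
Qed.

Lemma shared_pair e x y z : e \in EE -> x != y -> shared x -> shared y -> shared z ->
  x \in H e -> y \in H e -> z \in H e -> (z == x) || (z == y).
Proof.
move=> eE xy sx sy sz xe ye ze.
have [u ue au] := shared_endpoint sx eE xe.
have [w we aw] := shared_endpoint sy eE ye.
have [q qe aq] := shared_endpoint sz eE ze.
have uw : u != w by apply: contraNneq xy => uw; rewrite -au -aw uw.
have [eE' _] := edge_pair eE ue we uw.
by move: qe; rewrite eE' !inE -au -aw -aq => /orP[] /eqP ->; rewrite eqxx ?orbT.
Qed.

(** By [skeleton_vertex] this graph on the shared vertices is a copy of a
    subgraph of the skeleton. *)
Definition linked : rel V := fun x y => [&& x != y, shared x, shared y & common x y].
Local Notation A := linked.

Lemma linked_sym : ssrbool.symmetric A.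
Proof.
by move=> x y; rewrite /linked eq_sym common_sym; case: (shared x); case: (shared y).
Qed.

Lemma linked_neq x y : A x y -> x != y.
Proof. by case/and4P. Qed.

(** An inverse of [a] along [linked].  A vertex can be the image of several
    vertices of the skeleton, but all pieces with two shared vertices that
    contain [x] choose the same one, by [endpoint_unique] applied at a common
    endpoint of two such pieces. *)
Lemma skeleton_vertex : exists tau : V -> T, forall x y e,
  x != y -> shared x -> shared y -> e \in EE -> x \in H e -> y \in H e ->
  tau x \in e /\ a (tau x) = x.
Proof.
suff loc x : exists u : T, forall y e,
  x != y -> shared x -> shared y -> e \in EE -> x \in H e -> y \in H e ->
  u \in e /\ a u = x.
  by case: (fin_all_exists loc) => tau tauP; exists tau.
case: (boolP [exists y, A x y]) => [/existsP[y /and4P[xy sx sy /commonP[e [eE xe ye]]]]|nA].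
  have [u ue au] := shared_endpoint sx eE xe.
  exists u => z f xz _ sz fE xf zf; split => //.
  have [ef|ef] := eqVneq e f; first by rewrite -ef.
  have xef : x \in H e :&: H f by rewrite inE xe.
  have /set0Pn[w wef] : e :&: f != set0.
    by apply: (piece_adjacent rep) => //; apply/set0Pn; exists x.
  have aw := piece_glue rep eE fE ef wef xef.
  case/setIP: wef => we wf.
  by rewrite (endpoint_unique eE xy sy ye ue we au (esym aw)).
have [e0 + _] := piece_vertices rep x; rewrite inE => /existsP[u _].
exists u => y e xy sx sy eE xe ye; case/existsP: nA; exists y.
by rewrite /linked xy sx sy /=; apply/commonP; exists e.
Qed.

Lemma next_map_in (f : V -> T) c x : {in c &, injective f} -> uniq c -> 1 < size c ->
  x \in c -> next (map f c) (f x) = f (next c x).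
Proof.
move=> finj uc c1 xc; have uf : uniq (map f c) by rewrite map_inj_in_uniq.
have [i p cE] := rot_to xc.
rewrite -(next_rot i uc) -(next_rot i uf) -map_rot cE.
have : size (x :: p) = size c by rewrite -cE size_rot.
by case: p cE => [|y p] _ /=; [move=> c1'; rewrite -c1' in c1 | rewrite !eqxx].
Qed.

(** [skeleton_vertex] maps the two cycles injectively to cycles of the
    cactus. *)
Lemma linked_cycles_share c1 c2 (d : {set V}) : graph_cycle A c1 -> graph_cycle A c2 ->
  d \in cycle_edges c1 -> d \in cycle_edges c2 -> c1 =i c2.
Proof.
have [tau tauP] := skeleton_vertex.
have tauA x y : A x y -> a (tau x) = x.
  by case/and4P => xy sx sy /commonP[e [eE xe ye]]; case: (tauP x y e).
have tauK c x : graph_cycle A c -> x \in c -> a (tau x) = x.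
  by case/andP => _ /andP[cyc _] xc; apply: tauA (next_cycle cyc xc).
have tauinj c : graph_cycle A c -> {in c &, injective tau}.
  by move=> cyc x y xc yc e; rewrite -(tauK _ _ cyc xc) e (tauK _ _ cyc yc).
have tauC c : graph_cycle A c -> graph_cycle t (map tau c).
  move=> gc; case/andP: (gc) => c3 /andP[cyc uc]; rewrite /graph_cycle size_map c3 /=.
  rewrite /ucycleb map_inj_in_uniq ?uc ?andbT; last exact: tauinj gc.
  rewrite cycle_map; apply: sub_cycle cyc => x y Axy /=.
  have ax := tauA _ _ Axy; have ay : a (tau y) = y by apply: (tauA y x); rewrite linked_sym.
  case/and4P: Axy => xy sx sy /commonP[e [eE xe ye]].
  have [txe _] := tauP x y e xy sx sy eE xe ye.
  have [|tye _] := tauP y x e _ sy sx eE ye xe; first by rewrite eq_sym.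
  have [|_ ->//] := edge_pair eE txe tye.
  by apply: contraNneq xy => te; rewrite -ax -ay te.
have edgeC c x : graph_cycle A c -> x \in c ->
    [set tau z | z in [set x; next c x]] \in cycle_edges (map tau c).
  move=> gc xc; case/andP: (gc) => c3 /andP[_ uc].
  apply/imsetP; exists (tau x); first exact: map_f.
  by rewrite imsetU1 imset_set1 next_map_in //; [exact: tauinj gc | exact: ltnW].
have sub c c' : graph_cycle A c -> graph_cycle A c' ->
    cycle_edges (map tau c) = cycle_edges (map tau c') -> {subset c <= c'}.
  move=> gc gc' E x xc; have := edgeC c x gc xc; rewrite E => /imsetP[u uc' Eu].
  have : tau x \in [set tau z | z in [set x; next c x]].
    by apply: imset_f; rewrite set21.
  rewrite Eu !inE => /orP xu.
  have : tau x \in map tau c' by case: xu => /eqP ->; rewrite ?mem_next.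
  by case/mapP => z zc' /(congr1 a); rewrite (tauK _ _ gc xc) (tauK _ _ gc' zc') => ->.
move=> g1 g2 /imsetP[x xc1 dx] /imsetP[y yc2 dy].
have E : cycle_edges (map tau c1) = cycle_edges (map tau c2).
  apply: (skeleton_cactus rep (tauC _ g1) (tauC _ g2)) (edgeC _ _ g1 xc1) _.
  by rewrite -dx dy; apply: edgeC.
by move=> z; apply/idP/idP; apply: sub.
Qed.

Lemma linked_cycles_head x y p q : graph_cycle A [:: x, y & p] ->
  graph_cycle A [:: x, y & q] -> [:: x, y & p] =i [:: x, y & q].
Proof.
have head r : [set x; y] \in cycle_edges [:: x, y & r].
  by apply/imsetP; exists x; rewrite ?mem_head //= eqxx.
by move=> gp gq; apply: linked_cycles_share gp gq (head p) (head q).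
Qed.

Lemma triangle_cycle x y z : A x y -> A y z -> A x z -> graph_cycle A [:: x; y; z].
Proof.
move=> xy yz xz; rewrite /graph_cycle /ucycleb /= !inE negb_or xy yz linked_sym xz.
by rewrite !linked_neq.
Qed.

Definition linked_square x s y k :=
  [&& x != y, s != k, A x s, A s y, A y k & A k x].

Lemma square_cycle x s y k : linked_square x s y k -> graph_cycle A [:: x; s; y; k].
Proof.
case/and5P => xy sk xs sy /andP[yk kx]; rewrite /graph_cycle /ucycleb /= !inE !negb_or.
by rewrite xs sy yk kx xy sk eq_sym !linked_neq // linked_sym.
Qed.

Lemma square_swap x s y k : linked_square x s y k -> linked_square x k y s.
Proof.
case/and5P => xy sk xs sy /andP[yk kx]; rewrite /linked_square xy eq_sym sk.
by rewrite ![A k _]linked_sym yk linked_sym kx linked_sym sy linked_sym xs.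
Qed.

Lemma square_rev x s y k : linked_square x s y k -> linked_square y s x k.
Proof.
case/and5P => xy sk xs sy /andP[yk kx]; rewrite /linked_square eq_sym xy sk.
by rewrite linked_sym sy linked_sym xs linked_sym kx linked_sym yk.
Qed.

Definition opposite x y := [exists s, [exists k, linked_square x s y k]].

Lemma oppositeP x y : reflect (exists s k, linked_square x s y k) (opposite x y).
Proof.
apply: (iffP existsP) => [[s /existsP[k sq]]|[s [k sq]]]; first by exists s, k.
by exists s; apply/existsP; exists k.
Qed.

(** Otherwise a triangle and a square of [linked] share an edge. *)
Lemma square_not_linked x s y k : linked_square x s y k -> ~~ A x y.
Proof.
move=> sq; apply/negP => Axy; case/and5P: (sq) => xy sk xs sy /andP[yk kx].
have := linked_cycles_head (triangle_cycle xs sy Axy) (square_cycle sq) k.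
rewrite !inE eqxx !orbT eq_sym [k == s]eq_sym (negPf sk) [k == y]eq_sym.
by rewrite (negPf (linked_neq yk)) eq_sym (negPf (linked_neq kx)).
Qed.

(** Every position of [z] off the square closes up, together with the path
    [x], [s], [y], a cycle of length at most 6 that shares an edge with the
    square; so [z] is on the square after all. *)
Lemma square_third x s y k z : linked_square x s y k ->
  A x z || opposite x z -> A y z || opposite y z -> (z == s) || (z == k).
Proof.
have on_square x1 s1 y1 k1 z1 p : linked_square x1 s1 y1 k1 -> x1 != z1 -> y1 != z1 ->
    graph_cycle A [:: x1, s1 & p] -> z1 \in [:: x1, s1 & p] -> (z1 == s1) || (z1 == k1).
  move=> sq xz yz gp; rewrite (linked_cycles_head gp (square_cycle sq)) !inE.
  by rewrite ![z1 == _]eq_sym (negPf xz) (negPf yz) /=.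
have AD x1 s1 y1 k1 z1 : linked_square x1 s1 y1 k1 -> A y1 z1 -> opposite x1 z1 ->
    (z1 == s1) || (z1 == k1).
  move=> sq yz /oppositeP[p [q sq']].
  case/and5P: (sq') => xz pq xp pz /andP[zq qx].
  case/and5P: (sq) => xy sk xs sy /andP[yk kx].
  have [//|zs] /= := eqVneq z1 s1.
  have [sp|sp] := eqVneq s1 p.
    subst p; have := on_square _ _ _ _ z1 [:: z1; q] sq xz (linked_neq yz) (square_cycle sq').
    by rewrite !inE eqxx !orbT (negPf zs) => /(_ isT).
  have yp : y1 != p.
    by apply: contraTneq xp => <-; apply: square_not_linked sq.
  have := on_square _ _ _ _ z1 [:: y1; z1; p] sq xz (linked_neq yz).
  rewrite !inE eqxx !orbT (negPf zs) /=; apply=> //.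
  rewrite /graph_cycle /ucycleb /= !inE !negb_or xs sy yz [A z1 p]linked_sym pz.
  rewrite [A p x1]linked_sym xp (linked_neq xs) xy xz (linked_neq xp).
  by rewrite (linked_neq sy) [s1 == z1]eq_sym zs sp (linked_neq yz) yp eq_sym (linked_neq pz).
move=> sq; case/and5P: (sq) => xy sk xs sy /andP[yk kx].
case/orP => [xz|xz] /orP[yz|yz].
- have [//|zs] /= := eqVneq z s.
  have := on_square _ _ _ _ z [:: y; z] sq (linked_neq xz) (linked_neq yz).
  rewrite !inE eqxx !orbT (negPf zs) /=; apply=> //; apply: square_cycle.
  by rewrite /linked_square xy eq_sym zs xs sy yz linked_sym.
- exact: AD (square_rev sq) xz yz.
- exact: AD sq yz xz.
have [//|zs] /= := eqVneq z s.
case/oppositeP: (xz) => p [q sq1]; case/oppositeP: (yz) => p' [q' sq2].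
case/and5P: (sq1) => nxz pq xp pz /andP[zq qx].
case/and5P: (sq2) => nyz pq' yp' pz' /andP[zq' qy'].
have [sp|sp] := eqVneq s p.
  subst p; have := on_square _ _ _ _ z [:: z; q] sq nxz nyz (square_cycle sq1).
  by rewrite !inE eqxx !orbT (negPf zs) => /(_ isT).
have [sp'|sp'] := eqVneq s p'.
  subst p'; have := on_square _ _ _ _ z [:: z; q'] (square_rev sq) nyz nxz (square_cycle sq2).
  by rewrite !inE eqxx !orbT (negPf zs) => /(_ isT).
have yp : y != p by apply: contraTneq xp => <-; apply: square_not_linked sq.
have xp' : x != p'.
  by apply: contraTneq yp' => <-; rewrite linked_sym; apply: square_not_linked sq.
have [pp'|pp'] := eqVneq p p'.
  subst p'; have sq3 : linked_square x s y p.
    by rewrite /linked_square xy sp xs sy yp' linked_sym.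
  have := linked_cycles_head (square_cycle sq3) (square_cycle sq) p.
  rewrite !inE eqxx !orbT eq_sym (negPf (linked_neq xp)) eq_sym (negPf sp).
  rewrite eq_sym (negPf yp) /= => /esym/eqP pk; subst p.
  have := on_square _ _ _ _ z [:: z; q] (square_swap sq) nxz nyz (square_cycle sq1).
  by rewrite !inE eqxx !orbT (negPf zs) orbF => /(_ isT).
have := on_square _ _ _ _ z [:: y; p'; z; p] sq nxz nyz.
rewrite !inE eqxx !orbT (negPf zs) /=; apply=> //.
rewrite /graph_cycle /ucycleb /= !inE !negb_or xs sy yp' pz' [A z p]linked_sym pz.
rewrite [A p x]linked_sym xp (linked_neq xs) xy xp' nxz (linked_neq xp).
rewrite (linked_neq sy) sp' [s == z]eq_sym zs sp (linked_neq yp') nyz yp.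
by rewrite (linked_neq pz') [p' == p]eq_sym pp' eq_sym (linked_neq pz).
Qed.

(** * The filling of a chordal cactus *)

(** The vertices [x] and [y] are the two shared vertices of the piece, which
    the edges to [z] leave. *)
Definition inner_chord : rel V := fun x y =>
  [&& x != y, ~~ h x y &
    [exists e in EE, [&& x \in H e, y \in H e &
      [exists z, [&& z \notin H e, h x z & h y z]]]]].

(** A diagonal of a piece that is a 4-cycle.  A diagonal between two shared
    vertices is left out: three such pieces around a triangle of the skeleton
    would give a triangle of new edges. *)
Definition inner_diagonal : rel V := fun x y =>
  [&& x != y, ~~ h x y, ~~ (shared x && shared y) &
    [exists e in EE, [&& x \in H e, y \in H e &
      [exists s in H e, [exists k in H e,
        [&& s != k, ~~ h s k & [&& h x s, h s y, h y k & h k x]]]]]]].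

(** A diagonal of a square whose four edges are in four different pieces. *)
Definition outer_diagonal : rel V := fun x y =>
  [&& x != y, ~~ common x y &
    [exists s, [exists k, [&& s != k, ~~ common s k & [&& h x s, h s y, h y k & h k x]]]]].

Definition filling : rel V := fun x y =>
  [|| h x y, inner_chord x y, inner_diagonal x y | outer_diagonal x y].
Local Notation hp := filling.

Lemma inner_chordP x y : reflect
  (exists e z, [/\ [/\ e \in EE, x \in H e, y \in H e & z \notin H e],
                   x != y, ~~ h x y, h x z & h y z])
  (inner_chord x y).
Proof.
apply: (iffP and3P) => [[xy nxy /exists_inP[e eE /and3P[xe ye /existsP[z /and3P[ze xz yz]]]]]|].
  by exists e, z.
case=> e [z [[eE xe ye ze] xy nxy xz yz]]; split => //.
by apply/exists_inP; exists e => //; rewrite xe ye; apply/existsP; exists z; rewrite ze xz.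
Qed.

Lemma inner_diagonalP x y : reflect
  (exists e s k, [/\ [/\ e \in EE, x \in H e, y \in H e, s \in H e & k \in H e],
     [/\ x != y, s != k, ~~ h x y & ~~ h s k], ~~ (shared x && shared y) &
     [/\ h x s, h s y, h y k & h k x]])
  (inner_diagonal x y).
Proof.
apply: (iffP and4P) => [[xy nxy nsh /exists_inP[e eE /and3P[xe ye]]]|].
  case/exists_inP=> s se /exists_inP[k ke /and3P[sk nsk /and4P[xs sy yk kx]]].
  by exists e, s, k.
case=> e [s [k [[eE xe ye se ke] [xy sk nxy nsk] nsh [xs sy yk kx]]]]; split => //.
apply/exists_inP; exists e => //; rewrite xe ye /=.
apply/exists_inP; exists s => //; apply/exists_inP; exists k => //.
by rewrite sk nsk xs sy yk.
Qed.

Lemma outer_diagonalP x y : reflect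
  (exists s k, [/\ [/\ x != y, s != k, ~~ common x y & ~~ common s k] &
     [/\ h x s, h s y, h y k & h k x]])
  (outer_diagonal x y).
Proof.
apply: (iffP and3P) => [[xy nxy /existsP[s /existsP[k /and3P[sk nsk /and4P[xs sy yk kx]]]]]|].
  by exists s, k.
case=> s [k [[xy sk nxy nsk] [xs sy yk kx]]]; split => //.
by apply/existsP; exists s; apply/existsP; exists k; rewrite sk nsk xs sy yk.
Qed.

Lemma inner_chord_sym : ssrbool.symmetric inner_chord.
Proof.
move=> x y; apply/inner_chordP/inner_chordP => -[e [z [[eE xe ye ze] xy nxy xz yz]]];
  by exists e, z; split; rewrite // 1?eq_sym // hsym.
Qed.

Lemma inner_diagonal_sym : ssrbool.symmetric inner_diagonal.
Proof.
suff imp x y : inner_diagonal x y -> inner_diagonal y x.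
  by move=> x y; apply/idP/idP; apply: imp.
move=> /inner_diagonalP[e [s [k [[eE xe ye se ke] [xy sk nxy nsk] nsh [xs sy yk kx]]]]].
apply/inner_diagonalP; exists e, s, k; split; [by [] | | by rewrite andbC | by split; rewrite hsym].
by split; rewrite // 1?eq_sym // hsym.
Qed.

Lemma outer_diagonal_sym : ssrbool.symmetric outer_diagonal.
Proof.
move=> x y; apply/outer_diagonalP/outer_diagonalP;
  move=> -[s [k [[xy sk nxy nsk] [xs sy yk kx]]]];
  by exists s, k; split; split; rewrite // 1?eq_sym // 1?common_sym // hsym.
Qed.

Lemma filling_sym : ssrbool.symmetric hp.
Proof.
move=> x y; rewrite /filling hsym inner_chord_sym inner_diagonal_sym.
by rewrite outer_diagonal_sym.
Qed.

Lemma filling_irr : irreflexive hp.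
Proof.
move=> x; rewrite /filling hirr /inner_chord /inner_diagonal /outer_diagonal.
by rewrite eqxx.
Qed.

Lemma filling_neq x y : hp x y -> x != y.
Proof. by move=> xy; apply: contraTneq xy => ->; rewrite filling_irr. Qed.

Lemma h_filling x y : h x y -> hp x y.
Proof. by rewrite /filling => ->. Qed.

Lemma h_linked x y : shared x -> shared y -> h x y -> A x y.
Proof.
move=> sx sy hxy; rewrite /linked sx sy h_common // !andbT /=.
by apply: contraTneq hxy => ->; rewrite hirr.
Qed.

Lemma outside_shared e x z : e \in EE -> x \in H e -> z \notin H e -> h x z -> shared x.
Proof.
move=> eE xe ze /h_common/commonP[f [fE xf zf]]; apply: sharedI eE fE _ xe xf.
by apply: contraNneq ze => ->.
Qed.

Lemma inner_chord_triangle x y : inner_chord x y ->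
  exists z, [/\ A x y, A x z, A y z, h x z & h y z].
Proof.
case/inner_chordP=> e [z [[eE xe ye ze] xy nxy xz yz]].
have sx := outside_shared eE xe ze xz; have sy := outside_shared eE ye ze yz.
have sz : shared z.
  case/commonP: (h_common xz) => f [fE xf zf].
  case/commonP: (h_common yz) => g [gE yg zg].
  apply: (sharedI fE gE _ zf zg); apply: contraNneq ze => fg; rewrite -fg in yg.
  by rewrite -(piece_unique fE eE xy xf yg xe ye).
exists z; split => //; [|exact: h_linked|exact: h_linked].
by rewrite /linked xy sx sy; apply/commonP; exists e.
Qed.

Lemma outer_diagonal_square x y : outer_diagonal x y ->
  exists s k, [/\ linked_square x s y k, outer_diagonal s k &
     [/\ h x s, h s y, h y k & h k x]].
Proof.
move=> /outer_diagonalP[s [k [[xy sk nxy nsk] [xs sy yk kx]]]]; exists s, k.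
have sh p q r : h p q -> h q r -> ~~ common p r -> shared q.
  move=> /h_common/commonP[f [fE pf qf]] /h_common/commonP[g [gE qg rg]] npr.
  apply: (sharedI fE gE _ qf qg); apply: contraNneq npr => fg.
  by rewrite -fg in rg; apply/commonP; exists f.
have shs := sh _ _ _ xs sy nxy; have shk := sh _ _ _ yk kx _.
have {}shk : shared k by apply: shk; rewrite common_sym.
have shy := sh _ _ _ sy yk nsk; have shx : shared x.
  by apply: sh kx xs _; rewrite common_sym.
split => //; first by rewrite /linked_square xy sk !h_linked.
by apply/outer_diagonalP; exists y, x; split; split; rewrite // 1?eq_sym // 1?common_sym // 1?hsym.
Qed.

Lemma filling_shared x y : shared x -> shared y -> hp x y -> A x y || outer_diagonal x y.
Proof.
move=> sx sy /or4P[hxy|/inner_chord_triangle[z [-> //]]|/inner_diagonalP|->].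
- by rewrite h_linked.
- by case=> e [s [k [_ _]]]; rewrite sx sy.
- by rewrite orbT.
Qed.

Lemma outer_diagonal_opposite x y : outer_diagonal x y -> opposite x y.
Proof. by case/outer_diagonal_square=> s [k [sq _ _]]; apply/oppositeP; exists s, k. Qed.

Lemma filling_linked x y : shared x -> shared y -> hp x y -> A x y || opposite x y.
Proof.
move=> sx sy /(filling_shared sx sy)/orP[->//|/outer_diagonal_opposite ->].
by rewrite orbT.
Qed.

(** If no opposite pair of the square is in a common piece, the diagonals are
    outer.  If [x] and [y] are in the piece [e], either one of [s] and [k] is
    outside [e] and [x], [y] is an inner chord, or the square is inside [e];
    then one of its four vertices is unshared, since [e] has at most two
    shared vertices, and the diagonal through this vertex is inner. *)
Lemma filling_square_diagonal x s y k : x != y -> s != k ->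
  h x s -> h s y -> h y k -> h k x -> hp x y || hp s k.
Proof.
move=> xy sk xs sy yk kx; apply/norP => -[nxy nsk].
have [hxy hsk] : ~~ h x y /\ ~~ h s k.
  by split; [apply: contraNN nxy | apply: contraNN nsk]; apply: h_filling.
have chord p q z e : ~~ hp p q -> ~~ h p q -> p != q -> e \in EE -> p \in H e ->
    q \in H e -> h p z -> h z q -> z \in H e.
  move=> npq hpq pq eE pe qe pz zq; apply: contraNT npq => ze.
  rewrite /filling; suff -> : inner_chord p q by rewrite !orbT.
  by apply/inner_chordP; exists e, z; split; rewrite // hsym.
case: (boolP (common x y)) => [/commonP[e [eE xe ye]]|cxy].
  have se := chord _ _ _ _ nxy hxy xy eE xe ye xs sy.
  have ke : k \in H e by apply: (chord _ _ _ _ nxy hxy xy eE xe ye); rewrite hsym.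
  case: (boolP (shared x && shared y)) => [/andP[sx sy']|nsh].
    case: (boolP (shared s && shared k)) => [/andP[ss sk']|nsh].
      have ne p q : h p q -> (p == q) = false.
        by move=> hpq; apply: contraTF hpq => /eqP ->; rewrite hirr.
      have := shared_pair eE xy sx sy' ss xe ye se.
      by rewrite eq_sym (ne _ _ xs) (ne _ _ sy).
    case/negP: nsk; rewrite /filling; suff -> : inner_diagonal s k by rewrite !orbT.
    apply/inner_diagonalP; exists e, y, x; split; [by [] | | by [] | by split; rewrite ?sy].
    by split; rewrite // 1?eq_sym // hsym.
  case/negP: nxy; rewrite /filling; suff -> : inner_diagonal x y by rewrite !orbT.
  by apply/inner_diagonalP; exists e, s, k.
case: (boolP (common s k)) => [/commonP[e [eE se ke]]|csk].
  case/negP: cxy; apply/commonP; exists e; split => //.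
    by apply: (chord _ _ _ _ nsk hsk sk eE se ke); rewrite // hsym.
  by apply: (chord _ _ _ _ nsk hsk sk eE se ke).
case/negP: nxy; rewrite /filling; suff -> : outer_diagonal x y by rewrite !orbT.
by apply/outer_diagonalP; exists s, k.
Qed.

Lemma cycle_degree2 (N : {set V}) v x y z : is_cycle_graph (induced h N) -> v \in N ->
  x \in N -> y \in N -> z \in N -> h v x -> h v y -> h v z ->
  [|| x == y, y == z | x == z].
Proof.
case=> n n3 [f [[f' fK f'K] fE]] vN xN yN zN.
pose i u (uN : u \in N) := f' (exist _ u uN).
have hE u w (uN : u \in N) (wN : w \in N) : h u w = cycle_graph n (i u uN) (i w wN).
  by rewrite -fE /i !f'K.
have iinj u w (uN : u \in N) (wN : w \in N) : i u uN = i w wN -> u = w.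
  by move=> /(can_inj f'K)/(congr1 val).
rewrite (hE _ _ vN xN) (hE _ _ vN yN) (hE _ _ vN zN) /cycle_graph.
have next_eq u w (uN : u \in N) (wN : w \in N) : (i v vN).+1 %% n == i u uN ->
    (i v vN).+1 %% n == i w wN -> u == w.
  move=> /eqP E1 /eqP E2; apply/eqP/(iinj _ _ uN wN)/val_inj.
  by rewrite /= -E1 -E2.
have prev_eq u w (uN : u \in N) (wN : w \in N) : (i u uN).+1 %% n == i v vN ->
    (i w wN).+1 %% n == i v vN -> u == w.
  move=> /eqP E1 /eqP E2; apply/eqP/(iinj _ _ uN wN)/val_inj/eqP.
  move/eqP: (etrans E1 (esym E2)); rewrite -[(i u uN).+1]addn1 -[(i w wN).+1]addn1.
  by rewrite eqn_modDr !modn_small.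
case/orP=> hx /orP[] hy /orP[] hz.
- by rewrite (next_eq _ _ xN yN).
- by rewrite (next_eq _ _ xN yN).
- by rewrite (next_eq _ _ xN zN) ?orbT.
- by rewrite (prev_eq _ _ yN zN) ?orbT.
- by rewrite (next_eq _ _ yN zN) ?orbT.
- by rewrite (prev_eq _ _ xN zN) ?orbT.
- by rewrite (prev_eq _ _ xN yN).
- by rewrite (prev_eq _ _ xN yN).
Qed.

Lemma hole_free_square (N : {set V}) x s y k : hole_free h N -> x != y -> s != k ->
  x \in N -> s \in N -> y \in N -> k \in N ->
  h x s -> h s y -> h y k -> h k x -> h x y || h s k.
Proof.
move=> hN xy sk xN sN yN kN xs sy yk kx; apply/norP => -[nxy nsk].
have ne p q : h p q -> p != q by apply: contraTneq => ->; rewrite hirr.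
have un : uniq [:: x; s; y; k].
  rewrite /= !inE !negb_or xy sk (ne _ _ xs) (ne _ _ sy) (ne _ _ yk).
  by rewrite eq_sym (ne _ _ kx).
pose f (i : 'I_4) := nth x [:: x; s; y; k] i.
apply: (hN 4 f) => //.
- by move=> i j /eqP; rewrite nth_uniq // => /eqP/val_inj.
- by case=> [[|[|[|[|//]]]] i4].
- have E := (hirr, (xs, sy, yk, kx), (negPf nxy, negPf nsk)).
  case=> [[|[|[|[|//]]]] i4] [[|[|[|[|//]]]] j4]; rewrite /f /cycle_graph /= ?E //;
    by rewrite hsym E.
Qed.

Lemma inner_diagonal_cycle x y e : inner_diagonal x y -> e \in EE -> x \in H e ->
  y \in H e -> is_cycle_graph (induced h (H e)).
Proof.
case/inner_diagonalP=> f [s [k [[fE xf yf sf kf] [xy sk nxy nsk] _ [xs sy yk kx]]]] eE xe ye.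
rewrite (piece_unique eE fE xy xe ye xf yf).
case: (piece_type rep fE) => // /chordal_hole_free hN.
have := hole_free_square hN xy sk xf sf yf kf xs sy yk kx.
by rewrite (negPf nxy) (negPf nsk).
Qed.

Lemma unshared_filling e x w : ~~ shared x -> e \in EE -> x \in H e -> hp x w ->
  w \in H e /\ (h x w \/ inner_diagonal x w).
Proof.
move=> nx eE xe /or4P[hxw|/inner_chord_triangle[z [/and4P[_ sx]]]|dxw|].
- case/commonP: (h_common hxw) => f [fE xf wf].
  by rewrite (unshared_piece nx eE fE xe xf); split => //; left.
- by rewrite sx in nx.
- case/inner_diagonalP: (dxw) => f [s [k [[fE xf wf _ _] _ _ _]]].
  by rewrite (unshared_piece nx eE fE xe xf); split => //; right.
- case/outer_diagonal_square=> s [k [/and5P[_ _ /and4P[_ sx]]]].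
  by rewrite sx in nx.
Qed.

(** A common neighbour of [x], [y] and [w] would have degree 3 in a cycle. *)
Lemma inner_diagonal_unique e x y w : e \in EE -> x \in H e -> y \in H e -> w \in H e ->
  inner_diagonal x y -> inner_diagonal x w -> y = w.
Proof.
move=> eE xe ye we dxy dxw; have cyc := inner_diagonal_cycle dxy eE xe ye.
case/inner_diagonalP: (dxy) => f [s [k [[fE xf yf sf kf] [xy sk nxy nsk] _ [xs sy yk kx]]]].
case/inner_diagonalP: (dxw) => f' [s' [k' [[f'E xf' wf' sf' kf'] [xw sk' nxw nsk'] _]]].
move=> [xs' sw wk' kx']; have fe := piece_unique fE eE xy xf yf xe ye.
have f'e := piece_unique f'E eE xw xf' wf' xe we; rewrite fe f'e in sf kf sf' kf'.
have sw' : h s w.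
  rewrite hsym in kx; rewrite hsym in kx'.
  have := cycle_degree2 cyc xe sf kf sf' xs kx xs'; rewrite (negPf sk) /=.
  case/orP=> [/eqP ks'|/eqP -> //].
  have := cycle_degree2 cyc xe sf kf kf' xs kx kx'; rewrite (negPf sk) /=.
  case/orP=> [/eqP kk'|/eqP ->]; last by rewrite hsym.
  by rewrite -ks' -kk' eqxx in sk'.
rewrite hsym in xs; have := cycle_degree2 cyc sf xe ye we xs sy sw'.
by rewrite (negPf xy) (negPf xw) orbF /= => /eqP.
Qed.

(** An end [x] that is unshared has all its neighbours in its piece, which is
    a 4-cycle; so [z] is one of the other two vertices. *)
Lemma inner_diagonal_triangle x y z : inner_diagonal x y -> hp x z -> hp y z ->
  h x z /\ h y z.
Proof.
wlog nx : x y / ~~ shared x.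
  move=> W dxy xz yz; case/inner_diagonalP: (dxy) => e [s [k [_ _ + _]]].
  rewrite negb_and => /orP[nx|ny]; first exact: W.
  by have [] := W y x ny _ yz xz; first by rewrite inner_diagonal_sym.
move=> dxy xz yz; have cyc e := inner_diagonal_cycle (e := e) dxy.
case/inner_diagonalP: (dxy) => e [s [k [[eE xe ye se ke] [xy sk nxy nsk] _ [xs sy yk kx]]]].
have [ze [hxz|dxz]] := unshared_filling nx eE xe xz; last first.
  by have := filling_neq yz; rewrite (inner_diagonal_unique eE xe ye ze dxy dxz) eqxx.
split => //; rewrite hsym in kx.
have := cycle_degree2 (cyc e eE xe ye) xe se ke ze xs kx hxz.
by rewrite (negPf sk) /= => /orP[] /eqP <- //; rewrite hsym.
Qed.

(** An inner diagonal is not in a triangle with another new edge, by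
    [inner_diagonal_triangle].  The other new edges join shared vertices: an
    outer diagonal is controlled by [square_third], and an inner chord is on a
    triangle of [linked] whose other two edges are in [h], which is the only
    cycle of [linked] through it. *)
Lemma filling_triangle x y z : hp x y -> hp y z -> hp x z -> ~~ h x y -> ~~ h y z -> False.
Proof.
move=> pxy pyz pxz nxy nyz.
case: (boolP (inner_diagonal x y)) => [dxy|ndxy].
  by have [_ hyz] := inner_diagonal_triangle dxy pxz pyz; rewrite hyz in nyz.
case: (boolP (inner_diagonal y z)) => [dyz|ndyz].
  rewrite filling_sym in pxy; rewrite filling_sym in pxz.
  have [hyx _] := inner_diagonal_triangle dyz pxy pxz.
  by rewrite hsym hyx in nxy.
have new p q : hp p q -> ~~ h p q -> ~~ inner_diagonal p q ->
    inner_chord p q \/ outer_diagonal p q.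
  by move=> /or4P[->//|->|->//|->]; [left | right].
have sh p q : inner_chord p q \/ outer_diagonal p q -> shared p /\ shared q.
  case=> [/inner_chord_triangle[w [/and4P[_ ? ?]]] //|].
  case/outer_diagonal_square=> s [k [/and5P[_ _ /and4P[_ ? _ _] /and4P[_ _ ? _] _]]] _ _.
  by [].
have mxy := new _ _ pxy nxy ndxy; have myz := new _ _ pyz nyz ndyz.
have [sx sy] := sh _ _ mxy; have [_ sz] := sh _ _ myz.
case: mxy => [cxy|/outer_diagonal_square[s [k [sq _ [_ sy' yk _]]]]]; last first.
  have := square_third sq (filling_linked sx sz pxz) (filling_linked sy sz pyz).
  by case/orP=> /eqP zE; move: nyz; rewrite zE ?yk // hsym sy'.
case: myz => [cyz|/outer_diagonal_square[s [k [sq _ [ys _ _ ky]]]]]; last first.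
  have := square_third sq; move/(_ x).
  rewrite (filling_linked sy sx) 1?filling_sym // (filling_linked sz sx) 1?filling_sym //.
  by move=> /(_ isT isT)/orP[] /eqP xE; move: nxy; rewrite xE ?ky // hsym ys.
case/orP: (filling_shared sx sz pxz) => [Axz|/outer_diagonal_square[s [k [sq _ [xs _ _ kx]]]]].
  have [w [Axy Axw Ayw _ yw]] := inner_chord_triangle cxy.
  have [_ [Ayz _ _ _ _]] := inner_chord_triangle cyz.
  have := linked_cycles_head (triangle_cycle Axy Ayz Axz) (triangle_cycle Axy Ayw Axw) z.
  rewrite !inE eqxx !orbT !(eq_sym z) (negPf (linked_neq Axz)) (negPf (linked_neq Ayz)) /=.
  by move/esym/eqP => wz; rewrite -wz yw in nyz.
have := square_third sq (filling_linked sx sy pxy).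
rewrite (filling_linked sz sy) 1?filling_sym // => /(_ isT)/orP[] /eqP yE.
  by rewrite yE xs in nxy.
by rewrite yE hsym kx in nxy.
Qed.

(** The cycle is the triangle [v], [w], [c], or a square if one of the edges to
    [c] is an outer diagonal. *)
Lemma linked_cycle_through v w (c : V) : A v w -> shared c -> hp v c -> hp w c ->
  exists p, [/\ graph_cycle A [:: v, w & p], c \in p &
    forall d, d \in p -> d != c -> h c d].
Proof.
move=> Avw sc vc wc; have [_ sv sw _] := and4P Avw.
case/orP: (filling_shared sv sc vc) => [Avc|].
  case/orP: (filling_shared sw sc wc) => [Awc|].
    exists [:: c]; split; rewrite ?mem_head //; first exact: triangle_cycle.
    by move=> d; rewrite inE => /eqP ->; rewrite eqxx.
  case/outer_diagonal_square=> s [k [sq _ [hws hsc hck hkw]]].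
  have := square_third sq (z := v); rewrite linked_sym Avw linked_sym Avc.
  move=> /(_ isT isT) vsk.
  have [k' [sq' hk']] : exists k', linked_square w v c k' /\ h c k'.
    case/orP: vsk => /eqP ->; first by exists k.
    by exists s; split; [exact: square_swap | rewrite hsym].
  exists [:: k'; c]; split.
  - have := square_cycle sq'; have := square_rev sq'; case/and5P=> cw vk cv vw /andP[wk' k'c].
    move=> _; apply: square_cycle; rewrite /linked_square Avw wk' k'c linked_sym Avc.
    by case/and5P: sq' => -> -> *.
  - by rewrite !inE eqxx orbT.
  - by move=> d; rewrite !inE => /orP[] /eqP ->; rewrite ?eqxx.
case/outer_diagonal_square=> s [k [sq _ [hvs hsc hck hkv]]].
have := square_third sq (z := w) _ _; rewrite Avw => /(_ isT).
rewrite (filling_linked sc sw) 1?filling_sym // => /(_ isT) wsk.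
have [k' [sq' hk']] : exists k', linked_square v w c k' /\ h c k'.
  case/orP: wsk => /eqP ->; first by exists k.
  by exists s; split; [exact: square_swap | rewrite hsym].
exists [:: c; k']; split; rewrite ?mem_head //; first exact: square_cycle.
by move=> d; rewrite !inE => /orP[] /eqP ->; rewrite ?eqxx.
Qed.

(** If [v] and [w] are linked, then [c] and [d] are on the same cycle through
    the edge [v], [w], and this cycle is a square.  If they are joined by an
    outer diagonal, [c] and [d] are the other two corners. *)
Lemma shared_link v w (c d : V) : shared v -> shared w -> shared c -> shared d ->
  hp v w -> hp v c -> hp w c -> hp v d -> hp w d -> c != d -> hp c d.
Proof.
move=> sv sw sc sd vw vc wc vd wd cd.
case/orP: (filling_shared sv sw vw) => [Avw|].
  have [p [gp cp _]] := linked_cycle_through Avw sc vc wc.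
  have [q [gq dq dnb]] := linked_cycle_through Avw sd vd wd.
  apply: h_filling; rewrite hsym; apply: dnb => //.
  have := linked_cycles_head gp gq c; rewrite !inE cp !orbT.
  by rewrite !(eq_sym c) (negPf (filling_neq vc)) (negPf (filling_neq wc)) /= => <-.
case/outer_diagonal_square=> s [k [sq dsk _]].
have on z : shared z -> hp v z -> hp w z -> (z == s) || (z == k).
  by move=> sz vz wz; apply: square_third sq _ _; apply: filling_linked.
have skp : hp s k by rewrite /filling dsk !orbT.
case/orP: (on c sc vc wc) (on d sd vd wd) cd => /eqP -> /orP[] /eqP ->;
  by rewrite ?eqxx // filling_sym.
Qed.

Lemma simplicially_reducible_eq (L L' : rel V) (N : {set V}) :
  {in N &, L =2 L'} -> simplicially_reducible L N -> simplicially_reducible L' N.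
Proof.
move=> LL' red X XN X0; have [w wX wcl] := red X XN X0; exists w => //.
have inN x : x \in X -> x \in N by apply: (subsetP XN).
apply/is_cliqueP => x y; rewrite !inE => /andP[xX wx] /andP[yX wy] xy.
rewrite -LL' ?inN //; apply: (is_cliqueP _ _ wcl) => //.
  by rewrite inE xX LL' ?inN.
by rewrite inE yX LL' ?inN.
Qed.

Lemma clique_reducible (L : rel V) (N : {set V}) :
  is_clique L N -> simplicially_reducible L N.
Proof.
move=> cl X XN /set0Pn[w wX]; exists w => //; apply: is_cliqueS cl.
by apply/subsetP => x; rewrite inE => /andP[/(subsetP XN)].
Qed.

(** The vertex [v] has its two neighbours on the cycle and possibly the opposite
    corner of a 4-cycle, which is joined to both. *)
Lemma cycle_piece_reducible U e v : ~~ shared v -> e \in EE -> v \in H e ->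
  is_cycle_graph (induced h (H e)) -> simplicially_reducible hp (nbhd hp U v).
Proof.
move=> nv eE ve cyc X XN X0.
have XP x : x \in X -> x \in H e /\ (h v x \/ inner_diagonal v x).
  by move=> /(subsetP XN); rewrite inE => /andP[_]; apply: unshared_filling.
case: (boolP [exists q in X, inner_diagonal v q]) => [/exists_inP[q qX dvq]|].
  case/inner_diagonalP: (dvq) => f [s [k [[fE vf qf sf kf] [vq sk nvq nsk] _ [vs sq qk kv]]]].
  have fe := unshared_piece nv fE eE vf ve; rewrite fe in qf sf kf.
  have Xskq x : x \in X -> [|| x == s, x == k | x == q].
    move=> /XP[xe [vx|dvx]].
      rewrite hsym in kv; have := cycle_degree2 cyc ve sf kf xe vs kv vx.
      by rewrite (negPf sk) !(eq_sym x) /= => /orP[] ->; rewrite ?orbT.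
    by rewrite (inner_diagonal_unique eE ve xe qf dvx dvq) eqxx !orbT.
  have kq : hp k q by apply: h_filling; rewrite hsym.
  case: (boolP (s \in X)) => [sX|nsX].
    exists s => //; apply/is_cliqueP => x y; rewrite !inE.
    move=> /andP[xX /filling_neq sx] /andP[yX /filling_neq sy].
    move: (Xskq x xX) (Xskq y yX); rewrite !(eq_sym _ s) (negPf sx) (negPf sy) /=.
    by move=> /orP[] /eqP -> /orP[] /eqP ->; rewrite ?eqxx // filling_sym.
  case: (boolP (k \in X)) => [kX|nkX].
    exists k => //; apply/is_cliqueP => x y; rewrite !inE.
    have q1 z : z \in X -> hp k z -> z = q.
      move=> zX kz; case/or3P: (Xskq z zX) => /eqP // zE.
        by rewrite -zE zX in nsX.
      by rewrite zE filling_irr in kz.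
    by move=> /andP[xX /(q1 _ xX) ->] /andP[yX /(q1 _ yX) ->]; rewrite eqxx.
  exists q => //; apply/is_cliqueP => x y; rewrite !inE => /andP[xX qx] _ _.
  case/or3P: (Xskq x xX) => /eqP xE; first by rewrite -xE xX in nsX.
    by rewrite -xE xX in nkX.
  by rewrite xE filling_irr in qx.
rewrite negb_exists_in => /forall_inP nd.
have {}XP x : x \in X -> x \in H e /\ h v x.
  by move=> xX; case: (XP x xX) => xe [//|dvx]; move: (nd x xX); rewrite dvx.
case/set0Pn: X0 => w wX; exists w => //; apply/is_cliqueP => x y; rewrite !inE.
move=> /andP[xX /filling_neq wx] /andP[yX /filling_neq wy] xy.
have [[we vw] [[xe vx] [ye vy]]] := (XP w wX, (XP x xX, XP y yX)).
by have := cycle_degree2 cyc ve we xe ye vw vx vy; rewrite (negPf wx) (negPf xy) (negPf wy).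
Qed.

(** In the neighbourhood of such a vertex the new edge from [p] to [q] may
    close a hole, so these vertices have to wait. *)
Definition under_chord v :=
  [exists p, [exists q, [&& inner_chord p q, h v p & h v q]]].

(** Unshared vertices that are not under a chord go first: they have the
    neighbourhood of a vertex in a chordal graph, or [cycle_piece_reducible]
    applies.  When all remaining unshared vertices are under a chord, those of
    a chordal piece form a clique with the ends of its chord, because [h] has
    no hole in the piece.  When only shared vertices remain, being joined is
    transitive on every neighbourhood, by [shared_link]. *)
Lemma filling_reducible : locally_reducible hp.
Proof.
move=> U /set0Pn[u uU].
have fill_chordal e v w : ~~ shared v -> e \in EE -> v \in H e -> hole_free h (H e) ->
    hp v w -> w \in H e /\ h v w.
  move=> nv eE ve hf vw; have [we [//|dvw]] := unshared_filling nv eE ve vw.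
  case/inner_diagonalP: dvw => f [s [k [[fE vf _ sf kf] [vw' sk nvw nsk] _ [vs sw wk kv]]]].
  have fe := unshared_piece nv fE eE vf ve; rewrite fe in sf kf.
  have := hole_free_square hf vw' sk ve sf we kf vs sw wk kv.
  by rewrite (negPf nvw) (negPf nsk).
case: (boolP [exists v in U, ~~ shared v && ~~ under_chord v]).
  case/exists_inP=> v vU /andP[nv nuc]; exists v => //.
  have [e eE ve] := piece_vertices rep v.
  case: (piece_type rep eE) => [|/chordal_hole_free hf]; first exact: cycle_piece_reducible nv eE ve.
  have NP w : w \in nbhd hp U v -> w \in H e /\ h v w.
    by rewrite inE => /andP[_]; apply: fill_chordal.
  apply: (@simplicially_reducible_eq h); last first.
    apply: hole_free_reducible => //; apply: hole_freeS hf.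
    by apply/subsetP => w /NP[].
  move=> x y /NP[xe vx] /NP[ye vy]; apply/idP/idP; first exact: h_filling.
  have cxy : common x y by apply/commonP; exists e.
  case/or4P => // [cxy'|dxy|/outer_diagonalP[s [k [[_ _]]]]]; last by rewrite cxy.
    by case/existsP: nuc; exists x; apply/existsP; exists y; rewrite cxy' vx.
  case/inner_diagonalP: dxy => f [s [k [[fE xf yf sf kf] [xy sk nxy nsk] _ [xs sy yk kx]]]].
  have fe := piece_unique fE eE xy xf yf xe ye; rewrite fe in sf kf.
  have := hole_free_square hf xy sk xe sf ye kf xs sy yk kx.
  by rewrite (negPf nxy) (negPf nsk).
rewrite negb_exists_in => /forall_inP uc.
have {}uc v : v \in U -> ~~ shared v -> under_chord v.
  by move=> vU nv; have := uc v vU; rewrite nv /= negbK.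
have under e v p q : ~~ shared v -> e \in EE -> v \in H e -> inner_chord p q ->
    h v p -> h v q -> [/\ p \in H e, q \in H e, shared p, shared q & p != q].
  move=> nv eE ve cpq vp vq; have [_ [/and4P[pq sp sq _] _ _ _ _]] := inner_chord_triangle cpq.
  by have [] := unshared_filling nv eE ve (h_filling vp);
     have [] := unshared_filling nv eE ve (h_filling vq).
case: (boolP [exists v in U, ~~ shared v]) => [/exists_inP[v vU nv]|].
  exists v => //; have [e eE ve] := piece_vertices rep v.
  case: (piece_type rep eE) => [|/chordal_hole_free hf]; first exact: cycle_piece_reducible nv eE ve.
  have /existsP[p /existsP[q /and3P[cpq vp vq]]] := uc v vU nv.
  have [pe qe sp sq pq] := under e v p q nv eE ve cpq vp vq.
  have NP w : w \in nbhd hp U v -> w \in H e /\ [|| w == p, w == q | h w p && h w q].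
    rewrite inE => /andP[wU vw]; have [we _] := fill_chordal _ _ _ nv eE ve hf vw.
    split => //; case: (boolP (shared w)) => [sw|nw].
      by have := shared_pair eE pq sp sq sw pe qe we => /orP[] ->; rewrite ?orbT.
    have /existsP[p' /existsP[q' /and3P[cpq' wp' wq']]] := uc w wU nw.
    have [pe' qe' sp' sq' pq'] := under e w p' q' nw eE we cpq' wp' wq'.
    have := shared_pair eE pq sp sq sp' pe qe pe'.
    have := shared_pair eE pq sp sq sq' pe qe qe'.
    move=> /orP[] /eqP qE /orP[] /eqP pE; rewrite pE qE ?eqxx // in pq' wp' wq'.
      by rewrite wp' wq' !orbT.
    by rewrite wp' wq' !orbT.
  apply: clique_reducible; apply/is_cliqueP => x y.
  have ppq : hp p q by rewrite /filling cpq !orbT.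
  move=> /NP[xe /or3P[/eqP ->|/eqP ->|/andP[xp xq]]] /NP[ye /or3P[/eqP ->|/eqP ->|/andP[yp yq]]];
    rewrite ?eqxx // => xy; try by rewrite // filling_sym.
  - by rewrite filling_sym h_filling.
  - by rewrite filling_sym h_filling.
  - exact: h_filling.
  - exact: h_filling.
  apply: h_filling; case/inner_chordP: (cpq) => f [z [_ _ npq _ _]].
  have := hole_free_square hf pq xy pe xe qe ye; rewrite (negPf npq) /=.
  by apply; rewrite // hsym.
rewrite negb_exists_in => /forall_inP sU.
have {}sU v : v \in U -> shared v by move=> /sU; rewrite negbK.
exists u => // X XN /set0Pn[w wX]; exists w => //.
have XP x : x \in X -> shared x /\ hp u x.
  by move=> /(subsetP XN); rewrite inE => /andP[/sU].
apply/is_cliqueP => x y; rewrite !inE => /andP[xX wx] /andP[yX wy] xy.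
have [[sw uw] [[sx ux] [sy uy]]] := (XP w wX, (XP x xX, XP y yX)).
exact: shared_link (sU u uU) sw sx sy uw ux wx uy wy xy.
Qed.

End Cactus.

Lemma co_chordal_cactus_co_chordal (V : finType) (g : rel V) r :
  simple_graph g -> co_chordal_cactus g -> 1 < r -> co_chordal r.+1 (conn_clutter r g).
Proof.
move=> [gsym girr] [T [t [H [a rep]]]] r2.
have hsym := compl_graph_sym gsym; have hirr := @compl_graph_irr _ g.
have nh x y : g x y -> ~~ compl_graph g x y by rewrite /compl_graph => ->; rewrite andbF.
apply: (@co_chordal_of_filling _ _ (filling (compl_graph g) t H)) => //.
- exact: filling_sym.
- exact: filling_irr.
- by move=> x y; apply: h_filling.
- by move=> x s y k; apply: (filling_square_diagonal hsym hirr rep).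
- move=> x y z xy yz xz /nh nxy /nh nyz.
  exact: (filling_triangle hsym hirr rep xy yz xz nxy nyz).
- exact: filling_reducible hsym hirr rep.
Qed.

(** * The Koszul differential and linear strands *)

Import GRing.Theory.
Local Open Scope ring_scope.

Lemma sum_antisym (I : finType) (R : zmodType) (c : I -> I -> R) :
  (forall i, c i i = 0) -> (forall i j, c i j = - c j i) ->
  \sum_i \sum_j c i j = 0.
Proof.
move=> c0 cN.
have split_sum i : \sum_j c i j = \sum_(j | (enum_rank j < enum_rank i)%N) c i j +
    \sum_(j | (enum_rank i < enum_rank j)%N) c i j.
  rewrite (bigID (fun j => enum_rank j < enum_rank i)%N) /=; congr (_ + _).
  rewrite (bigD1 i) ?ltnn //= c0 add0r; apply: eq_bigl => j.
  rewrite -leqNgt [RHS]ltn_neqAle andbC; congr (~~ _ && _).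
  by rewrite (inj_eq val_inj) (inj_eq enum_rank_inj) eq_sym.
rewrite (eq_bigr _ (fun i _ => split_sum i)) big_split /=.
rewrite [X in _ + X](exchange_big_dep predT) //= -big_split big1 //= => i _.
by rewrite -big_split big1 //= => j _; rewrite cN addNr.
Qed.

Section Contraction.
Variables (V : finType) (R : comNzRingType) (x : V -> R).
Implicit Types (u v w a : V) (A B C P S W s : {set V}) (z : {set V} -> R).
Implicit Types (f g : {set V} -> {set V} -> R) (E : {set {set V}}).

Definition below v A : nat := #|[set a in A | (enum_rank a < enum_rank v)%N]|.

(** The sign of moving [v] to its place in [v |: A], for the exterior algebra
    with basis the subsets of [V]. *)
Definition sgn v A : R := (-1) ^+ below v A.

Lemma sgn0 v : sgn v set0 = 1.
Proof.
by rewrite /sgn /below eq_card0 // => a; rewrite !inE.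
Qed.

Lemma sgn_sq v A : sgn v A * sgn v A = 1.
Proof. by rewrite /sgn -expr2 sqrr_sign. Qed.

Lemma sgnK v A (y : R) : sgn v A * (sgn v A * y) = y.
Proof. by rewrite mulrA sgn_sq mul1r. Qed.

Lemma sgn_inj v A (y y' : R) : sgn v A * y = sgn v A * y' -> y = y'.
Proof. by move=> e; rewrite -(sgnK v A y) e sgnK. Qed.

Lemma below_setU1 v w A : w \notin A ->
  below v (w |: A) = ((enum_rank w < enum_rank v) + below v A)%N.
Proof.
move=> wA; rewrite /below; case: (boolP (enum_rank w < enum_rank v)%N) => wv.
  have -> : [set a in w |: A | (enum_rank a < enum_rank v)%N] =
      w |: [set a in A | (enum_rank a < enum_rank v)%N].
    by apply/setP => a; rewrite !inE; case: (eqVneq a w) => [->|] //=; rewrite wv.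
  by rewrite cardsU1 inE (negPf wA).
rewrite add0n; apply: eq_card => a; rewrite !inE.
by case: (eqVneq a w) => [->|] //=; rewrite (negPf wv) andbF.
Qed.

Lemma sgn_swap v w A : v != w -> v \notin A -> w \notin A ->
  sgn v (w |: A) * sgn w A = - (sgn w (v |: A) * sgn v A).
Proof.
move=> vw vA wA; rewrite /sgn !below_setU1 // -!exprD.
have : enum_rank v != enum_rank w by apply: contraNneq vw => /enum_rank_inj ->.
by rewrite -val_eqE /=; case: ltngtP => //= _ _; rewrite !add0n add1n addSn exprS mulN1r
  ?opprK addnC.
Qed.

(** The contraction of the exterior algebra by the dual vector of [v]. *)
Definition contract v z A : R := if v \in A then 0 else sgn v A * z (v |: A).

Lemma contract_in v z A : v \in A -> contract v z A = 0.
Proof. by rewrite /contract => ->. Qed.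

Lemma contract_out v z A : v \notin A -> contract v z A = sgn v A * z (v |: A).
Proof. by rewrite /contract => /negPf ->. Qed.

Lemma eq_contract v z z' : z =1 z' -> contract v z =1 contract v z'.
Proof. by move=> e A; rewrite /contract e. Qed.

Lemma contract_sum v (I : Type) (r : seq I) (p : pred I) (F : I -> {set V} -> R) A :
  contract v (fun A' => \sum_(i <- r | p i) F i A') A = \sum_(i <- r | p i) contract v (F i) A.
Proof.
rewrite /contract; case: ifP => _; first by rewrite big1.
by rewrite mulr_sumr.
Qed.

Lemma contractZ v c z A : contract v (fun A' => c * z A') A = c * contract v z A.
Proof. by rewrite /contract; case: ifP => _; rewrite ?mulr0 // mulrCA. Qed.

Lemma contractD v z z' A :
  contract v (fun A' => z A' + z' A') A = contract v z A + contract v z' A.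
Proof. by rewrite /contract; case: ifP => _; rewrite ?addr0 // mulrDr. Qed.

Lemma contractN v z A : contract v (fun A' => - z A') A = - contract v z A.
Proof. by rewrite /contract; case: ifP => _; rewrite ?oppr0 // mulrN. Qed.

Lemma contract_eq0 v z A : (forall A', z A' = 0) -> contract v z A = 0.
Proof. by move=> z0; rewrite /contract z0 mulr0; case: ifP. Qed.

Lemma contract_sq v z A : contract v (contract v z) A = 0.
Proof.
by rewrite /contract; case: ifP => // _; rewrite setU11 mulr0.
Qed.

Lemma contractC v w z A : contract v (contract w z) A = - contract w (contract v z) A.
Proof.
have [->|vw] := eqVneq v w; first by rewrite contract_sq oppr0.
rewrite /contract !in_setU1 (negPf vw) eq_sym (negPf vw) /=.
case: (boolP (v \in A)) => vA; case: (boolP (w \in A)) => wA; rewrite ?mulr0 ?oppr0 //.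
rewrite setUCA !mulrA [sgn v A * _]mulrC [sgn w A * _]mulrC.
by rewrite (@sgn_swap w v) 1?eq_sym // mulNr.
Qed.

Definition koszul z A : R := \sum_v x v * contract v z A.

Lemma eq_koszul z z' : z =1 z' -> koszul z =1 koszul z'.
Proof. by move=> e A; apply: eq_bigr => v _; rewrite (eq_contract _ e). Qed.

Lemma koszulD z z' A : koszul (fun A' => z A' + z' A') A = koszul z A + koszul z' A.
Proof. by rewrite -big_split; apply: eq_bigr => v _; rewrite contractD mulrDr. Qed.

Lemma koszulN z A : koszul (fun A' => - z A') A = - koszul z A.
Proof. by rewrite -sumrN; apply: eq_bigr => v _; rewrite contractN mulrN. Qed.

Lemma koszulZ c z A : koszul (fun A' => c * z A') A = c * koszul z A.
Proof. by rewrite mulr_sumr; apply: eq_bigr => v _; rewrite contractZ mulrCA. Qed.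

Lemma koszul_sum (I : Type) (r : seq I) (p : pred I) (F : I -> {set V} -> R) A :
  koszul (fun A' => \sum_(i <- r | p i) F i A') A = \sum_(i <- r | p i) koszul (F i) A.
Proof.
rewrite /koszul exchange_big; apply: eq_bigr => v _.
by rewrite contract_sum mulr_sumr.
Qed.

Lemma koszul_eq0 z A : (forall A', z A' = 0) -> koszul z A = 0.
Proof. by move=> z0; apply: big1 => v _; rewrite contract_eq0 ?mulr0. Qed.

Lemma contract_koszul v z A : contract v (koszul z) A = - koszul (contract v z) A.
Proof.
rewrite /koszul contract_sum -sumrN; apply: eq_bigr => w _.
by rewrite contractZ contractC mulrN.
Qed.

Lemma koszul_sq z A : koszul (koszul z) A = 0.
Proof.
rewrite /koszul.
have -> : \sum_v x v * contract v (koszul z) A =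
    \sum_v \sum_w x v * (x w * contract v (contract w z) A).
  apply: eq_bigr => v _; rewrite -mulr_sumr; congr (_ * _).
  by rewrite /koszul contract_sum; apply: eq_bigr => w _; rewrite contractZ.
apply: sum_antisym => [v|v w]; first by rewrite contract_sq !mulr0.
by rewrite contractC !mulrN mulrCA.
Qed.

Definition supported S z := forall A, ~~ (A \subset S) -> z A = 0.

Lemma supported_contract S v z : supported S z -> supported S (contract v z).
Proof.
move=> zS A AS; rewrite /contract; case: ifP => // _; rewrite zS ?mulr0 //.
by apply: contra AS; apply: subset_trans; apply: subsetUr.
Qed.

Lemma supported_koszul S z : supported S z -> supported S (koszul z).
Proof.
by move=> zS A AS; apply: big1 => v _; rewrite (supported_contract v zS) ?mulr0.
Qed.

Lemma koszul0 S z : supported S z -> koszul z set0 = \sum_(v in S) x v * z [set v].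
Proof.
move=> zS; rewrite /koszul (bigID (mem S)) /= [X in _ + X]big1 ?addr0.
  by apply: eq_bigr => v _; rewrite contract_out ?inE // sgn0 mul1r setU0.
move=> v vS; rewrite contract_out ?inE // setU0 zS ?mulr0 //.
by rewrite sub1set.
Qed.

Definition linear_form (P : {set V}) (c : V -> R) A : R := \sum_(v in P | A == [set v]) c v.

Lemma supported_linear_form P c : supported P (linear_form P c).
Proof.
move=> A AP; apply: big1 => v /andP[vP /eqP AE]; case/negP: AP.
by rewrite AE sub1set.
Qed.

Lemma linear_form1 P c v : v \in P -> linear_form P c [set v] = c v.
Proof.
move=> vP; rewrite /linear_form (big_pred1 v) // => w.
by apply/andP/eqP => [[_ /eqP/set1_inj ->]|->].
Qed.

Lemma contract2_linear_form P c v w A : contract v (contract w (linear_form P c)) A = 0.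
Proof.
rewrite /contract; case: ifP => // vA; case: ifPn => wA; rewrite ?mulr0 //.
rewrite [linear_form _ _ _]big1 ?mulr0 // => u /andP[_ /eqP AE].
have wu : w = u by apply/set1P; rewrite -AE setU11.
have vu : v = u by apply/set1P; rewrite -AE !inE eqxx orbT.
by move: wA; rewrite wu vu setU11.
Qed.

Lemma contract_cancel v z z' A : v \in A ->
  contract v z (A :\ v) = contract v z' (A :\ v) -> z A = z' A.
Proof.
move=> vA; rewrite !contract_out ?setD11 // setD1K //.
exact: sgn_inj.
Qed.

(** The value [f B A] is the coefficient of the basis vector [A] of the exterior
    algebra tensored with the monomial [mon B] of the ideal of [E].  The last
    two conditions say that contracting by [v] and multiplying by [x v] at the
    same time, summed over [v], gives 0: the second one collects the monomials
    that are not squarefree, the third one the monomial of [W].  They have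
    constant coefficients, so their solutions form a free module. *)
Definition lin_cycle E f :=
  [/\ forall B A, B \notin E -> f B A = 0,
      forall B A, ~~ [disjoint A & B] -> f B A = 0 &
      forall W A, \sum_(a in W) contract a (f (W :\ a)) A = 0].

Definition mon B : R := \prod_(v in B) x v.

Definition aug_map f : R := \sum_B f B set0 * mon B.

Lemma lin_cycleD E f g : lin_cycle E f -> lin_cycle E g ->
  lin_cycle E (fun B A => f B A + g B A).
Proof.
move=> [f1 f2 f3] [g1 g2 g3]; split=> [B A BE|B A AB|W A].
- by rewrite f1 // g1 // addr0.
- by rewrite f2 // g2 // addr0.
- under eq_bigr do rewrite contractD.
  by rewrite big_split /= f3 g3 addr0.
Qed.

Lemma lin_cycleN E f : lin_cycle E f -> lin_cycle E (fun B A => - f B A).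
Proof.
move=> [f1 f2 f3]; split=> [B A BE|B A AB|W A].
- by rewrite f1 // oppr0.
- by rewrite f2 // oppr0.
- under eq_bigr do rewrite contractN.
  by rewrite sumrN f3 oppr0.
Qed.

Lemma lin_cycleS E E' f : E \subset E' -> lin_cycle E f -> lin_cycle E' f.
Proof.
move=> /subsetP EE' [f1 f2 f3]; split => // B A BE'; apply: f1.
by apply: contra BE'; apply: EE'.
Qed.

Lemma eq_lin_cycle E f g : (forall B A, f B A = g B A) -> lin_cycle E f -> lin_cycle E g.
Proof.
move=> fg [f1 f2 f3]; split=> [B A BE|B A AB|W A].
- by rewrite -fg f1.
- by rewrite -fg f2.
- apply: etrans (f3 W A); apply: eq_bigr => a _.
  by apply: eq_contract => A'; rewrite fg.
Qed.

Lemma lin_cycle_koszul E f : lin_cycle E f -> lin_cycle E (fun B => koszul (f B)).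
Proof.
move=> [f1 f2 f3]; split=> [B A BE|B A AB|W A].
- by apply: koszul_eq0 => A'; rewrite f1.
- apply: big1 => v _; rewrite /contract; case: ifP => _; rewrite ?mulr0 // f2 ?mulr0 //.
  by apply: contra AB; apply: disjointWl; apply: subsetUr.
- under eq_bigr do rewrite contract_koszul.
  rewrite sumrN /koszul exchange_big big1 ?oppr0 //= => v _.
  by rewrite -mulr_sumr -contract_sum contract_eq0 ?mulr0.
Qed.

Lemma mon_setU1 v B : v \notin B -> mon (v |: B) = x v * mon B.
Proof. by move=> vB; rewrite /mon big_setU1. Qed.

Lemma aug_koszul E f : lin_cycle E f -> aug_map (fun B => koszul (f B)) = 0.
Proof.
move=> [f1 f2 f3]; rewrite /aug_map /koszul.
transitivity (\sum_v \sum_(B : {set V} | v \notin B) f B [set v] * mon (v |: B)).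
  under eq_bigr do rewrite mulr_suml.
  rewrite exchange_big; apply: eq_bigr => v _.
  rewrite (bigID (fun B : {set V} => v \in B)) /= big1 ?add0r => [|B vB]; last first.
     rewrite contract_out ?inE // setU0 f2 ?mulr0 ?mul0r //.
    by rewrite disjoints1 negbK.
  apply: eq_bigr => B vB; rewrite contract_out ?inE // sgn0 mul1r setU0 mon_setU1 //.
  by rewrite mulrAC mulrC.
transitivity (\sum_v \sum_(W : {set V} | v \in W) f (W :\ v) [set v] * mon W).
  apply: eq_bigr => v _; rewrite (reindex_onto (fun W : {set V} => W :\ v) (fun B => v |: B)) => [|B vB]; last by rewrite setU1K.
  apply: eq_big => [W|W]; last by case/andP=> _ /eqP ->.
  rewrite setD11 /=; apply/eqP/idP => [<-|/setD1K //]; exact: setU11.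
rewrite (exchange_big_dep predT) //= big1 // => W _; rewrite -mulr_suml.
have := f3 W set0; under eq_bigr do rewrite contract_out ?inE // sgn0 mul1r setU0.
by move->; rewrite mul0r.
Qed.

Lemma aug_mapD f g : aug_map (fun B A => f B A + g B A) = aug_map f + aug_map g.
Proof. by rewrite -big_split; apply: eq_bigr => B _; rewrite mulrDl. Qed.

Lemma aug_mapN f : aug_map (fun B A => - f B A) = - aug_map f.
Proof. by rewrite -sumrN; apply: eq_bigr => B _; rewrite mulNr. Qed.

Lemma eq_aug_map f g : (forall B, f B set0 = g B set0) -> aug_map f = aug_map g.
Proof. by move=> e; apply: eq_bigr => B _; rewrite e. Qed.

(** Exactness in all homological degrees at once; the condition on [aug_map]
    concerns the part with [A = set0] only. *)
Definition strand_exact E := forall f, lin_cycle E f ->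
  (forall B A, koszul (f B) A = 0) -> aug_map f = 0 ->
  exists2 g, lin_cycle E g & forall B A, f B A = koszul (g B) A.

(** * Strands of stars *)

(** Any [a] in [A :&: Q] would give the same value for the families of
    interest. *)
Definition potential (Q : {set V}) (F : V -> {set V} -> R) A : R :=
  if [pick a in A :&: Q] is Some a then sgn a (A :\ a) * F a (A :\ a) else 0.

(** A Poincare lemma for the contractions: the antisymmetry of
    [contract w (F v)] in [v] and [w] makes the values of [potential] agree. *)
Lemma contract_potential (Q : {set V}) (F : V -> {set V} -> R) v A :
  {in Q, forall v A, v \in A -> F v A = 0} ->
  {in Q &, forall v w, v != w -> forall A, contract w (F v) A + contract v (F w) A = 0} ->
  v \in Q -> contract v (potential Q F) A = F v A.
Proof.
move=> F0 Frel vQ; case: (boolP (v \in A)) => vA.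
  by rewrite contract_in // F0.
rewrite contract_out // /potential; case: pickP => [a|/(_ v)]; last first.
  by rewrite !inE eqxx vQ.
rewrite !inE => /andP[]; have [-> _ _|av /= aA aQ] := eqVneq a v.
  by rewrite setU1K // sgnK.
have [C [aC vC AE]] : exists C, [/\ a \notin C, v \notin C & A = a |: C].
  by exists (A :\ a); rewrite !inE eqxx (negPf vA) andbF setD1K.
have va : v != a by rewrite eq_sym.
have -> : (v |: A) :\ a = v |: C.
  by rewrite AE setUCA setU1K // !inE negb_or eq_sym va.
have := Frel v a vQ aQ va C; rewrite !contract_out // -AE => rel.
have swap := sgn_swap va vC aC; rewrite -AE in swap.
have := sgn_sq a C; have := sgn_sq v C; have := sgn_sq a (v |: C).
move: rel swap; move: (sgn a C) (sgn v C) (sgn a (v |: C)) (sgn v A) => s r q p.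
move: (F v A) (F a (v |: C)) => X Y rel swap qq rr ss.
have pq : p * q = - (r * s).
  have -> : p * q = (p * s) * (s * q) by rewrite -mulrA [s * (_ * _)]mulrA ss mul1r.
  rewrite swap mulNr; congr (- _).
  have -> : q * r * (s * q) = q * q * (r * s) by ring.
  by rewrite qq mul1r.
rewrite mulrA pq mulNr [r * s]mulrC -mulrA -mulrN.
have -> : - (r * Y) = s * X by apply/eqP; rewrite eq_sym -addr_eq0 rel.
by rewrite mulrA ss mul1r.
Qed.

Lemma potential0 (Q : {set V}) (F : V -> {set V} -> R) A :
  (forall a, a \in A -> a \in Q -> F a (A :\ a) = 0) -> potential Q F A = 0.
Proof.
move=> F0; rewrite /potential; case: pickP => // a; rewrite inE => /andP[aA aQ].
by rewrite F0 // mulr0.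
Qed.

(** The ideal of this family is the product of [mon s] and the ideal generated
    by the variables in [S]. *)
Definition star s (S : {set V}) : {set {set V}} := [set v |: s | v in S].

(** For disjoint [S] and [s] the sum has at most one term; it embeds the Koszul
    complex of the variables in [S] into the strand of the star. *)
Definition star_chain s (S : {set V}) z : {set V} -> {set V} -> R :=
  fun B A => \sum_(v in S | v |: s == B) contract v z A.

Lemma setU1_inj s v w : v \notin s -> v |: s = w |: s -> v = w.
Proof.
by move=> vs /setP/(_ v); rewrite !inE eqxx (negPf vs) !orbF => /esym/eqP.
Qed.

Lemma star_chainE s (S : {set V}) z v A : [disjoint S & s] -> v \in S ->
  star_chain s S z (v |: s) A = contract v z A.
Proof.
move=> Ss vS; rewrite /star_chain (big_pred1 v) // => w.
apply/andP/eqP => [[wS /eqP]|->]; last by [].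
by apply: setU1_inj; apply: contraTN wS => ws; rewrite (disjointFl Ss ws).
Qed.

Lemma star_chain_out s (S : {set V}) z B A : B \notin star s S -> star_chain s S z B A = 0.
Proof.
move=> BS; apply: big1 => v /andP[vS /eqP vB]; case/negP: BS.
by apply/imsetP; exists v.
Qed.

Lemma lin_cycle_star_chain s (S : {set V}) z : [disjoint S & s] -> supported S z ->
  lin_cycle (star s S) (star_chain s S z).
Proof.
move=> Ss zS; split=> [B A|B A AB|W A]; first exact: star_chain_out.
- apply: big1 => v /andP[vS /eqP vB]; rewrite /contract; case: ifPn => // vA.
  rewrite zS ?mulr0 //; apply: contra AB => AS.
  rewrite -vB disjoint_sym disjoints_subset subUset sub1set inE vA.
  rewrite -disjoints_subset disjoint_sym; apply: disjointWl Ss.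
  exact: subset_trans (subsetUr _ _) AS.
- have notS a w : a \notin S -> contract a (contract w z) A = 0.
    move=> aS; rewrite /contract; case: ifP => // _; case: ifP => _; rewrite ?mulr0 //.
    rewrite zS ?mulr0 //; apply: contra aS => /subsetP; apply.
    by rewrite !inE eqxx orbT.
  pose c a w := if [&& a \in S, w \in S, a != w & W == a |: (w |: s)]
    then contract a (contract w z) A else 0.
  transitivity (\sum_a \sum_w c a w); last first.
    apply: sum_antisym => [a|a w]; rewrite /c; first by rewrite eqxx /= !andbF.
    rewrite [w |: (a |: s)]setUCA [w == a]eq_sym; do 2 case: (_ \in S) => //=; rewrite ?oppr0 //.
    by case: ifP; rewrite ?oppr0 // contractC.
  rewrite big_mkcond; apply: eq_bigr => a _.
  under [RHS]eq_bigr do rewrite /c.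
  case: (boolP (a \in S)) => aS /=; last first.
    rewrite [RHS]big1 //; case: ifP => // _; rewrite contract_sum big1 // => w _.
    exact: notS.
  have as_ : a \notin s by rewrite (disjointFr Ss aS).
  rewrite -big_mkcond /=; case: ifPn => aW; last first.
    rewrite big1 // => w /and3P[_ _ /eqP WE].
    by rewrite WE setU11 in aW.
  rewrite contract_sum; apply: eq_bigl => w; case: (w \in S) => //=.
  apply/eqP/andP => [e|[aw /eqP ->]].
    have aw : a != w by apply/eqP => aw; have := setD11 a W; rewrite -e aw setU11.
    by rewrite e setD1K.
  by rewrite setU1K // !inE negb_or aw.
Qed.

Lemma star_chain_koszul s (S : {set V}) z B A :
  star_chain s S (koszul z) B A = - koszul (star_chain s S z B) A.
Proof.
rewrite /star_chain koszul_sum -sumrN; apply: eq_bigr => v _.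
by rewrite contract_koszul.
Qed.

Lemma eq_star_chain s (S : {set V}) z z' B A : z =1 z' ->
  star_chain s S z B A = star_chain s S z' B A.
Proof. by move=> e; apply: eq_bigr => v _; apply: eq_contract. Qed.

Lemma star_relation E f s v w A : lin_cycle E f -> v != w -> v \notin s -> w \notin s ->
  (forall a, a \in s -> (v |: (w |: s)) :\ a \notin E) ->
  contract w (f (v |: s)) A + contract v (f (w |: s)) A = 0.
Proof.
move=> [f1 _ f3] vw vs ws sE; have := f3 (v |: (w |: s)) A.
rewrite big_setU1 /= ?inE ?negb_or ?vw //= big_setU1 //= [X in _ + (_ + X)]big1.
  rewrite addr0 setU1K ?inE ?negb_or ?vw // setUCA setU1K ?inE ?negb_or 1?eq_sym ?vw //.
  by rewrite addrC.
by move=> a aS; apply: contract_eq0 => A'; apply: f1; apply: sE.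
Qed.

Section Exactness.

Hypothesis x_regular : forall v (y : R), x v * y = 0 -> y = 0.
Hypothesis kill : forall P : {set V}, exists phi : {rmorphism R -> R},
  [/\ forall v, v \in P -> phi (x v) = 0, forall v, v \notin P -> phi (x v) = x v &
      forall p, exists c : V -> R, p = phi p + \sum_(v in P) x v * c v].

Lemma mon_regular B (y : R) : mon B * y = 0 -> y = 0.
Proof.
rewrite /mon; elim/big_rec: _ y => [y|v p _ IH y]; first by rewrite mul1r.
by rewrite -mulrA => /x_regular/IH.
Qed.

(** The Koszul complex of the variables in [S] is exact in positive degrees.
    Splitting off one variable [s], write [z] as a part [al] without [s] and
    [s] times [be].  Then [be] is a cycle whose constant part is in the ideal
    of the other variables, because [x s] is regular modulo this ideal; so [be]
    is the boundary of some [ga].  Subtracting the boundary of [s] times [ga]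
    from [z], up to sign, leaves a cycle without [s]. *)
Lemma koszul_exact (S : {set V}) z : supported S z -> z set0 = 0 ->
  (forall A, koszul z A = 0) ->
  exists2 y, supported S y & forall A, z A = koszul y A.
Proof.
move: {2}#|S| (erefl #|S|) => n; elim: n S z => [|n IHn] S z cS zS z0 kz.
  exists (fun=> 0) => // A; rewrite koszul_eq0 //.
  have [->//|A0] := eqVneq A set0; apply: zS.
  by rewrite (cards0_eq cS) subset0.
have [s sS] : exists s : V, s \in S by apply/set0Pn; rewrite -cards_eq0 cS.
pose S' := S :\ s; have cS' : #|S'| = n by move: cS; rewrite (cardsD1 s) sS add1n => -[].
have sS' : s \notin S' by rewrite setD11.
have S'S A : s \notin A -> ~~ (A \subset S') -> ~~ (A \subset S).
  by move=> sA; apply: contra => AS; rewrite subsetD1 AS.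
pose al A := if s \in A then 0 else z A.
pose be := contract s z.
have alS : supported S' al.
  by move=> A AS; rewrite /al; case: ifPn => // sA; apply: zS; apply: S'S.
have beS : supported S' be.
  move=> A AS; rewrite /be /contract; case: ifPn => // sA; rewrite zS ?mulr0 //.
  by apply: contra (S'S A sA AS) => /subsetP AS'; apply/subsetP => v vA; rewrite AS' // setU1r.
have kbe A : koszul be A = 0.
  by apply/eqP; rewrite -oppr_eq0 -contract_koszul contract_eq0.
have kal A : koszul al A = - (x s * be A).
  have [sA|sA] := boolP (s \in A).
    rewrite /be contract_in // mulr0 oppr0; apply: big1 => v _.
    rewrite /contract; case: ifP => _; rewrite ?mulr0 // /al !inE sA orbT !mulr0 //.
  have als : al (s |: A) = 0 by rewrite /al setU11.
  have := kz A; rewrite /koszul (bigD1 s) //= addrC => /(canRL (addrK _)).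
  rewrite sub0r -/be => <-; rewrite (bigD1 s) //= contract_out // als !mulr0 add0r.
  apply: eq_bigr => v vs; congr (_ * _); rewrite /contract; case: ifP => // _.
  by rewrite /al !inE (negPf sA) eq_sym (negPf vs).
have [ga gaS [ga0 bega]] : exists2 ga, supported S' ga & ga set0 = 0 /\
    forall A, be A = koszul ga A.
  have [c be0] : exists c, be set0 = \sum_(v in S') x v * c v.
    have [phi [phi0 phi1 phiP]] := kill S'; have [c bec] := phiP (be set0).
    exists c; rewrite {1}bec [X in X + _](_ : _ = 0) ?add0r //; apply: (@x_regular s).
    rewrite -[x s]phi1 // -rmorphM; apply/eqP; rewrite -oppr_eq0 -rmorphN -kal.
    rewrite (koszul0 alS) rmorph_sum big1 // => v vS'.
    by rewrite rmorphM phi0 // mul0r.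
  pose ga0 := linear_form S' c; have ga0S : supported S' ga0 := @supported_linear_form S' c.
  have [||A|ga1 ga1S ga1E] := IHn S' (fun A => be A - koszul ga0 A) cS'.
  - move=> A AS; rewrite beS // (supported_koszul ga0S) // subr0 //.
  - rewrite (koszul0 ga0S) be0; apply/eqP; rewrite subr_eq0; apply/eqP.
    by apply: eq_bigr => v vS; rewrite /ga0 linear_form1.
  - by rewrite koszulD koszulN kbe koszul_sq subr0.
  pose ga A := if A == set0 then 0 else ga0 A + ga1 A.
  exists ga => [A AS|].
    by rewrite /ga; case: ifP => // _; rewrite ga0S // ga1S // addr0.
  split; first by rewrite /ga eqxx.
  move=> A; have -> : be A = koszul (fun A => ga0 A + ga1 A) A.
    by rewrite koszulD -ga1E addrC subrK.
  apply: eq_bigr => v _; congr (_ * _); rewrite /contract; case: ifP => // _.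
  by rewrite /ga; case: eqP => // /setP/(_ v); rewrite !inE eqxx.
have [||A|de deS deE] := IHn S' (fun A => al A + x s * ga A) cS'.
- by move=> A AS; rewrite alS // gaS // mulr0 addr0.
- by rewrite /al inE z0 ga0 mulr0 addr0.
- by rewrite koszulD koszulZ kal bega addNr.
pose et A := if s \in A then - (sgn s (A :\ s) * ga (A :\ s)) else de A.
have etS : supported S et.
  move=> A AS; rewrite /et; case: ifPn => sA.
    rewrite gaS ?mulr0 ?oppr0 //; apply: contra AS => AS'.
    by rewrite -(setD1K sA) subUset sub1set sS (subset_trans AS') // subsetDl.
  by apply: deS; apply: contra AS => AS; apply: subset_trans AS (subsetDl _ _).
have cet A : contract s et A = - ga A.
  have [sA|sA] := boolP (s \in A).
    rewrite contract_in // gaS ?oppr0 //; apply: contra sS' => /subsetP; exact.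
  by rewrite contract_out // /et setU11 setU1K // mulrN sgnK.
exists et => // A; have [sA|sA] := boolP (s \in A).
  apply: (contract_cancel sA); rewrite contract_koszul.
  by rewrite (eq_koszul cet) koszulN opprK -bega.
have -> : z A = koszul de A - x s * ga A by rewrite -deE addrK /al (negPf sA).
have -> : koszul de A = \sum_(v | v != s) x v * contract v de A.
  rewrite /koszul (bigD1 s) //= contract_out // deS ?mulr0 ?add0r //.
  by apply: contra sS' => /subsetP; apply; rewrite setU11.
rewrite [RHS](bigD1 s) //= cet mulrN [RHS]addrC; congr (_ - _).
apply: eq_bigr => v vs; congr (_ * _); rewrite /contract; case: ifP => // _.
by rewrite /et !inE (negPf sA) eq_sym (negPf vs).
Qed.

Lemma setD1_notin_star s (S : {set V}) W b : b \in s -> W :\ b \notin star s S.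
Proof.
move=> bs; apply/imsetP => -[v _ e].
by have := setD11 b W; rewrite e !inE bs orbT.
Qed.

(** The strand of a star is the Koszul complex of [S] truncated in degree 0. *)
Lemma star_cycle_potential s (S : {set V}) f : [disjoint S & s] -> lin_cycle (star s S) f ->
  exists z, [/\ supported S z, z set0 = 0 & forall B A, f B A = star_chain s S z B A].
Proof.
move=> Ss fN; have [f1 f2 _] := fN.
have notin v : v \in S -> v \notin s by move=> vS; rewrite (disjointFr Ss vS).
have f0 v w A : v \in S -> w \notin S -> w \in A -> f (v |: s) A = 0.
  move=> vS wS wA; have [ws|ws] := boolP (w \in s).
    apply: f2; apply: contraTN ws => dAB.
    by move: (disjointFr dAB wA); rewrite !inE => /negbT/norP[_ ->].
  have vw : v != w by apply: contraNneq wS => <-.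
  have := star_relation (A :\ w) fN vw (notin v vS) ws (fun b => @setD1_notin_star s S _ b).
  rewrite [X in _ + X]contract_eq0 ?addr0 => [|A']; last first.
    apply: f1; apply: contra wS => /imsetP[v' v'S e].
    by rewrite (setU1_inj ws e).
  rewrite contract_out ?setD11 // setD1K // => e.
  by apply: (@sgn_inj w (A :\ w)); rewrite e mulr0.
exists (potential S (fun v => f (v |: s))); split.
- move=> A AS; apply: potential0 => a aA aS.
  have /subsetPn[w wA wS] := AS; apply: (f0 a w) => //.
  by rewrite !inE wA andbT; apply: contraNneq wS => ->.
- by apply: potential0 => a; rewrite inE.
- move=> B A; have [/imsetP[v vS ->]|BS] := boolP (B \in star s S); last first.
    by rewrite f1 // star_chain_out.
  rewrite star_chainE // contract_potential //.
  - move=> w wS C wC; apply: f2; apply: contraTN wC => dCB.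
    by rewrite (disjointFl dCB) // setU11.
  - move=> u w uS wS uw C; apply: star_relation fN uw _ _ _; rewrite ?notin //.
    by move=> b; apply: setD1_notin_star.
Qed.

Lemma aug_star_chain s (S : {set V}) z : [disjoint S & s] -> supported S z ->
  aug_map (star_chain s S z) = mon s * koszul z set0.
Proof.
move=> Ss zS; rewrite (koszul0 zS) /aug_map /star_chain.
under eq_bigr do rewrite mulr_suml.
rewrite (exchange_big_dep (mem S)) /= => [|B v _ /andP[] //].
rewrite mulr_sumr; apply: eq_bigr => v vS.
rewrite (big_pred1 (v |: s)) => [|B]; last by rewrite vS /= eq_sym.
rewrite mon_setU1 ?(disjointFr Ss vS) // contract_out ?inE // sgn0 mul1r setU0.
by rewrite mulrC -mulrA mulrCA.
Qed.

(** Contracting [koszul z] by [v] in [S] gives 0, so only its constant part can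
    be nonzero, and this part is what the augmentation sees. *)
Lemma star_exact s (S : {set V}) : [disjoint S & s] -> strand_exact (star s S).
Proof.
move=> Ss f fN df af; have [z [zS z0 fE]] := star_cycle_potential Ss fN.
have [|y yS yE] := koszul_exact zS z0.
  move=> A; have [->|A0] := eqVneq A set0.
    apply: (@mon_regular s); rewrite -(aug_star_chain Ss zS) -af.
    by apply: eq_aug_map => B; rewrite fE.
  have [AS|AS] := boolP (A \subset S); last exact: supported_koszul zS A AS.
  case/set0Pn: A0 => v vA; have vS := subsetP AS v vA.
  apply: (@contract_cancel v _ (fun=> 0)) => //.
  rewrite contract_koszul [RHS]contract_eq0 // -oppr0 -(df (v |: s) (A :\ v)).
  by congr (- _); apply: eq_koszul => C; rewrite fE star_chainE.
exists (fun B A => - star_chain s S y B A).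
  exact: lin_cycleN (lin_cycle_star_chain Ss yS).
by move=> B A; rewrite koszulN -star_chain_koszul fE; apply: eq_star_chain.
Qed.

(** * The strands of a clutter and of its deletion *)

(** [EI] stands for the complement of a clutter, [EJ] for that of its deletion at
    [s], and [Q] for the [v] outside [s] such that [v |: s] is in the clutter. *)
Section Step.
Variables (s Q : {set V}) (EI EJ : {set {set V}}).
Hypotheses (Qs : [disjoint Q & s]) (IJ : EI \subset EJ).
Hypothesis starJ : star s (~: s) \subset EJ.
Hypothesis starI : star s (~: (s :|: Q)) \subset EI.
Hypothesis Qout : forall v, v \in Q -> v |: s \notin EI.
Hypothesis JI : forall B, B \in EJ -> B \notin EI -> B \in star s Q.
Hypothesis face : forall v w b, v \in Q -> w \in Q -> v != w -> b \in s ->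
  (v |: (w |: s)) :\ b \notin EJ.
Hypothesis far : forall B, B \in EI -> ~~ (B \subset s :|: Q).

Let P := ~: (s :|: Q).

Let Cs : [disjoint ~: s & s].
Proof. by rewrite disjoint_sym disjoints_subset setCK. Qed.

Let Ps : [disjoint P & s].
Proof. by rewrite disjoint_sym disjoints_subset setCK subsetUl. Qed.

Let QC v : v \in Q -> v \in ~: s.
Proof. by move=> vQ; rewrite inE (disjointFr Qs vQ). Qed.

(** The values of [f] on the members [v |: s] with [v] in [Q] have a potential,
    by [star_relation] and [face].  Its star chain has the same values there,
    and lies in the strand of the larger star because [v |: s] is in [EJ] for
    every [v]. *)
Lemma lin_cycle_split f : lin_cycle EJ f ->
  exists g h, [/\ lin_cycle EI g, lin_cycle (star s (~: s)) h &
                  forall B A, f B A = g B A + h B A].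
Proof.
move=> fN; have [_ f2 _] := fN.
pose z := potential Q (fun v => f (v |: s)).
have fin v A : v \in Q -> v \in A -> f (v |: s) A = 0.
  move=> _ vA; apply: f2; apply: contraTN vA => dAB.
  by rewrite (disjointFl dAB) // setU11.
have cz v A : v \in Q -> contract v z A = f (v |: s) A.
  move=> vQ; apply: contract_potential => //; first by move=> w wQ C; apply: fin.
  move=> u w uQ wQ uw C; apply: (star_relation _ fN uw).
  - by rewrite (disjointFr Qs uQ).
  - by rewrite (disjointFr Qs wQ).
  - by move=> b; apply: face.
have zS : supported (~: s) z.
  move=> A AS; apply: potential0 => a aA aQ.
  have /subsetPn[b bA] := AS; rewrite inE negbK => bs.
  apply: f2; apply/negP => dAB.
  have : b \in A :\ a.
    by rewrite !inE bA andbT; apply: contraTneq bs => ->; rewrite (disjointFr Qs aQ).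
  by move/(disjointFr dAB); rewrite !inE bs orbT.
have hN := lin_cycle_star_chain Cs zS.
exists (fun B A => f B A - star_chain s (~: s) z B A), (star_chain s (~: s) z).
split=> // [|B A]; last by rewrite subrK.
have [g1 g2 g3] := lin_cycleD fN (lin_cycleN (lin_cycleS starJ hN)).
split=> // B A BI; have [BJ|] := boolP (B \in EJ); last exact: g1.
have /imsetP[v vQ ->] := JI BJ BI.
by rewrite star_chainE ?QC // cz // subrr.
Qed.

Lemma lin_cycle_meet f : lin_cycle EI f -> lin_cycle (star s (~: s)) f ->
  lin_cycle (star s P) f.
Proof.
move=> [f1 f2 f3] [h1 _ _]; split=> // B A BP.
have [/imsetP[v vs BE]|] := boolP (B \in star s (~: s)); last exact: h1.
have [vQ|vQ] := boolP (v \in Q); first by rewrite BE f1 // Qout.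
case/negP: BP; rewrite BE; apply/imsetP; exists v => //.
by move: vs; rewrite !inE negb_or => ->.
Qed.

(** Write a cycle of the strand of [EJ] as [g + h].  The boundaries of [g] and
    [h] are opposite, hence in the strand of the smaller star, and exactness
    there corrects [g] and [h] to cycles [g'] and [h']. *)
Lemma strand_exact_up : strand_exact EI -> strand_exact EJ.
Proof.
move=> exI f /lin_cycle_split[g [h [gN hN fE]]] df af.
have gJ := lin_cycle_koszul gN; have hJ := lin_cycle_koszul hN.
have gh B A : koszul (g B) A = - koszul (h B) A.
  by apply/eqP; rewrite -addr_eq0 -koszulD -(df B A); apply/eqP/eq_koszul => A'; rewrite fE.
have meet := lin_cycle_meet gJ (eq_lin_cycle (fun B A => esym (gh B A)) (lin_cycleN hJ)).
have [B A||k kN kE] := star_exact Ps meet; [exact: koszul_sq|exact: aug_koszul gN|].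
have kI := lin_cycleS starI kN.
have PC : P \subset ~: s by apply/subsetP => v; rewrite !inE negb_or => /andP[].
have kL : lin_cycle (star s (~: s)) k by apply: lin_cycleS kN; apply: imsetS.
pose g' B A := g B A - k B A; pose h' B A := h B A + k B A.
have g'N : lin_cycle EI g' := lin_cycleD gN (lin_cycleN kI).
have h'N : lin_cycle (star s (~: s)) h' := lin_cycleD hN kL.
have dg' B A : koszul (g' B) A = 0 by rewrite koszulD koszulN kE subrr.
have dh' B A : koszul (h' B) A = 0 by rewrite koszulD -kE gh addrN.
have fE' B A : f B A = g' B A + h' B A by rewrite fE addrACA addNr addr0.
have [z [zS _ hE]] := star_cycle_potential Cs h'N.
have augh : aug_map h' = mon s * koszul z set0.
  by rewrite -(aug_star_chain Cs zS); apply: eq_aug_map => B; apply: hE.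
(* The augmentations of [g'] and [h'] are opposite, so they are in the ideal
   of [EI] and divisible by [mon s].  Killing the variables of [P] kills the
   first ideal by [far] and leaves [mon s] alone, so the quotient is in the
   ideal of [P]: the augmentation comes from a chain [k'] of degree 0. *)
have augg : aug_map g' = - aug_map h'.
  by apply/eqP; rewrite -addr_eq0 -aug_mapD -af; apply/eqP/eq_aug_map => B; rewrite fE'.
have [phi [phi0 phi1 phiP]] := kill P.
have phi_q : phi (koszul z set0) = 0.
  apply: (@mon_regular s).
  have <- : phi (mon s) = mon s.
    rewrite rmorph_prod; apply: eq_bigr => v vs; rewrite phi1 //.
    by rewrite !inE vs.
  rewrite -rmorphM -augh; apply/eqP; rewrite -oppr_eq0 -rmorphN -augg rmorph_sum.
  apply/eqP/big1 => B _; have [BI|BI] := boolP (B \in EI); last first.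
    by have [g1 _ _] := g'N; rewrite g1 // mul0r rmorph0.
  have /subsetPn[v vB vP] := far BI.
  rewrite rmorphM [phi (mon B)]rmorph_prod (bigD1 v) //= phi0 ?mul0r ?mulr0 //.
  by rewrite inE.
have [c qE] := phiP (koszul z set0); rewrite phi_q add0r in qE.
pose k' := star_chain s P (linear_form P c).
have k'N := lin_cycle_star_chain Ps (@supported_linear_form P c).
have dk' B A : koszul (k' B) A = 0.
  apply: big1 => v _; rewrite contract_sum big1 ?mulr0 // => w _.
  exact: contract2_linear_form.
have ak' : aug_map k' = aug_map h'.
  rewrite /k' (aug_star_chain Ps (@supported_linear_form P c)) augh qE; congr (_ * _).
  rewrite (koszul0 (@supported_linear_form P c)).
  by apply: eq_bigr => v vP; rewrite linear_form1.
have [|B A||u uN uE] := exI (fun B A => g' B A + k' B A).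
- exact: lin_cycleD g'N (lin_cycleS starI k'N).
- by rewrite koszulD dg' dk' addr0.
- by rewrite aug_mapD augg ak' addNr.
have [|B A||w wN wE] := star_exact Cs (f := fun B A => h' B A - k' B A).
- by apply: lin_cycleD h'N (lin_cycleN (lin_cycleS _ k'N)); apply: imsetS.
- by rewrite koszulD koszulN dh' dk' subrr.
- by rewrite aug_mapD aug_mapN ak' addrN.
exists (fun B A => u B A + w B A).
  exact: lin_cycleD (lin_cycleS IJ uN) (lin_cycleS starJ wN).
by move=> B A; rewrite koszulD -uE -wE addrACA addrN addr0 fE'.
Qed.

(** A cycle of the strand of [EI] is the boundary of some [g + h] in the
    strand of [EJ]; the boundary of [h] lies in the strand of the smaller star
    and is therefore a boundary there. *)
Lemma strand_exact_down : strand_exact EJ -> strand_exact EI.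
Proof.
move=> exJ f fN df af; have [e eN kE] := exJ f (lin_cycleS IJ fN) df af.
have [g [h [gN hN ghE]]] := lin_cycle_split eN.
have hE B A : koszul (h B) A = f B A - koszul (g B) A.
  by rewrite kE (eq_koszul (ghE B)) koszulD addrC addKr.
have hI : lin_cycle EI (fun B => koszul (h B)).
  apply: eq_lin_cycle (lin_cycleD fN (lin_cycleN (lin_cycle_koszul gN))) => B A.
  by rewrite hE.
have meet := lin_cycle_meet hI (lin_cycle_koszul hN).
have [B A||k kN kE'] := star_exact Ps meet; [exact: koszul_sq|exact: aug_koszul hN|].
exists (fun B A => g B A + k B A).
  exact: lin_cycleD gN (lin_cycleS starI kN).
by move=> B A; rewrite koszulD -kE' hE addrC subrK.
Qed.

End Step.

End Exactness.

End Contraction.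

(** * Chordal clutters have exact linear strands *)

Section PolynomialStrand.
Variables (K : fieldType) (V : finType).
Local Notation R := {mpoly K[#|V|]}.

Definition vertex_var (v : V) : R := 'X_(enum_rank v).
Local Notation x := vertex_var.

Lemma vertex_var_regular v (y : R) : x v * y = 0 -> y = 0.
Proof.
move/eqP; rewrite mulf_eq0 => /orP[/eqP x0|/eqP //].
move: x0 => /(congr1 (mcoeff U_(enum_rank v)%MM)); rewrite mcoeffX eqxx mcoeff0.
by move=> /eqP; rewrite oner_eq0.
Qed.

(** The substitution of 0 for the variables in [P]. *)
Lemma vertex_var_kill (P : {set V}) : exists phi : {rmorphism R -> R},
  [/\ forall v, v \in P -> phi (x v) = 0, forall v, v \notin P -> phi (x v) = x v &
      forall p, exists c : V -> R, p = phi p + \sum_(v in P) x v * c v].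
Proof.
pose lq : #|V|.-tuple R := [tuple if enum_val i \in P then 0 else 'X_i | i < #|V|].
pose phi : {rmorphism R -> R} := comp_mpoly lq.
have phiX i : phi 'X_i = if enum_val i \in P then 0 else 'X_i.
  by rewrite /phi /= comp_mpolyXU -tnth_nth tnth_mktuple.
exists phi; split => [v vP|v vP|p].
- by rewrite phiX enum_rankK vP.
- by rewrite phiX enum_rankK (negPf vP).
pose D q := exists c : V -> R, q = phi q + \sum_(v in P) x v * c v.
have DC c : D c%:MP.
  exists (fun=> 0); rewrite /phi /= comp_mpolyC big1 ?addr0 // => v _.
  by rewrite mulr0.
have DD p1 p2 : D p1 -> D p2 -> D (p1 + p2).
  move=> [c1 e1] [c2 e2]; exists (fun v => c1 v + c2 v).
  rewrite {1}e1 {1}e2 rmorphD addrACA -big_split; congr (_ + _).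
  by apply: eq_bigr => v _; rewrite mulrDr.
have DM p1 p2 : D p1 -> D p2 -> D (p1 * p2).
  move=> [c1 e1] [c2 e2]; exists (fun v => phi p1 * c2 v + c1 v * p2).
  rewrite {1}e1 mulrDl {1}e2 mulrDr rmorphM -addrA; congr (_ + _).
  rewrite [X in X + _]mulr_sumr [X in _ + X]mulr_suml -big_split; apply: eq_bigr => v _ /=.
  by rewrite mulrDr; congr (_ + _); [rewrite mulrCA | rewrite mulrA].
have DX i : D 'X_i.
  rewrite /D phiX; case: ifP => iP.
    exists (fun v => if v == enum_val i then 1 else 0).
    rewrite add0r (bigD1 (enum_val i)) //= eqxx mulr1 /x enum_valK big1 ?addr0 //.
    by move=> v /andP[_ /negPf ->]; rewrite mulr0.
  by exists (fun=> 0); rewrite big1 ?addr0 // => v _; rewrite mulr0.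
rewrite -/(D p) [p]mpolyE; elim/big_rec: _ => [|m q _ Dq]; first exact: (DC 0).
apply: (DD) Dq; rewrite -mul_mpolyC; apply: (DM) => //; rewrite mpolyXE_id.
elim/big_rec: _ => [|i q' _ Dq']; first exact: (DC 1).
apply: (DM) Dq'; elim: (m i) => [|k IHk]; first exact: (DC 1).
by rewrite exprS; apply: (DM).
Qed.

Section Clutters.
Variable d : nat.
Implicit Types C : {set {set V}}.
Local Notation cocl := (compl_clutter d).

Lemma compl_clutterE C B : (B \in cocl C) = (#|B| == d) && (B \notin C).
Proof. by rewrite inE. Qed.

Lemma deletion_exact C s : uniform d C -> s \in Sim d C ->
  strand_exact x (cocl C) <-> strand_exact x (cocl (deletion C s)).
Proof.
move=> uC; rewrite inE => /andP[/andP[/eqP sd _] /cliqueP sim].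
pose Q := [set v | v \notin s & v |: s \in C].
have nbE : closed_nbhd C s = s :|: Q.
  by apply/setP => v; rewrite !inE; case: (v \in s).
rewrite nbE in sim.
have vs_card v : v \notin s -> #|v |: s| = d by move=> vs; rewrite cardsU1 vs.
have del B : (B \in deletion C s) = (B \in C) && ~~ (s \subset B) by rewrite inE.
have Qs : [disjoint Q & s].
  by rewrite disjoints_subset; apply/subsetP => v; rewrite !inE => /andP[].
have IJ : cocl C \subset cocl (deletion C s).
  apply/subsetP => B; rewrite !compl_clutterE del => /andP[-> /=].
  by case: (B \in C).
have starJ : star s (~: s) \subset cocl (deletion C s).
  apply/subsetP => _ /imsetP[v + ->]; rewrite inE => vs.
  by rewrite compl_clutterE vs_card // eqxx del subsetUr andbF.
have starI : star s (~: (s :|: Q)) \subset cocl C.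
  apply/subsetP => _ /imsetP[v + ->]; rewrite !inE negb_or => /andP[vs].
  by rewrite vs_card // eqxx vs.
have Qout v : v \in Q -> v |: s \notin cocl C.
  by rewrite compl_clutterE inE => /andP[_ ->]; rewrite andbF.
have JI B : B \in cocl (deletion C s) -> B \notin cocl C -> B \in star s Q.
  rewrite !compl_clutterE del => /andP[/eqP Bd]; rewrite Bd eqxx /= negb_and !negbK.
  move=> /orP[/negPf -> // | sB] BC.
  have /cards1P[v Bv] : #|B :\: s| == 1%N.
    by rewrite cardsD (setIidPr sB) Bd -sd subSnn.
  have BE : B = v |: s.
    by rewrite -Bv setUC; apply/setP => w; rewrite !inE; case: (boolP (w \in s)) => [/(subsetP sB)|].
  have vs : v \notin s by have := set11 v; rewrite -Bv inE => /andP[].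
  by apply/imsetP; exists v => //; rewrite inE vs -BE.
have face v w b : v \in Q -> w \in Q -> v != w -> b \in s ->
    (v |: (w |: s)) :\ b \notin cocl (deletion C s).
  move=> vQ wQ vw bs; rewrite compl_clutterE negb_and negbK del.
  have vs : v \notin s by rewrite (disjointFr Qs vQ).
  have ws : w \notin s by rewrite (disjointFr Qs wQ).
  apply/orP; right; apply/andP; split; last first.
    by apply/negP => /subsetP/(_ b bs); rewrite setD11.
  apply: sim.
    apply: subset_trans (subsetDl _ _) _; rewrite !subUset !sub1set !in_setU vQ wQ !orbT.
    exact: subsetUl.
  have bW : b \in v |: (w |: s) by rewrite !inE bs !orbT.
  have := cardsD1 b (v |: (w |: s)); rewrite bW add1n.
  by rewrite cardsU1 !inE negb_or vw vs cardsU1 ws !add1n sd => -[].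
have far B : B \in cocl C -> ~~ (B \subset s :|: Q).
  rewrite compl_clutterE => /andP[/eqP Bd]; apply: contra => BW.
  exact: sim.
split.
  exact: (strand_exact_up vertex_var_regular vertex_var_kill Qs IJ starJ starI Qout JI face far).
exact: (strand_exact_down vertex_var_regular vertex_var_kill Qs IJ starJ starI Qout JI face).
Qed.

Lemma chordal_exact_iff C : uniform d C -> chordal_clutter d C ->
  strand_exact x (cocl C) <-> strand_exact x (cocl set0).
Proof.
move=> uC chC; elim: chC uC => [//|E s sE _ IH uE].
by rewrite (deletion_exact uE sE); apply: IH; apply: uniform_deletion.
Qed.

(** For the complete clutter the ideal of the complement is 0.  As this clutter
    is chordal, exactness passes from it to the empty clutter, and then to
    [C]. *)
Lemma chordal_exact C : (0 < d)%N -> uniform d C -> chordal_clutter d C ->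
  strand_exact x (cocl C).
Proof.
move=> d0 uC chC; apply/(chordal_exact_iff uC chC).
have uT : uniform d [set S : {set V} | #|S| == d] by move=> S; rewrite inE => /eqP.
apply/(chordal_exact_iff uT (complete_chordal V d0)) => f [f0 _ _] _ _.
have fz B A : f B A = 0 by rewrite f0 // compl_clutterE inE andbN.
exists f; last by move=> B A; rewrite fz koszul_eq0.
split => [B A _|B A _|W A]; rewrite ?fz // big1 // => a _.
by rewrite contract_eq0.
Qed.

End Clutters.

End PolynomialStrand.

(** * The resolution given by an exact strand *)

Section FromStrand.
Variables (K : fieldType) (n N M d : nat).
Local Notation R := {mpoly K[n]}.
Variables (C : nat -> 'M[K]_(N, M)) (D : 'M[R]_N) (al : 'cV[R]_N) (I : R -> Prop).

Local Notation mapC := (map_mx (@mpolyC n K)).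

Definition cycle_vector i (u : 'rV[R]_N) := u *m mapC (C i) = 0.
Local Notation cyc := cycle_vector.

Hypothesis D_homog : forall p q, D p q \is 1.-homog.
Hypothesis al_homog : forall p, al p 0 \is d.-homog.
Hypothesis D_cycle : forall i u, cyc i.+1 u -> cyc i (u *m D).
Hypothesis al_image : forall f, I f <-> exists2 u, cyc 0 u & f%:M = u *m al.
Hypothesis exact0 : forall u, cyc 0 u ->
  (u *m al = 0 <-> exists2 w, cyc 1 w & u = w *m D).
Hypothesis exactS : forall i u, cyc i.+1 u ->
  (u *m D = 0 <-> exists2 w, cyc i.+2 w & u = w *m D).

Let B i := row_base (kermx (C i)).
Let BR i := mapC (B i).
Let BI i := mapC (pinvmx (B i)).

Lemma map_mcoeff_mul p q (m : 'X_{1..n}) (u : 'M[R]_(p, N)) (A : 'M[K]_(N, q)) :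
  map_mx (mcoeff m) (u *m mapC A) = map_mx (mcoeff m) u *m A.
Proof.
apply/matrixP => i j; rewrite !mxE raddf_sum; apply: eq_bigr => k _.
by rewrite !mxE /= [_ * _%:MP]mulrC mul_mpolyC mcoeffZ [RHS]mulrC.
Qed.

Let BI_BR i p (u : 'M[R]_(p, N)) : u *m mapC (C i) = 0 -> u *m BI i *m BR i = u.
Proof.
move=> cu; apply/matrixP => k l; apply/mpolyP => m.
rewrite -mulmxA -map_mxM.
have cm : map_mx (mcoeff m) u *m C i = 0.
  by rewrite -map_mcoeff_mul cu; apply/matrixP => a b; rewrite !mxE mcoeff0.
have um : (map_mx (mcoeff m) u <= B i)%MS by rewrite eq_row_base; apply/sub_kermxP.
have : map_mx (mcoeff m) (u *m mapC (pinvmx (B i) *m B i)) = map_mx (mcoeff m) u.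
  by rewrite map_mcoeff_mul mulmxA mulmxKpV.
by move/matrixP/(_ k l); rewrite [LHS]mxE [RHS]mxE.
Qed.

Let BR_cyc i p (w : 'M[R]_(p, _)) : w *m BR i *m mapC (C i) = 0.
Proof.
rewrite -mulmxA -map_mxM (_ : B i *m C i = 0) ?map_mx0 ?mulmx0 //.
by apply/sub_kermxP; rewrite eq_row_base.
Qed.

Let BR_BI i : BR i *m BI i = 1%:M.
Proof. by rewrite -map_mxM mulmxVp ?row_base_free // map_mx1. Qed.

Let BR_inj i p (v w : 'M[R]_(p, _)) : v *m BR i = w *m BR i -> v = w.
Proof.
move=> /(congr1 (fun A => A *m BI i)).
by rewrite -!mulmxA BR_BI !mulmx1.
Qed.

(** The solutions over [K] of the constraints [C i] have the basis
    [row_base (kermx (C i))], which is also a basis of the solutions over the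
    polynomial ring, because the constraints are constant; [pinvmx] computes
    coordinates in it. *)
Definition strand_complex : free_complex K n := @FreeComplex K n
  (fun i => \rank (kermx (C i))) (fun i _ => (i + d)%N) (BR 0 *m al)
  (fun i => BR i.+1 *m D *m BI i).

Let diffB i p (w : 'M[R]_(p, _)) : w *m (BR i.+1 *m D *m BI i) *m BR i = w *m BR i.+1 *m D.
Proof.
rewrite !mulmxA; apply: BI_BR; apply/row_matrixP => k.
rewrite row_mul row_mul row0; apply: D_cycle.
by rewrite /cyc row_mul; apply: BR_cyc.
Qed.

Let homog_mulC p q r e (A : 'M[R]_(p, q)) (A' : 'M[K]_(q, r)) k l :
  (forall a b, A a b \is e.-homog) -> (A *m mapC A') k l \is e.-homog.
Proof.
move=> hA; rewrite mxE; apply: rpred_sum => j _.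
by rewrite mxE mulrC mul_mpolyC; apply: dhomogZ; apply: hA.
Qed.

Let homog_Cmul p q r e (A : 'M[R]_(q, r)) (A' : 'M[K]_(p, q)) k l :
  (forall a b, A a b \is e.-homog) -> (mapC A' *m A) k l \is e.-homog.
Proof.
move=> hA; rewrite mxE; apply: rpred_sum => j _.
by rewrite mxE mul_mpolyC; apply: dhomogZ; apply: hA.
Qed.

Lemma strand_complex_resolution : minimal_graded_resolution strand_complex I.
Proof.
have dh i k l : diff strand_complex i k l \is 1.-homog.
  by apply: homog_mulC => a b; apply: homog_Cmul.
split => /=.
- move=> k; apply: homog_Cmul => a b; rewrite ord1; exact: al_homog.
- move=> i k l; rewrite leq_add2r leqnSn subnDr subSnn; exact: dh.
- move=> f; rewrite al_image; split => [[u cu fE]|[v fE]].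
    by exists (u *m BI 0); rewrite mulmxA BI_BR.
  by exists (v *m BR 0); [exact: BR_cyc | rewrite fE mulmxA].
- move=> v; rewrite mulmxA; apply: iff_trans (exact0 (BR_cyc v)) _; split.
    case=> w cw vE; exists (w *m BI 1); apply: BR_inj.
    by rewrite diffB BI_BR.
  case=> w ->; exists (w *m BR 1); first exact: BR_cyc.
  by rewrite diffB.
- move=> i v; split => [v0|[w ->]].
    have /exactS : cyc i.+1 (v *m BR i.+1) by exact: BR_cyc.
    rewrite -diffB v0 mul0mx => -[/(_ erefl)[w cw vE] _].
    exists (w *m BI i.+2); apply: BR_inj.
    by rewrite diffB BI_BR.
  apply: BR_inj; rewrite diffB diffB mul0mx.
  have /exactS : cyc i.+1 (w *m BR i.+2 *m D) by apply: D_cycle; apply: BR_cyc.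
  by case=> _; apply; exists (w *m BR i.+2) => //; apply: BR_cyc.
- move=> i k l; apply: (dhomog_nemf_coeff (dh i k l)).
  by rewrite mf0.
Qed.

End FromStrand.

(** * Matrices of the linear strand *)

Section StrandMatrices.
Variables (K : fieldType) (V : finType) (d : nat) (E : {set {set V}}).
Local Notation R := {mpoly K[#|V|]}.
Local Notation x := (@vertex_var K V).
Local Notation J := ({set V} * {set V})%type.
Local Notation N := #|{: J}|.
Local Notation mapC := (map_mx (@mpolyC #|V| K)).
Implicit Types (A B W : {set V}).

Hypothesis Ed : uniform d E.
Hypothesis exE : strand_exact x E.

Definition entries (u : 'rV[R]_N) B A : R := u 0 (enum_rank (B, A)).

Definition entry_vector (f : {set V} -> {set V} -> R) : 'rV[R]_N :=
  \row_p f (enum_val p).1 (enum_val p).2.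

Lemma entry_vectorK f B A : entries (entry_vector f) B A = f B A.
Proof. by rewrite /entries mxE enum_rankK. Qed.

Lemma entriesP u w : (forall B A, entries u B A = entries w B A) -> u = w.
Proof.
move=> uw; apply/rowP => p; have := uw (enum_val p).1 (enum_val p).2.
by rewrite /entries -surjective_pairing enum_valK.
Qed.

(** Homological degree [i] is the part with [#|A| = i]. *)
Definition forbidden i (BA : J) : bool :=
  [|| BA.1 \notin E, ~~ [disjoint BA.2 & BA.1] | #|BA.2| != i].

Definition support_mx i : 'M[K]_N := diag_mx (\row_q (forbidden i (enum_val q))%:R).

Definition cocycle_mx : 'M[K]_N := \matrix_(p, q)
  let: (B, A) := (enum_val p : J) in let: (W, A') := (enum_val q : J) in
  \sum_(a in W | [&& a \notin A', B == W :\ a & A == a |: A']) sgn K a A'.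

Definition constraint_mx i : 'M[K]_(N, N + N) := row_mx (support_mx i) cocycle_mx.

Definition koszul_mx : 'M[R]_N := \matrix_(p, q)
  let: (B, A) := (enum_val p : J) in let: (B', A') := (enum_val q : J) in
  \sum_(v | [&& v \notin A', B == B' & A == v |: A']) x v * sgn R v A'.

Definition augmentation_mx : 'cV[R]_N := \col_p
  let: (B, A) := (enum_val p : J) in if (B \in E) && (A == set0) then mon x B else 0.

Lemma sum_entries (u : 'rV[R]_N) (F : J -> R) :
  \sum_p u 0 p * F (enum_val p) = \sum_B \sum_A entries u B A * F (B, A).
Proof.
rewrite pair_big /= (reindex enum_rank) /=; last first.
  by exists enum_val => p _; rewrite ?enum_rankK ?enum_valK.
by apply: eq_bigr => -[B A] _; rewrite enum_rankK.
Qed.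

Lemma entries_koszul u B A : entries (u *m koszul_mx) B A = koszul x (entries u B) A.
Proof.
pose F (BA : J) := \sum_(v | [&& v \notin A, BA.1 == B & BA.2 == v |: A]) x v * sgn R v A.
rewrite {1}/entries mxE; transitivity (\sum_p u 0 p * F (enum_val p)).
  apply: eq_bigr => p _; rewrite mxE enum_rankK /=.
  by rewrite /F; case: (enum_val p) => B1 A1.
rewrite sum_entries /F /= (bigD1 B) //= [X in _ + X]big1 ?addr0 => [|B' B'B]; last first.
  apply: big1 => A' _; rewrite big_pred0 ?mulr0 // => v.
  by rewrite (negPf B'B) andbF.
under eq_bigr do rewrite mulr_sumr.
rewrite (exchange_big_dep (fun v => v \notin A)) /= => [|A' v _ /andP[] //].
rewrite /koszul [RHS](bigID (fun v => v \notin A)) /= [X in _ + X]big1 ?addr0; last first.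
  by move=> v; rewrite negbK => vA; rewrite contract_in ?mulr0.
apply: eq_bigr => v vA; rewrite (big_pred1 (v |: A)) => [|A']; last by rewrite vA eqxx.
by rewrite contract_out // mulrCA [entries _ _ _ * _]mulrC.
Qed.

Lemma mpolyC_sgn a A : (sgn K a A)%:MP = sgn R a A.
Proof. by rewrite /sgn rmorph_sign. Qed.

Lemma entries_cocycle u W A' : (u *m mapC cocycle_mx) 0 (enum_rank (W, A')) =
  \sum_(a in W) contract a (entries u (W :\ a)) A'.
Proof.
pose F (BA : J) :=
  \sum_(a in W | [&& a \notin A', BA.1 == W :\ a & BA.2 == a |: A']) sgn R a A'.
rewrite mxE; transitivity (\sum_p u 0 p * F (enum_val p)).
  apply: eq_bigr => p _; rewrite !mxE enum_rankK /=; congr (_ * _).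
  rewrite /F; case: (enum_val p) => B1 A1 /=; rewrite raddf_sum; apply: eq_bigr => a _ /=.
  exact: mpolyC_sgn.
rewrite sum_entries pair_big /F /=; under eq_bigr do rewrite mulr_sumr.
rewrite (exchange_big_dep (fun a => (a \in W) && (a \notin A'))) /=; last first.
  by move=> BA a _ /and4P[-> ->].
rewrite [RHS](bigID (fun a => a \notin A')) /= [X in _ = _ + X]big1 ?addr0; last first.
  by move=> a /andP[_]; rewrite negbK => aA; rewrite contract_in.
apply: eq_bigr => a /andP[aW aA]; rewrite (big_pred1 (W :\ a, a |: A')) => [|[B A]].
  by rewrite contract_out // mulrC.
by rewrite aW aA /= xpair_eqE.
Qed.

Lemma cycle_vectorP i u : cycle_vector constraint_mx i u <->
  lin_cycle E (entries u) /\ (forall B A, #|A| != i -> entries u B A = 0).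
Proof.
rewrite /cycle_vector map_row_mx mul_mx_row; split.
- move/eqP; rewrite row_mx_eq0 => /andP[/eqP u1 /eqP u2].
  have u1' B A : forbidden i (B, A) -> entries u B A = 0.
    move=> bad; have /rowP/(_ (enum_rank (B, A))) := u1.
    rewrite !mxE (bigD1 (enum_rank (B, A))) //= !mxE eqxx enum_rankK bad mulr1n.
    rewrite [X in _ + X]big1 ?addr0 ?mulr1 // => p pq.
    by rewrite !mxE (negPf pq) mulr0n mpolyC0 mulr0.
  split=> [|B A Ai]; last by apply: u1'; rewrite /forbidden /= Ai !orbT.
  split=> [B A BE|B A AB|W A].
  + by apply: u1'; rewrite /forbidden /= BE.
  + by apply: u1'; rewrite /forbidden /= AB !orbT.
  + by rewrite -entries_cocycle u2 mxE.
- move=> [[u1 u2 u3] ui]; apply/eqP; rewrite row_mx_eq0; apply/andP; split; apply/eqP/rowP => q.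
    rewrite !mxE big1 // => p _; rewrite !mxE; case: eqVneq => [pq|_]; last first.
      by rewrite mulr0n mpolyC0 mulr0.
    subst q; case: (boolP (forbidden i _)) => [bad|_]; last by rewrite mul0rn mpolyC0 mulr0.
    have -> : u 0 p = entries u (enum_val p).1 (enum_val p).2.
      by rewrite /entries -surjective_pairing enum_valK.
    by case/or3P: bad => [/u1 ->|/u2 ->|/ui ->]; rewrite mul0r.
  by rewrite -[q]enum_valK; case: (enum_val q) => W A; rewrite entries_cocycle u3 mxE.
Qed.

Lemma entries_augmentation u : lin_cycle E (entries u) ->
  u *m augmentation_mx = (aug_map x (entries u))%:M.
Proof.
move=> [u1 _ _]; apply/matrixP => i j; rewrite !ord1 !mxE eqxx mulr1n.
pose F (BA : J) := if (BA.1 \in E) && (BA.2 == set0) then mon x BA.1 else 0.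
transitivity (\sum_p u 0 p * F (enum_val p)).
  by apply: eq_bigr => p _; rewrite mxE /F; case: (enum_val p).
rewrite sum_entries /F; apply: eq_bigr => B _ /=.
rewrite (bigD1 set0) //= eqxx andbT big1 ?addr0 => [|A /negPf ->]; last by rewrite andbF mulr0.
by case: (boolP (B \in E)) => // BE; rewrite u1 // !mul0r.
Qed.

Lemma mon_homog B : mon x B \is #|B|.-homog.
Proof.
rewrite /mon -sum1_card; apply: (big_rec2 (fun (p : R) k => p \is k.-homog)).
  exact: dhomog1.
by move=> v p k _ pk; apply: dhomogM pk; rewrite dhomogX; exact/eqP/mdeg1.
Qed.

Lemma koszul_mx_homog p q : koszul_mx p q \is 1.-homog.
Proof.
rewrite mxE; case: (enum_val p) (enum_val q) => [B A] [B' A'].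
apply: rpred_sum => v _; rewrite /sgn mulrC rpredMsign dhomogX; exact/eqP/mdeg1.
Qed.

Lemma augmentation_mx_homog p : augmentation_mx p 0 \is d.-homog.
Proof.
rewrite mxE; case: (enum_val p) => [B A]; case: ifP => [/andP[BE _]|_]; last exact: rpred0.
by rewrite -(Ed BE); apply: mon_homog.
Qed.

Lemma koszul_degree i (f : {set V} -> R) A : (forall A', #|A'| != i.+1 -> f A' = 0) ->
  #|A| != i -> koszul x f A = 0.
Proof.
move=> f0 Ai; apply: big1 => v _; rewrite /contract; case: ifPn => vA; rewrite ?mulr0 //.
by rewrite f0 ?mulr0 // cardsU1 vA.
Qed.

Lemma lin_cycle_degree i (g : {set V} -> {set V} -> R) : lin_cycle E g ->
  lin_cycle E (fun B A => if #|A| == i then g B A else 0).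
Proof.
move=> [g1 g2 g3]; split=> [B A BE|B A AB|W A].
- by rewrite g1 //; case: ifP.
- by rewrite g2 //; case: ifP.
- have [Ai|Ai] := boolP (#|A|.+1 == i).
    rewrite -[RHS](g3 W A); apply: eq_bigr => a _; rewrite /contract.
    by case: ifPn => // aA; rewrite cardsU1 aA add1n Ai.
  apply: big1 => a _; rewrite /contract; case: ifPn => // aA.
  by rewrite cardsU1 aA add1n (negPf Ai) mulr0.
Qed.

Lemma exact_degree i u : cycle_vector constraint_mx i u ->
  u *m koszul_mx = 0 -> aug_map x (entries u) = 0 ->
  exists2 w, cycle_vector constraint_mx i.+1 w & u = w *m koszul_mx.
Proof.
move=> /cycle_vectorP[uN ui] du au.
have [B A|g gN gE] := exE uN _ au.
  by rewrite -entries_koszul du /entries mxE.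
pose g' B A := if #|A| == i.+1 then g B A else 0.
exists (entry_vector g').
  apply/cycle_vectorP; split=> [|B A Ai]; last by rewrite entry_vectorK /g' (negPf Ai).
  by apply: eq_lin_cycle (lin_cycle_degree i.+1 gN) => B A; rewrite entry_vectorK.
apply: entriesP => B A; rewrite entries_koszul.
rewrite (eq_koszul x (z' := g' B)); last by move=> A'; rewrite entry_vectorK.
have [Ai|Ai] := eqVneq #|A| i.
  rewrite gE; apply: eq_bigr => v _; congr (_ * _); rewrite /contract.
  by case: ifPn => // vA; rewrite /g' cardsU1 vA Ai eqxx.
rewrite ui // (@koszul_degree i) // => A' A'i.
by rewrite /g' (negPf A'i).
Qed.

Lemma linear_strand_resolution (I : R -> Prop) :
  (forall f, I f <-> exists c : {set V} -> R, f = \sum_(B in E) c B * mon x B) ->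
  exists2 F : free_complex K #|V|, minimal_graded_resolution F I &
    forall i (k : 'I_(rk F i)), shift k = (i + d)%N.
Proof.
move=> IE; exists (strand_complex d constraint_mx koszul_mx augmentation_mx) => //.
apply: strand_complex_resolution.
- exact: koszul_mx_homog.
- exact: augmentation_mx_homog.
- move=> i u /cycle_vectorP[uN ui]; apply/cycle_vectorP; split.
    by apply: eq_lin_cycle (lin_cycle_koszul x uN) => B A; rewrite entries_koszul.
  by move=> B A Ai; rewrite entries_koszul (@koszul_degree i) // => A' /ui.
- move=> f; rewrite IE; split=> [[c ->]|[u /cycle_vectorP[uN u0]]].
    pose g B A := if (B \in E) && (A == set0) then c B else 0.
    have gN : lin_cycle E g.
      split=> [B A /negPf BE|B A|W A]; rewrite /g ?BE //.
        by case: eqVneq => [->|_]; rewrite ?andbF // disjoints_subset sub0set.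
      apply: big1 => a _; rewrite /contract; case: ifP => // _.
      have /negPf -> : a |: A != set0 by apply/set0Pn; exists a; rewrite setU11.
      by rewrite andbF mulr0.
    have gN' : lin_cycle E (entries (entry_vector g)).
      by apply: eq_lin_cycle gN => B A; rewrite entry_vectorK.
    exists (entry_vector g).
      apply/cycle_vectorP; split=> // B A; rewrite cards_eq0 entry_vectorK /g => /negPf ->.
      by rewrite andbF.
    rewrite (entries_augmentation gN'); apply: (congr1 (fun p : R => p%:M)).
    rewrite /aug_map big_mkcond.
    apply: eq_bigr => B _; rewrite entry_vectorK /g eqxx andbT.
    by case: ifP => // _; rewrite mul0r.
  rewrite (entries_augmentation uN) => /matrixP/(_ 0 0).
  rewrite [LHS]mxE [RHS]mxE eqxx !mulr1n => ->.
  exists (fun B => entries u B set0); rewrite [RHS]big_mkcond; apply: eq_bigr => B _.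
  by case: (boolP (B \in E)) => // BE; have [u1 _ _] := uN; rewrite u1 // mul0r.
- move=> u cu; have /cycle_vectorP[uN u0] := cu.
  rewrite entries_augmentation //; split=> [|[w /cycle_vectorP[wN _] uE]].
    move=> /matrixP/(_ 0 0); rewrite !mxE eqxx mulr1n => au.
    apply: exact_degree => //; apply: entriesP => B A; rewrite entries_koszul.
    rewrite /entries mxE; apply: big1 => v _; rewrite /contract; case: ifPn => vA; rewrite ?mulr0 //.
    by rewrite -/(entries u B (v |: A)) u0 ?mulr0 // cardsU1 vA.
  rewrite (_ : aug_map x (entries u) = 0) ?raddf0 // -(aug_koszul x wN).
  by apply: eq_aug_map => B; rewrite uE entries_koszul.
- move=> i u cu; have /cycle_vectorP[uN ui] := cu; split=> [du|[w _ ->]].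
    apply: exact_degree => //; apply: big1 => B _; rewrite ui ?mul0r //.
    by rewrite cards0.
  apply: entriesP => B A; rewrite entries_koszul /entries mxE.
  rewrite (eq_koszul x (z' := koszul x (entries w B))) ?koszul_sq // => A'.
  by rewrite -entries_koszul.
Qed.

End StrandMatrices.

(** * Comparison of minimal resolutions *)

Section Comparison.
Variables (K : fieldType) (n : nat).
Local Notation R := {mpoly K[n]}.

Lemma pihomogM c f (p q : R) : q \is f.-homog ->
  pihomog mdeg c (p * q) = if (f <= c)%N then pihomog mdeg (c - f) p * q else 0.
Proof.
move=> qf; rewrite {1 2}[p]mpolyE mulr_suml !raddf_sum /= mulr_suml.
rewrite (_ : (if _ then _ else 0) = \sum_(m <- msupp p)
    if (f <= c)%N then pihomog mdeg (c - f) (p@_m *: 'X_[m]) * q else 0); last first.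
  by case: ifP => // _; rewrite big1.
apply: eq_bigr => m _; rewrite -scalerAl !linearZ /= pihomogX.
have mq : 'X_[m] * q \is (mdeg m + f).-homog.
  by apply: dhomogM => //; rewrite dhomogX.
have [fc|cf] := leqP f c; last first.
  rewrite (pihomog_ne0 (d := mdeg m + f)) ?scaler0 //.
  by rewrite gtn_eqF // (leq_trans cf) // leq_addl.
have [mE|mE] := eqVneq (mdeg m) (c - f)%N.
  rewrite -scalerAl; congr (_ *: _); apply: pihomog_dE.
  by rewrite -(subnK fc) -mE.
rewrite scaler0 mul0r (pihomog_ne0 (d := mdeg m + f)) ?scaler0 //.
by apply: contraNneq mE => <-; rewrite addnK.
Qed.

Definition graded_mx p q (s : 'I_p -> nat) t (A : 'M[R]_(p, q)) :=
  forall k l, if (t <= s k)%N then A k l \is (s k - t).-homog else A k l == 0.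

(** Keep from the entries of the lift [W] the components of the right degree. *)
Lemma homogeneous_lift p q r (s : 'I_p -> nat) t f (W : 'M[R]_(p, q)) (D : 'M[R]_(q, r)) :
  (forall k l, D k l \is f.-homog) -> graded_mx s t (W *m D) ->
  exists2 W', graded_mx s (t + f) W' & W *m D = W' *m D.
Proof.
move=> Df grM.
exists (\matrix_(k, l) if (t + f <= s k)%N then pihomog mdeg (s k - (t + f)) (W k l) else 0).
  by move=> k l; rewrite mxE; case: (t + f <= s k)%N; rewrite ?eqxx //; apply: pihomogP.
apply/matrixP => k l; have := grM k l; case: leqP => [ts|st /eqP ->]; last first.
  rewrite mxE big1 // => j _; rewrite mxE leqNgt (leq_trans st) ?leq_addr ?mul0r //.
move/pihomog_dE => <-; rewrite !mxE raddf_sum; apply: eq_bigr => j _ /=.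
rewrite (pihomogM _ _ (Df j l)) mxE leq_subRL // subnDA.
by case: ifP; rewrite ?mul0r.
Qed.

Lemma row_lift p q r (A : 'M[R]_(p, r)) (D : 'M[R]_(q, r)) :
  (forall k, exists w : 'rV_q, row k A = w *m D) -> exists W, A = W *m D.
Proof.
move=> h; have [W WE] := fin_all_exists h.
by exists (\matrix_k W k); apply/row_matrixP => k; rewrite row_mul rowK.
Qed.

Lemma exact_lift p q r c (A : 'M[R]_(p, q)) (D : 'M[R]_(q, c)) (D' : 'M[R]_(r, q)) :
  (forall v : 'rV_q, v *m D = 0 <-> exists w, v = w *m D') ->
  A *m D = 0 -> exists W, A = W *m D'.
Proof.
move=> ex AD; apply: row_lift => k; apply/ex.
by rewrite -row_mul AD row0.
Qed.

Lemma aug_lift q r (I : R -> Prop) (A : 'cV[R]_r) (D : 'cV[R]_q) :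
  (forall f, I f <-> exists v : 'rV_r, f%:M = v *m A) ->
  (forall f, I f <-> exists v : 'rV_q, f%:M = v *m D) ->
  exists W, A = W *m D.
Proof.
move=> IA ID; apply: row_lift => k.
have /ID[w wE] : I (A k 0).
  apply/IA; exists (delta_mx 0 k); rewrite -rowE.
  by apply/matrixP => i j; rewrite !ord1 !mxE eqxx mulr1n.
by exists w; rewrite -wE; apply/matrixP => i j; rewrite !ord1 !mxE eqxx mulr1n.
Qed.

Lemma mcoeff0_mul0 p q r (A : 'M[R]_(p, q)) (B : 'M[R]_(q, r)) k l :
  (forall j, (A k j)@_0%MM = 0 \/ (B j l)@_0%MM = 0) -> ((A *m B) k l)@_0%MM = 0.
Proof.
move=> AB; rewrite mxE raddf_sum big1 // => j _ /=; rewrite rmorphM /=.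
by case: (AB j) => ->; rewrite ?mul0r ?mulr0.
Qed.

Section Bound.
Variables (I : R -> Prop) (d : nat) (F G : free_complex K n).
Hypotheses (Fres : minimal_graded_resolution F I) (Gres : minimal_graded_resolution G I).
Hypothesis Flin : forall i (k : 'I_(rk F i)), shift k = (i + d)%N.

(** A stage of the construction of comparison maps between [G] and [F] and of
    a homotopy [S] from their composite to the identity.  The matrix [X] stands
    for the preceding homotopy composed with the differential, whose entries
    have no constant term. *)
Definition comparison_at i (Phi : 'M[R]_(rk G i, rk F i)) : Prop :=
  exists (Psi : 'M[R]_(rk F i, rk G i)) (X : 'M[R]_(rk G i)) (S : 'M[R]_(rk G i, rk G i.+1)),
  [/\ graded_mx (@shift _ _ G i) (i + d) Phi,
      exists Phi', diff G i *m Phi = Phi' *m diff F i,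
      exists Psi', diff F i *m Psi = Psi' *m diff G i,
      1%:M - Phi *m Psi = X + S *m diff G i &
      diff G i *m X = 0 /\ forall k l, (X k l)@_0%MM = 0].

Let FD i (k : 'I_(rk F i.+1)) l : diff F i k l \is 1.-homog.
Proof.
have := diff_homog Fres k l.
by rewrite !Flin leq_add2r leqnSn subnDr subSnn.
Qed.

Let GDD i : diff G i.+1 *m diff G i = 0.
Proof.
apply/row_matrixP => k; rewrite row_mul row0; apply/(exact_succ Gres).
by exists (delta_mx 0 k); rewrite -rowE.
Qed.

Let FDD i : diff F i.+1 *m diff F i = 0.
Proof.
apply/row_matrixP => k; rewrite row_mul row0; apply/(exact_succ Fres).
by exists (delta_mx 0 k); rewrite -rowE.
Qed.

Let GDa : diff G 0 *m aug G = 0.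
Proof.
apply/row_matrixP => k; rewrite row_mul row0; apply/(exact_zero Gres).
by exists (delta_mx 0 k); rewrite -rowE.
Qed.

Let FDa : diff F 0 *m aug F = 0.
Proof.
apply/row_matrixP => k; rewrite row_mul row0; apply/(exact_zero Fres).
by exists (delta_mx 0 k); rewrite -rowE.
Qed.

Lemma comparison i : exists Phi, @comparison_at i Phi.
Proof.
elim: i => [|i [Phi [Psi [X [S [grPhi [Phi' PhiE] [Psi' PsiE] hom [DX X0]]]]]]].
- have [Phi0 aE0] := aug_lift (aug_image Gres) (aug_image Fres).
  have [Psi pE] := aug_lift (aug_image Fres) (aug_image Gres).
  have [k l||Phi grPhi aE] := @homogeneous_lift _ _ _ (@shift _ _ G 0) 0 d Phi0 (aug F).
  + by have := aug_homog Fres k; rewrite Flin ord1.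
  + by move=> k l; rewrite -aE0 leq0n subn0 ord1; apply: aug_homog Gres k.
  rewrite -aE0 in aE.
  have [S SE] : exists S, 1%:M - Phi *m Psi = S *m diff G 0.
    apply: exact_lift (exact_zero Gres) _.
    by rewrite mulmxBl mul1mx -mulmxA -pE -aE subrr.
  exists Phi, Psi, 0, S; split => //.
  + by apply: exact_lift (exact_zero Fres) _; rewrite -mulmxA -aE GDa.
  + by apply: exact_lift (exact_zero Gres) _; rewrite -mulmxA -pE FDa.
  + by rewrite add0r.
  + by rewrite mulmx0; split => // k l; rewrite mxE mcoeff0.
have [k l|k l|Phi1 grPhi1 Phi1E] :=
    @homogeneous_lift _ _ _ (@shift _ _ G i.+1) (i + d) 1 Phi' (diff F i).
- exact: FD.
- rewrite -PhiE mxE; case: ifPn => sk.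
    apply: rpred_sum => j _; have := diff_homog Gres k j; have := grPhi j l.
    case: ifPn => [tj|_ /eqP ->]; last by rewrite mulr0 rpred0.
    move=> Pj; case: ifPn => [jk Dj|_ /eqP ->]; last by rewrite mul0r rpred0.
    by have := dhomogM Dj Pj; rewrite addnBA // subnK.
  rewrite big1 // => j _; have := diff_homog Gres k j; have := grPhi j l.
  case: ifPn => [tj|_ /eqP ->]; last by rewrite mulr0.
  case: ifPn => [jk|_ _ /eqP ->]; last by rewrite mul0r.
  by rewrite (leq_trans tj jk) in sk.
have Phi1D : diff G i *m Phi = Phi1 *m diff F i by rewrite PhiE Phi1E.
have [S1 S1E] : exists S1, 1%:M - Phi1 *m Psi' - diff G i *m S = S1 *m diff G i.+1.
  apply: exact_lift (@exact_succ _ _ _ _ Gres i) _.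
  rewrite !mulmxBl mul1mx -!mulmxA -PsiE [Phi1 *m _]mulmxA -Phi1D.
  have := congr1 (mulmx (diff G i)) hom; rewrite mulmxBr mulmx1 mulmxDr DX add0r => <-.
  by rewrite -mulmxA subrr.
exists Phi1, Psi', (diff G i *m S), S1; split.
- by move: grPhi1; rewrite addn1 addSn.
- apply: exact_lift (@exact_succ _ _ _ _ Fres i) _.
  by rewrite -mulmxA -Phi1D mulmxA GDD mul0mx.
- apply: exact_lift (@exact_succ _ _ _ _ Gres i) _.
  by rewrite -mulmxA -PsiE mulmxA FDD mul0mx.
- by rewrite -S1E [RHS]addrC subrK.
- split; first by rewrite mulmxA GDD mul0mx.
  by move=> k l; apply: mcoeff0_mul0 => j; left; apply: (minimality Gres).
Qed.

(** Modulo the irrelevant ideal the composite of the comparison maps is the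
    identity.  If [k] had a larger degree, then the entries of its row in the
    graded matrix [Phi] would have positive degree, and the diagonal entry of
    the composite would have no constant term. *)
Lemma linear_shift_bound i (k : 'I_(rk G i)) : (shift k <= i + d)%N.
Proof.
have [Phi [Psi [X [S [grPhi _ _ hom [_ X0]]]]]] := comparison i.
rewrite leqNgt; apply/negP => lt.
have PhiPsi0 : ((Phi *m Psi) k k)@_0%MM = 0.
  apply: mcoeff0_mul0 => j; left; have := grPhi k j; rewrite ltnW // => Pk.
  by apply: (dhomog_nemf_coeff Pk); rewrite mf0 eq_sym -lt0n subn_gt0.
have SD0 : ((S *m diff G i) k k)@_0%MM = 0.
  by apply: mcoeff0_mul0 => j; right; apply: (minimality Gres).
move: (Phi *m Psi) (S *m diff G i) PhiPsi0 SD0 hom => P Q P0 Q0 /matrixP/(_ k k).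
rewrite !mxE eqxx => /(congr1 (mcoeff 0%MM)).
rewrite mcoeffB mcoeffD P0 Q0 X0 mcoeff1 eqxx subr0 addr0 => /eqP.
by rewrite oner_eq0.
Qed.

End Bound.

End Comparison.

Lemma ideal_gen_image (K : fieldType) (n : nat) (W : finType) (D : {set W})
    (F : W -> {mpoly K[n]}) f :
  ideal_gen [seq F B | B in D] f <-> exists c : W -> {mpoly K[n]}, f = \sum_(B in D) c B * F B.
Proof.
rewrite /image_mem -/(enum D); set r := enum D.
have eq_size : size r = size [seq F B | B <- r] by rewrite size_map.
have sumE (c : W -> {mpoly K[n]}) : \sum_(B in D) c B * F B =
    \sum_(i < size [seq F B | B <- r]) c (tnth (in_tuple r) (cast_ord (esym eq_size) i)) *
      [seq F B | B <- r]`_i.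
  rewrite -big_enum big_tnth (reindex (cast_ord (esym eq_size))) /=; last first.
    by exists (cast_ord eq_size) => i _; rewrite ?cast_ordK ?cast_ordKV.
  apply: eq_bigr => i _; congr (_ * _).
  set B := tnth _ _; rewrite (nth_map B) ?eq_size //.
  by congr F; rewrite {1}/B (tnth_nth B).
split=> [[c ->]|[c ->]]; last by rewrite sumE; eexists.
exists (fun B => if insub (index B r) is Some i then c (cast_ord eq_size i) else 0).
rewrite sumE; apply: eq_bigr => i _; congr (_ * _).
set B := tnth _ _; have -> : index B r = i.
  by rewrite {1}/B (tnth_nth B) /= index_uniq ?enum_uniq // eq_size.
case: insubP => [j _ ji|]; last by rewrite eq_size ltn_ord.
by congr c; apply: val_inj; rewrite /= ji.
Qed.

Lemma conn_clutter_uniform (V : finType) (g : rel V) r : uniform r.+1 (conn_clutter r g).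
Proof. by move=> S; rewrite inE => /andP[/eqP]. Qed.

Lemma compl_clutterK (V : finType) d (E : {set {set V}}) : uniform d E ->
  compl_clutter d (compl_clutter d E) = E.
Proof.
move=> uE; apply/setP => S; rewrite !inE; case: (boolP (S \in E)) => [/uE ->|_].
  by rewrite eqxx.
by rewrite andbT; case: eqP.
Qed.

Section LinearResolution.
Variables (K : fieldType) (n d : nat) (I : {mpoly K[n]} -> Prop) (F : free_complex K n).
Hypothesis Fres : minimal_graded_resolution F I.
Hypothesis Flin : forall i (k : 'I_(rk F i)), shift k = (i + d)%N.

Lemma linear_graded_betti i j : j != (i + d)%N -> graded_betti I i j 0.
Proof.
move=> ij; exists F => //; rewrite (_ : [set _ | _] = set0) ?cards0 //.
by apply/setP => k; rewrite !inE Flin eq_sym (negPf ij).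
Qed.

Lemma linear_regularity f : I f -> f != 0 -> is_regularity I d.
Proof.
move=> If f0; split.
  exists 0%N, d, (rk F 0); split => //.
    exists F => //; rewrite (_ : [set _ | _] = setT) ?cardsT ?card_ord //.
    by apply/setP => k; rewrite !inE Flin eqxx.
  apply: contraNneq f0 => rk0; have [/(_ If)[v fE] _] := aug_image Fres f.
  apply/eqP; move/matrixP/(_ 0 0): fE; rewrite !mxE eqxx mulr1n => ->.
  by rewrite big1 // => j; have := ltn_ord j; rewrite {2}rk0.
move=> i j b [G Gres ->]; rewrite cards_eq0 => /set0Pn[k]; rewrite inE => /eqP <-.
exact: linear_shift_bound Fres Gres Flin _ _.
Qed.

End LinearResolution.

(** * The theorem *)

Local Close Scope ring_scope.

Theorem theorem1p1 (V : finType) (g : rel V) (g_simple : simple_graph g)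
  (g_no_isolated : no_isolated g)
  (g_family : co_chordal_cactus g \/ twoK2_C4_free g \/ co_grid g)
  (r : nat) (r_ge2 : 2 <= r) :
  co_chordal r.+1 (conn_clutter r g) /\
  (forall K : fieldType,
     linear_resolution r.+1 (conn_ideal K r V g) /\
     (conn_clutter r g != set0 -> is_regularity (conn_ideal K r V g) r.+1)).
Proof.
have coch : co_chordal r.+1 (conn_clutter r g).
  case: g_family => [|[]] fam.
  - exact: co_chordal_cactus_co_chordal.
  - exact: twoK2_C4_free_co_chordal.
  - exact: co_grid_co_chordal.
split => // K; set E := conn_clutter r g.
have uE : uniform r.+1 E := @conn_clutter_uniform V g r.
have exE : strand_exact (@vertex_var K V) E.
  rewrite -(compl_clutterK uE); apply: chordal_exact => // S.
  by rewrite compl_clutterE => /andP[/eqP].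
have IE := ideal_gen_image E (mon (@vertex_var K V)).
have [F Fres Flin] := linear_strand_resolution uE exE IE.
split; [split|].
- exists [seq mon (@vertex_var K V) B | B in E] => //.
  by move=> _ /imageP[B BE ->]; rewrite -(uE B BE); apply: mon_homog.
- by move=> i j; apply: (linear_graded_betti Fres Flin).
case/set0Pn => B BE; apply: (linear_regularity Fres Flin (f := mon (@vertex_var K V) B)).
  apply/IE; exists (fun B' => (B' == B)%:R%R).
  rewrite (bigD1 B) //= eqxx mul1r big1 ?addr0 // => B' /andP[_ /negPf ->].
  by rewrite mul0r.
apply/eqP => B0; have := mon_regular (@vertex_var_regular K V) (B := B) (y := 1%R).
by rewrite B0 mul0r => /(_ erefl)/eqP; rewrite oner_eq0.
Qed.
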